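(* For any $\gamma>0$ the operator $\hbar_\gamma(0)$ has a zero-energy resonance. For any $\gamma>0$ and all $k\in\mathbb{T}^3\setminus\{0\}$ the operator $\hbar_\gamma(k)$ has a unique positive eigenvalue $z_\gamma(k)$ below the bottom of the essential spectrum of $\hbar_\gamma(k)$, and the function $k\mapsto z_\gamma(k)$ is even and real-analytic in $\mathbb{T}^3\setminus\{0\}$.
   Context: $\mathbb{T}^3=(-\pi,\pi]^3$ is the three-dimensional torus (opposite sides identified, addition modulo $(2\pi\mathbb{Z})^3$). Put $\varepsilon(p)=\sum_{i=1}^3(1-\cos p^{(i)})$ for $p=(p^{(1)},p^{(2)},p^{(3)})\in\mathbb{T}^3$, $\mu_0=(2\pi)^3\big(\int_{\mathbb{T}^3}\varepsilon(p)^{-1}dp\big)^{-1}$ and $v(\gamma)=\mu_0(1+\gamma)$ for $\gamma>0$. For $k\in\mathbb{T}^3$ the operator $\hbar_\gamma(k)$ on $L_2(\mathbb{T}^3)$ is $\hbar_\gamma(k)=h^0_\gamma(k)-v(\gamma)\,v$, where $(h^0_\gamma(k)f)(q)=\mathcal{E}_{k,\gamma}(q)f(q)$, $\mathcal{E}_{k,\gamma}(q)=\varepsilon(q)+\gamma\varepsilon(k-q)$, and $(vf)(q)=(2\pi)^{-3}\int_{\mathbb{T}^3}f(q')dq'$. Its essential spectrum is $[m(k,\gamma),M(k,\gamma)]$ with $m(k,\gamma)=\min_p\mathcal{E}_{k,\gamma}(p)$, $M(k,\gamma)=\max_p\mathcal{E}_{k,\gamma}(p)$. Zero-energy resonance: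 $\hbar_\gamma(0)$ is said to have a zero-energy resonance if the number $1$ is an eigenvalue of the rank-one operator $G_\gamma=v(\gamma)\,v^{1/2}(h^0_\gamma(0))^{-1}v^{1/2}$ on $L_2(\mathbb{T}^3)$, that is, $(G_\gamma f)(p)=\frac{v(\gamma)}{(2\pi)^{6}}\int_{\mathbb{T}^3}\frac{dq}{(1+\gamma)\varepsilon(q)}\int_{\mathbb{T}^3}f(q')dq'$, and the associated eigenfunction $\psi$ satisfies $(v^{1/2}\psi)(0)\neq0$ (here $v^{1/2}=v$, so $v^{1/2}\psi$ is a constant function). *)

(* Defs.v *)
From HB Require Import structures.
From mathcomp Require Import all_boot all_order all_algebra.
From mathcomp Require Import complex.
From mathcomp Require Import all_classical all_reals all_analysis.
Import Order.TTheory GRing.Theory Num.Theory.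
Import numFieldNormedType.Exports.
Set Implicit Arguments.
Unset Strict Implicit.
Unset Printing Implicit Defensive.
Local Open Scope classical_set_scope.
Local Open Scope ring_scope.
Local Open Scope complex_scope.

(* Points of T^3 are represented in R^3 by the fundamental domain (-pi, pi]^3;
   a function on T^3 is a function on R^3 of which only the values on [torus]
   matter. *)
Notation R3 R := (R * R * R)%type.

Notation leb3 R :=
  ((@lebesgue_measure R \x @lebesgue_measure R) \x @lebesgue_measure R)%E.

Definition torus (R : realType) : set (R3 R) :=
  `]- pi, pi] `*` `]- pi, pi] `*` `]- pi, pi].

(* [mod2pi1 t] is the representative of t modulo 2 pi in (-pi, pi]. *)
Definition mod2pi1 (R : realType) (t : R) : R :=
  t - (Num.ceil ((t - pi) / (2 * pi)))%:~R * (2 * pi).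

Definition mod2pi (R : realType) (p : R3 R) : R3 R :=
  (mod2pi1 p.1.1, mod2pi1 p.1.2, mod2pi1 p.2).

(* f is, on a cube around k, the sum of an absolutely convergent power series
   in three variables. *)
Definition real_analytic_at (R : realType) (f : R3 R -> R) (k : R3 R) : Prop :=
  exists (c : nat * nat * nat -> R) (r : R), 0 < r /\
    forall x : R3 R, `|x - k| < r ->
      let a (n : nat * nat * nat) := c n * (x.1.1 - k.1.1) ^+ n.1.1
        * (x.1.2 - k.1.2) ^+ n.1.2 * (x.2 - k.2) ^+ n.2 in
      summable [set: nat * nat * nat] (fun n => (a n)%:E) /\
      (fun N : nat => \sum_(i < N) \sum_(j < N) \sum_(l < N)
         a (nat_of_ord i, nat_of_ord j, nat_of_ord l)) @ \oo --> f x.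

(* Analyticity at a point of the torus is that of the 2 pi-periodic
   extension: the quotient map R^3 -> T^3 is a local analytic chart. *)
Definition torus_real_analytic_at (R : realType) (f : R3 R -> R) (k : R3 R)
  : Prop := real_analytic_at (fun x => f (mod2pi x)) k.

(* The complex space L_2(T^3); its elements are represented by functions,
   equality being equality almost everywhere on the torus. *)

Definition L2 (R : realType) (f : R3 R -> R[i]) : Prop :=
  let T : set (R3 (measurableTypeR R)) := @torus R in
  [/\ measurable_fun T (fun p => complex.Re (f p)),
      measurable_fun T (fun p => complex.Im (f p)) &
      (\int[leb3 R]_(p in T) (ComplexField.Normc.normc (f p) ^+ 2)%:E
         < +oo)%E].

Definition L2norm (R : realType) (f : R3 R -> R[i]) : R :=
  Num.sqrt (\int[leb3 R]_(p in @torus R)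
              (ComplexField.Normc.normc (f p) ^+ 2))%R.

Definition eq_ae (R : realType) (f g : R3 R -> R[i]) : Prop :=
  ae_eq (leb3 R) (@torus R) f g.

Definition cintegral (R : realType) (f : R3 R -> R[i]) : R[i] :=
  ((\int[leb3 R]_(p in @torus R) complex.Re (f p))%R
   +i* (\int[leb3 R]_(p in @torus R) complex.Im (f p))%R)%C.

(* Spectral notions for an everywhere defined operator A on L_2(T^3). They are
   only used for self-adjoint A, whose spectrum is contained in R, so spectral
   parameters are real. *)

Definition op_shift (R : realType) (A : (R3 R -> R[i]) -> (R3 R -> R[i]))
    (lambda : R) (f : R3 R -> R[i]) : R3 R -> R[i] :=
  fun q => A f q - lambda%:C * f q.

Definition eigenfunction (R : realType)
    (A : (R3 R -> R[i]) -> (R3 R -> R[i])) (lambda : R) (f : R3 R -> R[i])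
  : Prop :=
  [/\ L2 f, ~ eq_ae f (fun=> 0) & eq_ae (A f) (fun q => lambda%:C * f q)].

Definition is_eigenvalue (R : realType)
    (A : (R3 R -> R[i]) -> (R3 R -> R[i])) (lambda : R) : Prop :=
  exists f, eigenfunction A lambda f.

Definition finite_multiplicity (R : realType)
    (A : (R3 R -> R[i]) -> (R3 R -> R[i])) (lambda : R) : Prop :=
  exists (n : nat) (e : 'I_n -> R3 R -> R[i]),
    (forall i, L2 (e i)) /\
    forall f, eigenfunction A lambda f ->
      exists c : 'I_n -> R[i], eq_ae f (fun q => \sum_(i < n) c i * e i q).

(* A - lambda is a bijection of L_2(T^3) with bounded inverse. *)
Definition resolvent_set (R : realType)
    (A : (R3 R -> R[i]) -> (R3 R -> R[i])) : set R :=
  [set lambda | (exists C : R, forall f, L2 f ->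
                   L2norm f <= C * L2norm (op_shift A lambda f)) /\
                (forall g, L2 g ->
                   exists2 f, L2 f & eq_ae (op_shift A lambda f) g)].

Definition spectrum (R : realType) (A : (R3 R -> R[i]) -> (R3 R -> R[i]))
  : set R := ~` resolvent_set A.

Definition discrete_spectrum (R : realType)
    (A : (R3 R -> R[i]) -> (R3 R -> R[i])) : set R :=
  [set lambda | [/\ isolated (spectrum A) lambda, is_eigenvalue A lambda &
                    finite_multiplicity A lambda]].

Definition essential_spectrum (R : realType)
    (A : (R3 R -> R[i]) -> (R3 R -> R[i])) : set R :=
  spectrum A `\` discrete_spectrum A.

Definition ess_bottom (R : realType) (A : (R3 R -> R[i]) -> (R3 R -> R[i]))
  : R := inf (essential_spectrum A).

Definition dispersion (R : realType) (p : R3 R) : R :=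
  (1 - cos p.1.1) + (1 - cos p.1.2) + (1 - cos p.2).

Definition mu0 (R : realType) : R :=
  (2 * pi) ^+ 3 * (\int[leb3 R]_(p in @torus R) (dispersion p)^-1)%R^-1.

Definition coupling (R : realType) (gamma : R) : R := mu0 R * (1 + gamma).

(* No reduction modulo 2 pi of k - q is needed, [dispersion] being periodic. *)
Definition calE (R : realType) (k : R3 R) (gamma : R) (q : R3 R) : R :=
  dispersion q + gamma * dispersion (k - q).

Definition h0 (R : realType) (gamma : R) (k : R3 R) (f : R3 R -> R[i])
  : R3 R -> R[i] := fun q => (calE k gamma q)%:C * f q.

(* The inverse of [h0 gamma 0]; calE 0 gamma vanishes on the torus only at 0. *)
Definition h0inv (R : realType) (gamma : R) (f : R3 R -> R[i])
  : R3 R -> R[i] := fun q => ((calE 0 gamma q)^-1)%:C * f q.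

(* v is an orthogonal projection, so that it is its own square root. *)
Definition vop (R : realType) (f : R3 R -> R[i]) : R3 R -> R[i] :=
  fun=> (((2 * pi) ^+ 3)^-1)%:C * cintegral f.

Definition hop (R : realType) (gamma : R) (k : R3 R) (f : R3 R -> R[i])
  : R3 R -> R[i] := fun q => h0 gamma k f q - (coupling gamma)%:C * vop f q.

Definition Gop (R : realType) (gamma : R) (f : R3 R -> R[i])
  : R3 R -> R[i] :=
  fun p => (coupling gamma)%:C * vop (h0inv gamma (vop f)) p.

Definition zero_energy_resonance (R : realType) (gamma : R) : Prop :=
  is_eigenvalue (Gop gamma) 1 /\
  forall psi, eigenfunction (Gop gamma) 1 psi -> vop psi 0 != 0.

(* Main.v *)
Require Import Defs.
From HB Require Import structures.
From mathcomp Require Import all_boot all_order all_algebra.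
From mathcomp Require Import complex.
From mathcomp Require Import all_classical all_reals all_analysis.
From mathcomp Require Import measurable_realfun ring lra.
Import Order.TTheory GRing.Theory Num.Theory.
Import numFieldNormedType.Exports.
Set Implicit Arguments.
Unset Strict Implicit.
Unset Printing Implicit Defensive.
Local Open Scope classical_set_scope.
Local Open Scope ring_scope.
Local Open Scope complex_scope.

(** The perturbation in [hop gamma k] has rank one, so everything is governed
    by the scalar function
      F k l = \int_T dq / (calE k gamma q - l)          ([inv_symbol_integral]).
    Below the minimum m = [band_bottom gamma k] of the symbol, l is an
    eigenvalue exactly when F k l equals [critical gamma], the integral of
    1 / dispersion divided by 1 + gamma: solving (E - l) f = const for f and
    integrating gives this equation, whose solution is simple and has
    eigenfunction 1 / (E - l), while for F k l != critical the same computation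
    bounds the inverse of the operator ([eigenvalue_critical],
    [eigenfunction_inv], [resolvent_below]).  The coupling constant is tuned so
    that F 0 0 = critical gamma: at k = 0 the constants are fixed by [Gop],
    which is the resonance.

    Existence and uniqueness for k != 0.  F k is continuous and strictly
    increasing below m, so it remains to compare its values with the critical
    one.  At l = 0, convexity of the inverse gives
    1 / (x + gamma y) <= (1 / x + gamma / y) / (1 + gamma)^2 with x and y the
    dispersions at q and k - q; both have the same integral of the inverse by
    translation invariance, and the inequality is strict on a box when k != 0
    ([inv_symbol_integral0_lt]).  Near m, the symbol is, up to a translation in
    q, the sum of m and of a_i (1 - cos q_i), with amplitudes a_i <= 1 + gamma
    that do not exceed those of the symbol at k = 0 and at least one of which
    is smaller: hence F k l exceeds the critical value when l is close to m
    ([inv_symbol_integral_gt]).  That 1 / dispersion is integrable at all is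
    the three-dimensional fact [integrable_inv_dispersion].

    Bottom of the essential spectrum.  Below m the spectrum consists of at most
    one isolated simple eigenvalue.  Every value of the symbol is in the
    spectrum, because functions of mean zero concentrated near a point are not
    affected by the rank-one term ([spectrum_calE]).  So m is in the spectrum,
    and it is not discrete: either the symbol is not constant and m is a limit
    of values of the symbol, or the symbol is constant and m is an eigenvalue
    of infinite multiplicity ([ess_bottomE]).

    Evenness and periodicity follow from the fact that F and m depend on k only
    through the cosines of its coordinates ([level_ext]).

    Analyticity.  The equation F (k + h) (z k + Y) = F k (z k) is solved for Y
    by a Newton iteration inside a class of convergent power series in h with
    coefficients depending measurably on a parameter q ([analytic_family]).
    The class carries a majorant norm, for which it is stable under products,
    inverses near an invertible constant, sums of series and integration in q;
    in this norm the iteration is a contraction ([implicit_level]), so its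
    limit is again a power series. *)

(** * Absolutely convergent series *)

Section AbsSeries.
Variable R : realType.

Lemma cvg_le_of_near (F : set_system nat) {FF : ProperFilter F} (u : nat -> R)
    (l x : R) : u @ F --> l -> (\forall n \near F, u n <= x) -> l <= x.
Proof. by move=> ul ux; rewrite -(cvg_lim _ ul)//; apply: limr_le => //; exact: cvgP ul. Qed.

Lemma cvg_sum_seq (I : Type) (s : seq I) (u : I -> nat -> R) (l : I -> R) :
  (forall i, u i @ \oo --> l i) ->
  (fun n => \sum_(i <- s) u i n) @ \oo --> \sum_(i <- s) l i.
Proof.
move=> ul; elim: s => [|i s IH].
  by under eq_fun do rewrite big_nil; rewrite big_nil; exact: cvg_cst.
under eq_fun do rewrite big_cons; rewrite big_cons; exact: cvgD.
Qed.

Implicit Types (a b : nat -> R) (B : R).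

Lemma sum_uniq_nat (s : seq nat) (K : nat) (F : nat -> R) :
  uniq s -> {in s, forall j, (j < K)%N} ->
  \sum_(j <- s) F j = \sum_(0 <= j < K | j \in s) F j.
Proof.
move=> us sK; rewrite -[RHS]big_filter; apply: perm_big.
apply: uniq_perm => // [|j]; first exact/filter_uniq/iota_uniq.
rewrite mem_filter mem_index_iota /=; case: (boolP (j \in s)) => //= js.
by rewrite sK.
Qed.

(** Absolute convergence makes the tails small uniformly over all finite sets of
    large indices; this is what allows rearrangements below. *)
Lemma abs_series_tail b B :
  (forall n, \sum_(0 <= i < n) `|b i| <= B) ->
  forall e, 0 < e -> exists J, forall s : seq nat, uniq s ->
    {in s, forall j, (J <= j)%N} -> \sum_(j <- s) `|b j| <= e.
Proof.
move=> bB e e0.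
pose S := [set x | exists n, x = \sum_(0 <= i < n) `|b i|].
have hS : has_sup S.
  split; first by exists 0; exists 0%N; rewrite big_geq.
  by exists B => x [n ->]; exact: bB.
have [_ [J ->] HJ] := sup_adherent e0 hS.
exists J => s us sJ; pose K := (\max_(j <- s) j).+1.
have sK : {in s, forall j, (j < K)%N}.
  by move=> j js; rewrite ltnS; exact: leq_bigmax_seq.
have [JK|KJ] := leqP J K; last first.
  rewrite (_ : s = [::]) ?big_nil ?ltW//.
  clearbody K; case: s us sJ sK => // j s us sJ sK.
  have := sJ j (mem_head _ _); have := sK j (mem_head _ _).
  by move=> h1 h2; have := leq_ltn_trans h2 (ltn_trans h1 KJ); rewrite ltnn.
rewrite (sum_uniq_nat _ us sK).
have : \sum_(0 <= j < K) `|b j| <= sup S.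
  by apply: sup_upper_bound => //; exists K.
rewrite (@big_cat_nat _ _ _ J)//= => h.
have -> : \sum_(0 <= j < K | j \in s) `|b j| =
          \sum_(J <= j < K | j \in s) `|b j|.
  rewrite (@big_cat_nat _ _ _ J)//= big_nat_cond big1 ?add0r// => i.
  move=> /andP[/andP[_ iJ] /sJ]; by rewrite leqNgt iJ.
have : \sum_(J <= j < K | j \in s) `|b j| <= \sum_(J <= j < K) `|b j|.
  rewrite [leLHS]big_mkcond/=; apply: ler_sum => i _.
  by case: ifP.
lra.
Qed.

(** Unconditional summability in a quantitative form: a finite sum over any set
    of indices that catches the first nonzero terms is close to the partial
    sums.  Both the enumeration of double series and the passage to sums over
    growing boxes of exponents rest on it. *)
Lemma abs_series_close b B : (forall n, \sum_(0 <= i < n) `|b i| <= B) ->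
  forall e, 0 < e -> exists J0, forall J (s : seq nat), (J0 <= J)%N -> uniq s ->
    (forall j, (j < J0)%N -> b j != 0 -> j \in s) ->
    `|\sum_(j <- s) b j - \sum_(0 <= j < J) b j| <= e.
Proof.
move=> bB e e0; have e20 : 0 < e / 2 by lra.
have [J0 HJ0] := abs_series_tail bB e20.
exists J0 => J s J0J us sJ.
have h (t : seq nat) : uniq t -> (forall j, (j < J0)%N -> b j != 0 -> j \in t) ->
    `|\sum_(j <- t) b j - \sum_(0 <= j < J0) b j| <= e / 2.
  move=> ut tJ.
  rewrite (bigID (fun j => j < J0)%N)/=.
  have -> : \sum_(j <- t | (j < J0)%N) b j = \sum_(0 <= j < J0) b j.
    have tJ0 : {in [seq j <- t | (j < J0)%N], forall j, (j < J0)%N}.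
      by move=> j; rewrite mem_filter => /andP[].
    rewrite -big_filter (sum_uniq_nat _ _ tJ0) ?filter_uniq//.
    rewrite big_mkcond; apply: eq_big_nat => j /= jJ0.
    rewrite mem_filter jJ0/=; case: ifPn => // jt.
    by apply/esym/eqP/negPn/negP => /(tJ _ jJ0); exact/negP.
  rewrite addrAC subrr add0r (le_trans (ler_norm_sum _ _ _))//.
  rewrite -big_filter HJ0 ?filter_uniq// => j.
  by rewrite mem_filter -leqNgt => /andP[].
have h1 := h s us sJ.
have h2 : `|\sum_(0 <= j < J) b j - \sum_(0 <= j < J0) b j| <= e / 2.
  apply: h; first exact: iota_uniq.
  by move=> j jJ0 _; rewrite mem_index_iota /= (leq_trans jJ0).
have := ler_distD (\sum_(0 <= j < J0) b j) (\sum_(j <- s) b j)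
  (\sum_(0 <= j < J) b j).
rewrite [X in _ <= _ + X]distrC; lra.
Qed.

(** A double sequence as a single one, along the standard encoding of pairs of
    integers; codes of no pair carry the neutral value [x0]. *)
Definition enum_pairs T (x0 : T) (a : nat -> nat -> T) (j : nat) : T :=
  if (pickle_inv j : option (nat * nat)) is Some p then a p.1 p.2 else x0.

Let rect_uniq N I :
  uniq [seq pickle (n, i) | n <- index_iota 0 N, i <- index_iota 0 I].
Proof.
apply: allpairs_uniq; rewrite ?iota_uniq// => -[n i] [m j] _ _ /= /(pcan_inj (@pickleK _)).
by [].
Qed.

Let sum_rect N I (a : nat -> nat -> R) :
  \sum_(j <- [seq pickle (n, i) | n <- index_iota 0 N, i <- index_iota 0 I])
    enum_pairs 0 a j = \sum_(0 <= n < N) \sum_(0 <= i < I) a n i.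
Proof.
rewrite (@big_allpairs_dep _ _ _ _ _ _ (fun n i => pickle (n, i)) (index_iota 0 N) (fun _ => index_iota 0 I)).
apply: eq_bigr => n _; apply: eq_bigr => i _.
by rewrite /enum_pairs pickleK_inv.
Qed.

(** The pairs with code below J all lie in one rectangle. *)
Let rect_big J (a : nat -> nat -> R) : exists K, forall N I, (K <= N)%N -> (K <= I)%N ->
  forall j, (j < J)%N -> enum_pairs 0 a j != 0 ->
  j \in [seq pickle (n, i) | n <- index_iota 0 N, i <- index_iota 0 I].
Proof.
elim: J => [|J [K IH]]; first by exists 0%N.
pose p := odflt (0, 0)%N (pickle_inv J : option (nat * nat)).
exists (maxn K (maxn p.1.+1 p.2.+1)) => N I.
rewrite !geq_max => /and3P[KN pN _] /and3P[KI _ pI] j.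
rewrite ltnS leq_eqVlt => /predU1P[->{j}|/IH]; last exact.
rewrite /enum_pairs; move: pN pI; rewrite /p.
case E: pickle_inv => [[n i]|] /= pN pI; last by rewrite eqxx.
move=> _; apply/allpairsP; exists (n, i); rewrite /= !mem_index_iota /= pN pI.
by split => //; have := pickle_invK (T:=(nat * nat)%type) J; rewrite E.
Qed.

Let enum_pairs_norm (a : nat -> nat -> R) j :
  enum_pairs 0 (fun n i => `|a n i|) j = `|enum_pairs 0 a j|.
Proof. by rewrite /enum_pairs; case: pickle_inv => //; rewrite normr0. Qed.

Lemma sum_enum_pairs_le (a : nat -> nat -> R) (m : nat -> R) B :
  (forall n I, \sum_(0 <= i < I) `|a n i| <= m n) ->
  (forall N, \sum_(0 <= n < N) m n <= B) ->
  forall J, \sum_(0 <= j < J) `|enum_pairs 0 a j| <= B.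
Proof.
move=> am mB J; have [K HK] := rect_big J a.
apply: le_trans (mB K); apply: (@le_trans _ _ (\sum_(0 <= n < K) \sum_(0 <= i < K) `|a n i|)); last exact: ler_sum.
rewrite -(sum_rect _ _ (fun n i => `|a n i|)) (eq_bigr _ (fun j _ => enum_pairs_norm a j)).
pose s := [seq j <- index_iota 0 J | enum_pairs 0 a j != 0].
have -> : \sum_(0 <= j < J) `|enum_pairs 0 a j| = \sum_(j <- s) `|enum_pairs 0 a j|.
  rewrite big_filter [RHS]big_mkcond; apply: eq_bigr => j _.
  by case: ifPn => // /negPn/eqP ->; rewrite normr0.
have us : uniq s by rewrite filter_uniq// iota_uniq.
set t := [seq _ | _ <- _, _ <- _].
rewrite (bigID (mem s) _ _ (r := t))/= -[leLHS]addr0 lerD//; last by rewrite sumr_ge0.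
rewrite le_eqVlt -[X in _ == X]big_filter; apply/orP; left; apply/eqP.
apply: perm_big; apply: uniq_perm => //; first by rewrite filter_uniq ?rect_uniq.
move=> j; rewrite [RHS]mem_filter; case: (boolP (j \in s)) => //= js.
apply/esym.
move: js; rewrite mem_filter mem_index_iota => /andP[j0 /andP[_ jJ]].
exact: (HK K K).
Qed.

(** Fubini for absolutely convergent double series: partial sums over a large
    rectangle are close to a long partial sum of the enumeration, and one lets
    the sides of the rectangle grow one after the other. *)
Lemma cvg_enum_pairs (a : nat -> nat -> R) (m s : nat -> R) (B S : R) :
  (forall n I, \sum_(0 <= i < I) `|a n i| <= m n) ->
  (forall N, \sum_(0 <= n < N) m n <= B) ->
  (forall n, series (a n) @ \oo --> s n) -> series s @ \oo --> S ->
  series (enum_pairs 0 a) @ \oo --> S.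
Proof.
move=> am mB aS sS; have bB := sum_enum_pairs_le am mB.
apply/cvgrPdist_le => e e0; have [J0 HJ0] := abs_series_close bB e0.
near=> J; have J0J : (J0 <= J)%N by near: J; exists J0.
have [K HK] := rect_big J0 a.
have h N I : (K <= N)%N -> (K <= I)%N ->
   `|\sum_(0 <= n < N) series (a n) I - series (enum_pairs 0 a) J| <= e.
  move=> KN KI; rewrite /series/= -sum_rect; apply: HJ0 => //; exact: HK.
have h1 N : (K <= N)%N -> `|series s N - series (enum_pairs 0 a) J| <= e.
  move=> KN.
  have : (fun I => `|\sum_(0 <= n < N) series (a n) I - series (enum_pairs 0 a) J|)
     @ \oo --> `|series s N - series (enum_pairs 0 a) J|.
    apply: cvg_norm; apply: cvgB; last exact: cvg_cst.
    exact: (cvg_sum_seq aS).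
  move/cvg_le_of_near; apply.
  by near=> I; apply: h => //; near: I; exists K.
have : (fun N => `|series s N - series (enum_pairs 0 a) J|) @ \oo -->
     `|S - series (enum_pairs 0 a) J|.
  by apply: cvg_norm; apply: cvgB; [exact: sS|exact: cvg_cst].
move/cvg_le_of_near; apply.
by near=> N; apply: h1 => //; near: N; exists K.
Unshelve. all: end_near. Qed.

End AbsSeries.

(** * Families of power series in three variables *)

(** The total inverse is not continuous at 0; writing it as
    x * (x^2)^(-1) reduces it to a real power. *)
Lemma measurable_inv (R : realType) : measurable_fun [set: R] (fun x : R => x^-1 : R).
Proof.
have -> : (fun x : R => x^-1) = fun x => x * (x ^+ 2) `^ (-1).
  apply/funext => x; rewrite powR_inv1 ?sqr_ge0// expr2 invfM.
  by have [->|x0] := eqVneq x 0; rewrite ?invr0 ?mul0r// mulrA divff// mul1r.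
apply: measurable_funM => //.
exact: (measurableT_comp (measurable_powR (-1))).
Qed.

Lemma measurable_funV d (T : measurableType d) (R : realType) (D : set T)
  (f : T -> R) : measurable_fun D f -> measurable_fun D (fun x => (f x)^-1).
Proof. by move=> mf; exact: (measurableT_comp (@measurable_inv R) mf). Qed.

Section PowerSeries.
Variables (R : realType).
Local Notation idx := (nat * nat * nat)%type.

Definition cube (r : R) (h : R3 R) : Prop :=
  [/\ `|h.1.1| <= r, `|h.1.2| <= r & `|h.2| <= r].

Definition monomial (al : idx) (h : R3 R) : R :=
  h.1.1 ^+ al.1.1 * h.1.2 ^+ al.1.2 * h.2 ^+ al.2.

(** For r >= 0, the largest absolute value of the monomial on the cube. *)
Definition weight (r : R) (al : idx) : R := monomial al (r, r, r).

Lemma monomialD al be h :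
  monomial (al.1.1 + be.1.1, al.1.2 + be.1.2, al.2 + be.2)%N h =
  monomial al h * monomial be h.
Proof. by rewrite /monomial /= !exprD; ring. Qed.

Lemma weight_ge0 r al : 0 <= r -> 0 <= weight r al.
Proof. by move=> r0; rewrite /weight /monomial /= !mulr_ge0// exprn_ge0. Qed.

Lemma weight_gt0 r al : 0 < r -> 0 < weight r al.
Proof. by move=> r0; rewrite /weight /monomial /= !mulr_gt0// exprn_gt0. Qed.

Lemma monomial_le r al h : cube r h -> `|monomial al h| <= weight r al.
Proof.
move=> [h1 h2 h3]; rewrite /weight /monomial !normrM !normrX /=.
by rewrite !ler_pM ?mulr_ge0 ?exprn_ge0// lerXn2r ?nnegrE//;
  apply: (le_trans _ h1).
Qed.

Section Class.
Variables (d : measure_display) (Q : measurableType d) (D : set Q) (r : R).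
Hypothesis r0 : 0 < r.

(** Power series in h, with coefficients measurable in the parameter q, that
    converge absolutely on the cube of half-side [r] with majorant norm at most
    [M q].  The terms are indexed by integers and carry their exponents
    [al i], which may repeat: products and countable sums are then again of
    this form without collecting equal exponents. *)
Definition analytic_family (M : Q -> R) (f : Q -> R3 R -> R) : Prop :=
  exists (c : nat -> Q -> R) (al : nat -> idx),
  [/\ forall i, measurable_fun D (c i),
      forall q, D q -> forall n,
        \sum_(0 <= i < n) (`|c i q| * weight r (al i)) <= M q &
      forall q h, D q -> cube r h ->
        series (fun i => c i q * monomial (al i) h) @ \oo --> f q h].

Lemma family_term_le c (al : nat -> idx) (M : Q -> R) q h :
  (forall n, \sum_(0 <= i < n) (`|c i q| * weight r (al i)) <= M q) ->
  cube r h ->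
  forall n, \sum_(0 <= i < n) `|c i q * monomial (al i) h| <= M q.
Proof.
move=> cM rh n; apply: le_trans (cM n); apply: ler_sum => i _.
by rewrite normrM ler_wpM2l// monomial_le.
Qed.

Lemma family_bound M f q h : analytic_family M f -> D q -> cube r h ->
  `|f q h| <= M q.
Proof.
move=> [c [al [_ cM cf]]] Dq rh.
have /cvg_norm H := cf q h Dq rh.
apply: (cvg_le_of_near H); near=> n.
apply: le_trans (ler_norm_sum _ _ _) _.
exact: (family_term_le (cM q Dq) rh).
Unshelve. all: end_near. Qed.

Lemma family_ext M N f g : (forall q, D q -> M q <= N q) ->
  (forall q h, D q -> cube r h -> f q h = g q h) ->
  analytic_family M f -> analytic_family N g.
Proof.
move=> MN fg [c [al [mc cM cf]]]; exists c, al; split => //.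
- by move=> q Dq n; exact: le_trans (cM q Dq n) (MN q Dq).
- by move=> q h Dq rh; rewrite -fg//; exact: cf.
Qed.

(** Completeness of the class for the majorant norm. *)
Lemma family_series (M : nat -> Q -> R) B (f : nat -> Q -> R3 R -> R) F :
  (forall n, analytic_family (M n) (f n)) ->
  (forall q, D q -> forall N, \sum_(0 <= n < N) M n q <= B q) ->
  (forall q h, D q -> cube r h -> series (fun n => f n q h) @ \oo --> F q h) ->
  analytic_family B F.
Proof.
move=> /choice[c] /choice[al] Hf MB fF.
pose c' j q := enum_pairs 0 (fun n i => c n i q) j.
pose al' := enum_pairs (0, 0, 0)%N al.
exists c', al'; split.
- move=> j; rewrite /c' /enum_pairs; case: pickle_inv => [p|].
    by have [+ _ _] := Hf p.1; exact.
  exact: measurable_cst.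
- move=> q Dq n.
  rewrite (eq_bigr (fun j =>
    `|enum_pairs 0 (fun n i => `|c n i q| * weight r (al n i)) j|)).
    apply: (@sum_enum_pairs_le _ _ (fun n => M n q)); last exact: MB.
    move=> m I; have [_ H _] := Hf m.
    apply: le_trans (H q Dq I); apply: ler_sum => i _.
    by rewrite ger0_norm// mulr_ge0// weight_ge0// ltW.
  move=> j _; rewrite /c' /al' /enum_pairs; case: pickle_inv => [p|].
    by rewrite [RHS]ger0_norm// mulr_ge0// weight_ge0// ltW.
  by rewrite !normr0 mul0r.
- move=> q h Dq rh.
  rewrite (_ : (fun i => _) =
    enum_pairs 0 (fun n i => c n i q * monomial (al n i) h)); last first.
    apply/funext => j; rewrite /c' /al' /enum_pairs.
    by case: pickle_inv => // ; rewrite mul0r.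
  apply: (@cvg_enum_pairs _ _ (fun n => M n q) (fun n => f n q h) (B q)).
  - by move=> n I; have [_ H _] := Hf n; exact: (family_term_le (H q Dq) rh).
  - exact: MB.
  - by move=> n; have [_ _] := Hf n; apply.
  - exact: fF.
Qed.

Lemma family_mulmono (g : Q -> R) be M f : measurable_fun D g ->
  analytic_family M f ->
  analytic_family (fun q => `|g q| * weight r be * M q)
    (fun q h => g q * monomial be h * f q h).
Proof.
move=> mg [c [al [mc cM cf]]].
exists (fun i q => g q * c i q),
  (fun i => (be.1.1 + (al i).1.1, be.1.2 + (al i).1.2, be.2 + (al i).2)%N).
split.
- by move=> i; exact: measurable_funM.
- move=> q Dq n; rewrite (eq_bigr (fun i =>
    `|g q| * weight r be * (`|c i q| * weight r (al i)))); last first.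
    by move=> i _; rewrite /weight monomialD normrM mulrACA.
  have w0 := weight_ge0 be (ltW r0).
  rewrite -mulr_sumr ler_wpM2l ?(mulr_ge0 (normr_ge0 _) w0)//; exact: (cM q Dq n).
- move=> q h Dq rh; rewrite (_ : series _ =
    (fun n => g q * monomial be h * series (fun i => c i q * monomial (al i) h) n)).
    by apply: cvgMr; exact: cf.
  apply/funext => n; rewrite /series /= mulr_sumr; apply: eq_bigr => i _.
  by rewrite monomialD mulrACA.
Qed.

Lemma family_cst (g : Q -> R) : measurable_fun D g ->
  analytic_family (fun q => `|g q|) (fun q _ => g q).
Proof.
move=> mg; exists (fun i => if i is 0%N then g else cst 0), (fun=> (0, 0, 0)%N).
split.
- by case=> [//|i]; exact: measurable_cst.
- move=> q Dq [|n]; first by rewrite big_geq.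
  rewrite big_nat_recl// /weight /monomial /= !expr0 !mulr1 big1 ?addr0// => i _.
  by rewrite normr0.
- move=> q h Dq rh; apply: cvg_near_cst; near=> n.
  have n0 : (0 < n)%N by near: n; exists 1%N.
  rewrite /series /= -(prednK n0) big_nat_recl//= /monomial /= !expr0 !mulr1.
  by rewrite big1 ?addr0// => i _; rewrite mul0r.
Unshelve. all: end_near. Qed.

Lemma family_mul M N f g : analytic_family M f -> analytic_family N g ->
  (forall q, D q -> 0 <= N q) ->
  analytic_family (fun q => M q * N q) (fun q h => f q h * g q h).
Proof.
move=> [c [al [mc cM cf]]] hg N0.
apply: (@family_series (fun i q => `|c i q| * weight r (al i) * N q) _
  (fun i q h => c i q * monomial (al i) h * g q h)).
- by move=> n; exact: family_mulmono.
- by move=> q Dq n; rewrite -mulr_suml ler_wpM2r ?N0//; exact: cM.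
- move=> q h Dq rh; rewrite (_ : series _ =
    (fun n => series (fun i => c i q * monomial (al i) h) n * g q h)).
    by apply: cvgMl; exact: cf.
  by apply/funext => n; rewrite /series /= mulr_suml.
Qed.

Lemma family_add M N f g : analytic_family M f -> analytic_family N g ->
  (forall q, D q -> 0 <= M q) -> (forall q, D q -> 0 <= N q) ->
  analytic_family (fun q => M q + N q) (fun q h => f q h + g q h).
Proof.
move=> hf hg M0 N0.
have h0 : analytic_family (fun=> 0) (fun _ _ => 0).
  apply: (family_ext _ _ (family_cst (@measurable_cst _ _ Q R D 0))) => //.
  by move=> q _; rewrite normr0.
apply: (@family_series
  (fun n => if n is n'.+1 then if n' is 0%N then N else (fun=> 0) else M) _
  (fun n => if n is n'.+1 then if n' is 0%N then g else (fun _ _ => 0) else f)).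
- by case=> [//|[//|n]].
- move=> q Dq [|[|n]].
  + by rewrite big_geq// addr_ge0 ?M0 ?N0.
  + by rewrite big_nat1 lerDl N0.
  + by rewrite !big_nat_recl//= big1 ?addr0.
- move=> q h Dq rh; apply: cvg_near_cst; near=> n.
  have n0 : (1 < n)%N by near: n; exists 2%N.
  rewrite -(subnK n0) addn2 /series /= !big_nat_recl//=.
  by rewrite big1 ?addr0.
Unshelve. all: end_near. Qed.

Lemma family_exp M f n : analytic_family M f -> (forall q, D q -> 0 <= M q) ->
  analytic_family (fun q => M q ^+ n) (fun q h => f q h ^+ n).
Proof.
move=> hf M0; elim: n => [|n IH].
  have := family_cst (@measurable_cst _ _ Q R D 1).
  by apply: family_ext => // q _; rewrite normr1 expr0.
have := family_mul hf IH (fun q Dq => exprn_ge0 n (M0 q Dq)).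
by apply: family_ext => [q _|q h _ _]; rewrite exprS.
Qed.

Lemma family_scale (g : Q -> R) M f : measurable_fun D g ->
  analytic_family M f ->
  analytic_family (fun q => `|g q| * M q) (fun q h => g q * f q h).
Proof.
move=> mg hf; apply: (family_ext _ _ (family_mulmono (0, 0, 0)%N mg hf)).
  by move=> q Dq; rewrite /weight /monomial /= !expr0 !mulr1.
by move=> q h _ _; rewrite /monomial /= !expr0 !mulr1.
Qed.

(** The Neumann series of 1 / (a - f), which converges in norm because the norm
    of f is at most t * a with t < 1. *)
Lemma family_inv (a : Q -> R) M f t : measurable_fun D a ->
  (forall q, D q -> 0 < a q) -> t < 1 ->
  (forall q, D q -> 0 <= M q <= t * a q) ->
  analytic_family M f ->
  analytic_family (fun q => (a q * (1 - t))^-1) (fun q h => (a q - f q h)^-1).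
Proof.
move=> ma a0 t1 Mt hf.
have M0 q : D q -> 0 <= M q by move=> /Mt/andP[].
have ratio q : D q -> 0 <= M q / a q < 1.
  move=> Dq; have /andP[M0q Mtq] := Mt q Dq; have aq := a0 q Dq.
  rewrite divr_ge0 ?(ltW aq)//= ltr_pdivrMr// mul1r (le_lt_trans Mtq)//.
  by rewrite gtr_pMl.
apply: (@family_series (fun n q => `|(a q)^-1 ^+ n.+1| * M q ^+ n) _
  (fun n q h => (a q)^-1 ^+ n.+1 * f q h ^+ n)).
- move=> n; apply: family_scale; last exact: family_exp.
  apply: measurable_funX; exact: measurable_funV.
- move=> q Dq N; have aq := a0 q Dq; have /andP[q0 q1] := ratio q Dq.
  have /andP[M0q Mtq] := Mt q Dq.
  rewrite (eq_bigr (fun n => (a q)^-1 * (M q / a q) ^+ n)); last first.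
    move=> n _; rewrite ger0_norm ?exprn_ge0 ?invr_ge0 ?ltW//.
    by rewrite exprS exprMn; ring.
  have Ha : \sum_(0 <= n < N) (M q / a q) ^+ n <= (1 - M q / a q)^-1.
    have [q00|qn0] := eqVneq (M q / a q) 0.
      rewrite q00 subr0 invr1; case: N => [|N]; first by rewrite big_geq.
      by rewrite big_nat_recl// expr0 big1 ?addr0// => i _; rewrite expr0n.
    have := @geometric_le_lim R N 1 (M q / a q) ler01.
    rewrite lt_neqAle eq_sym qn0 q0 ger0_norm// mul1r => /(_ isT q1).
    by apply: le_trans; rewrite /series/= le_eqVlt (eq_bigr _ (fun i _ => mul1r _)) eqxx.
  rewrite -mulr_sumr invfM ler_pM2l ?invr_gt0//.
  apply: (le_trans Ha); rewrite lef_pV2 ?posrE ?subr_gt0// lerD2l lerN2.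
  by rewrite ler_pdivrMr.
- move=> q h Dq rh; have aq := a0 q Dq; have /andP[q0 q1] := ratio q Dq.
  have fq : `|f q h / a q| < 1.
    rewrite normrM [X in _ * X]ger0_norm ?invr_ge0 ?ltW//.
    by apply: le_lt_trans q1; rewrite ler_pM2r ?invr_gt0// (family_bound hf).
  have := @cvg_geometric_series R (a q)^-1 _ fq.
  have -> : (a q)^-1 / (1 - f q h / a q) = (a q - f q h)^-1.
    by rewrite -invfM mulrBr mulr1 mulrC divfK// gt_eqF.
  apply: cvg_trans; apply: near_eq_cvg; near=> n.
  apply: eq_bigr => i _ /=; rewrite exprS exprMn; ring.
Unshelve. all: end_near. Qed.

End Class.
End PowerSeries.

(** * Integration and pointwise analyticity of families *)

Lemma integrable_of_bounded d (T : measurableType d) (R : realType)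
    (mu : {measure set T -> \bar R}) (D : set T) (f : T -> R) (C : R) :
  measurable D -> (mu D < +oo)%E -> measurable_fun D f ->
  (forall x, D x -> `|f x| <= C) -> mu.-integrable D (EFin \o f).
Proof.
move=> mD Doo mf fC; apply: measurable_bounded_integrable => //.
exists C; split; first exact: num_real.
by move=> x Cx y Dy; exact: le_trans (fC y Dy) (ltW Cx).
Qed.

Section Families.
Variables (R : realType) (d : measure_display) (Q : measurableType d).
Variables (D : set Q) (r : R).
Hypothesis r0 : 0 < r.
Local Notation idx := (nat * nat * nat)%type.
Local Notation family := (analytic_family D r).

Lemma family_measurable M f h : family M f -> cube r h ->
  measurable_fun D (f^~ h).
Proof.
move=> [c [al [mc cM cf]]] rh.
apply: (@measurable_fun_cvg _ _ _ _
  (fun n q => series (fun i => c i q * monomial (al i) h) n)).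
  elim=> [|n IH]; rewrite /series /=.
    by under eq_fun do rewrite big_geq//; exact: measurable_cst.
  under eq_fun do rewrite big_nat_recr//=.
  by apply: measurable_funD => //; apply: measurable_funM => //; exact: measurable_cst.
by move=> q Dq; exact: cf.
Qed.

Section Integral.
Variable mu : {measure set Q -> \bar R}.
Hypotheses (mD : measurable D) (Doo : (mu D < +oo)%E).

Lemma Rintegral_sum n (u : nat -> Q -> R) :
  (forall i, mu.-integrable D (EFin \o u i)) ->
  mu.-integrable D (fun q => (\sum_(0 <= i < n) u i q)%:E) /\
  \int[mu]_(q in D) (\sum_(0 <= i < n) u i q) =
  \sum_(0 <= i < n) \int[mu]_(q in D) u i q.
Proof.
move=> iu; elim: n => [|n [IH1 IH2]].
  under eq_fun do rewrite big_geq//; rewrite big_geq//; split.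
    exact: integrable0.
  under eq_Rintegral do rewrite big_geq//.
  by rewrite Rintegral_cst// mul0r.
split.
  under eq_fun do rewrite big_nat_recr//= EFinD.
  exact: (integrableD mD IH1 (iu n)).
under eq_Rintegral do rewrite big_nat_recr//=.
by rewrite RintegralD// IH2 big_nat_recr.
Qed.

(** Integration in the parameter acts on the coefficients; the interchange with
    the series is dominated convergence, with the majorant norm as dominating
    constant. *)
Lemma family_integral M (K : R) f : family M f ->
  (forall q, D q -> M q <= K) ->
  family (fun=> K * fine (mu D)) (fun _ h => \int[mu]_(q in D) f q h).
Proof.
move=> hf MK; have [c [al [mc cM cf]]] := hf.
have w0 i := weight_gt0 (al i) r0.
have cK i q : D q -> `|c i q| * weight r (al i) <= K.
  move=> Dq; apply: le_trans (MK q Dq); apply: le_trans (cM q Dq i.+1).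
  rewrite big_nat_recr//= lerDr sumr_ge0// => j _.
  by rewrite mulr_ge0// ltW.
have ic i : mu.-integrable D (EFin \o c i).
  apply: (integrable_of_bounded (C := K / weight r (al i))) => // q Dq.
  by rewrite ler_pdivlMr// cK.
have icw i : mu.-integrable D (EFin \o (fun q => `|c i q| * weight r (al i))).
  apply: (integrable_of_bounded (C := K)) => //.
    by apply: measurable_funM => //; apply: measurableT_comp.
  by move=> q Dq; rewrite ger0_norm ?cK// mulr_ge0// ltW.
exists (fun i _ => \int[mu]_(q in D) c i q), al; split.
- by move=> i; exact: measurable_cst.
- move=> q0 Dq0 n.
  have [iS eS] := Rintegral_sum n icw.
  apply: (@le_trans _ _ (\int[mu]_(q in D)
      (\sum_(0 <= i < n) (`|c i q| * weight r (al i))))).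
    rewrite eS; apply: ler_sum => i _.
    rewrite RintegralZr//; last exact: (integrable_norm (ic i)).
    by rewrite ler_wpM2r ?(ltW (w0 i))// le_normr_Rintegral.
  rewrite -(Rintegral_cst _ mD); apply: le_Rintegral => //.
    apply: (integrable_of_bounded (C := `|K|)) => //; exact: measurable_cst.
  by move=> q Dq; exact: le_trans (cM q Dq n) (MK q Dq).
- move=> q0 h Dq0 rh.
  have im i : mu.-integrable D (EFin \o (fun q => c i q * monomial (al i) h)).
    exact: (integrableZr mD (monomial (al i) h) (ic i)).
  have SK n q : D q -> `|\sum_(0 <= i < n) c i q * monomial (al i) h| <= K.
    move=> Dq; apply: le_trans (ler_norm_sum _ _ _) _.
    exact: le_trans (family_term_le (cM q Dq) rh n) (MK q Dq).
  have mS n : measurable_fun D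
      (fun q => \sum_(0 <= i < n) c i q * monomial (al i) h).
    by have [/measurable_int/measurable_EFinP] := Rintegral_sum n im.
  have mfh := family_measurable hf rh.
  have [|||||if_ _ cv] := @dominated_convergence _ Q R mu D mD
     (fun n q => (\sum_(0 <= i < n) c i q * monomial (al i) h)%:E)
     (fun q => (f q h)%:E) (cst K%:E).
  - by move=> n; exact/measurable_EFinP.
  - exact/measurable_EFinP.
  - by apply: aeW => q Dq; apply: cvg_EFin; [exact: nearW|exact: cf].
  - apply: (integrable_of_bounded (C := `|K|)) => //; exact: measurable_cst.
  - by apply: aeW => q n Dq; rewrite lee_fin SK.
  have fin : (\int[mu]_(q in D) (f q h)%:E \is a fin_num)%E.
    exact: integrable_fin_num.
  rewrite -(fineK fin) in cv; have /fine_cvgP[_] := cv.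
  rewrite (_ : fine \o _ = series (fun i => (\int[mu]_(q in D) c i q) * monomial (al i) h))//.
  apply/funext => n /=; have [_ eS] := Rintegral_sum n im.
  rewrite /series /= -[LHS]/(Rintegral _ _ _) eS; apply: eq_bigr => i _.
  by rewrite RintegralZr.
Qed.

End Integral.

(** Regrouping the terms of a series by their exponents. *)
Lemma sum_fiber (F : nat -> R) (al : nat -> idx) (s : seq idx) n : uniq s ->
  \sum_(a <- s) \sum_(0 <= i < n | al i == a) F i =
  \sum_(0 <= i < n | al i \in s) F i.
Proof.
elim: s => [|a s IH] /=.
  by rewrite big_nil big_pred0.
move=> /andP[as_ us]; rewrite big_cons (IH us).
rewrite [RHS](bigID (fun i => al i == a))/=; congr (_ + _).
  by apply: eq_bigl => i; rewrite inE; case: (al i == a); rewrite ?andbF.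
apply: eq_bigl => i; rewrite inE; case: eqP => //= [->|_]; last by rewrite andbT.
exact/negbTE.
Qed.

Lemma abs_series_cvg (b : nat -> R) B :
  (forall n, \sum_(0 <= i < n) `|b i| <= B) -> cvgn (series b).
Proof.
move=> bB; apply: normed_cvg.
apply: nondecreasing_is_cvgn.
  by apply: nondecreasing_series => n _ _; exact: normr_ge0.
by exists B => _ [n _ <-]; exact: bB.
Qed.

(** Collecting the terms with equal exponents gives the coefficients of a power
    series in the usual sense; its sums over boxes of exponents converge to the
    same limit by unconditional summability. *)
Lemma family_real_analytic M f q (g : R3 R -> R) k : family M f -> D q ->
  (forall x, cube r (x - k) -> g x = f q (x - k)) -> real_analytic_at g k.
Proof.
move=> [c [al [mc cM cf]]] Dq gf.
pose C (a : idx) : R := limn (series (fun i => if al i == a then c i q else 0)).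
have sumC a n : series (fun i => if al i == a then c i q else 0) n =
    \sum_(0 <= i < n | al i == a) c i q by rewrite /series/= -big_mkcond.
have cvgC a : series (fun i => if al i == a then c i q else 0) @ \oo --> C a.
  apply: (@abs_series_cvg _ (M q / weight r a)) => n.
  rewrite ler_pdivlMr ?weight_gt0// mulr_suml; apply: le_trans (cM q Dq n).
  apply: ler_sum => i _; case: eqP => [->//|_].
  by rewrite normr0 mul0r mulr_ge0// ltW// weight_gt0.
have CM (s : seq idx) : uniq s -> \sum_(a <- s) `|C a| * weight r a <= M q.
  move=> us; have H : (fun n => \sum_(a <- s)
     `|series (fun i => if al i == a then c i q else 0) n| * weight r a) @ \oo
      --> \sum_(a <- s) `|C a| * weight r a.
    by apply: cvg_sum_seq => a; apply: cvgMl; exact: cvg_norm.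
  apply: (cvg_le_of_near H); near=> n; apply: le_trans (cM q Dq n).
  apply: (@le_trans _ _ (\sum_(a <- s) \sum_(0 <= i < n | al i == a)
     `|c i q| * weight r (al i))).
    apply: ler_sum => a _; rewrite sumC.
    rewrite [leRHS](eq_bigr (fun i => `|c i q| * weight r a)); last by move=> i /eqP ->.
    by rewrite -mulr_suml ler_wpM2r ?(ltW (weight_gt0 _ _))// ler_norm_sum.
  rewrite sum_fiber// [leLHS]big_mkcond; apply: ler_sum => i _.
  by case: ifP => // _; rewrite mulr_ge0// ltW// weight_gt0.
exists C, r; split => // x xk a.
have rh : cube r (x - k).
  move: xk; rewrite !prod_normE/= !gt_max => /andP[/andP[h1 h2] h3].
  by split; apply: ltW.
have aE al0 : a al0 = C al0 * monomial al0 (x - k).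
  by rewrite /a /monomial /= !mulrA.
split.
- rewrite /summable; apply: (@le_lt_trans _ _ (M q)%:E); last exact: ltry.
  apply: ub_ereal_sup => _ [A [fA _] <-].
  rewrite fsbig_finite//= sumEFin lee_fin.
  apply: le_trans (CM _ (finmap.fset_uniq (fset_set A))).
  apply: ler_sum => al0 _; rewrite aE normrM ler_wpM2l//.
  exact: monomial_le.
- pose L N : seq idx := [seq (p, l) | p <- [seq (i, j) |
     i <- index_iota 0 N, j <- index_iota 0 N], l <- index_iota 0 N].
  have uL N : uniq (L N).
    by rewrite !allpairs_uniq ?iota_uniq// => -[? ?] [? ?] _ _ /= [-> ->].
  have LP N (al0 : idx) : (al0.1.1 < N)%N -> (al0.1.2 < N)%N ->
      (al0.2 < N)%N -> al0 \in L N.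
    case: al0 => [[i j] l] /= h1 h2 h3; apply/allpairsP; exists ((i, j), l).
    split => //; last by rewrite mem_index_iota.
    by apply/allpairsP; exists (i, j); split; rewrite // mem_index_iota.
  rewrite (_ : (fun N => _) = fun N => \sum_(al0 <- L N) a al0); last first.
    apply/funext => N; rewrite /L !big_allpairs big_mkord.
    apply: eq_bigr => i _; rewrite big_mkord; apply: eq_bigr => j _.
    by rewrite big_mkord.
  rewrite gf//; pose b i := c i q * monomial (al i) (x - k).
  have bM := family_term_le (cM q Dq) rh.
  apply/cvgrPdist_le => e e0.
  have [J0 HJ0] := abs_series_close bM e0.
  (* The box of side N0 contains the exponents of the first J0 terms. *)
  have [N0 HN0] : exists N0, forall i, (i < J0)%N ->
     [/\ ((al i).1.1 < N0)%N, ((al i).1.2 < N0)%N & ((al i).2 < N0)%N].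
    elim: J0 {HJ0} => [|J [N0 IH]]; first by exists 0%N.
    exists (maxn N0 (maxn (al J).1.1 (maxn (al J).1.2 (al J).2)).+1) => i.
    rewrite ltnS leq_eqVlt => /predU1P[->{i}|/IH[h1 h2 h3]].
      by rewrite !leq_max !ltnS !leq_max !leqnn !orbT.
    by rewrite !leq_max h1 h2 h3.
  near=> N.
  have N0N : (N0 <= N)%N by near: N; exists N0.
  have H : (fun n => `|\sum_(0 <= i < n | al i \in L N) b i -
       \sum_(0 <= i < n) b i|) @ \oo --> `|\sum_(al0 <- L N) a al0 - f q (x - k)|.
    apply: cvg_norm; apply: cvgB; last exact: cf.
    under [X in X @ _ --> _]eq_fun => n do rewrite -sum_fiber//.
    apply: cvg_sum_seq => al0; rewrite aE.
    rewrite (_ : (fun n => _) = (fun n =>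
      series (fun i => if al i == al0 then c i q else 0) n *
      monomial al0 (x - k))); first by apply: cvgMl; exact: cvgC.
    apply/funext => n; rewrite sumC mulr_suml; apply: eq_bigr => i /eqP <-.
    by [].
  rewrite distrC; apply: (cvg_le_of_near H); near=> n.
  rewrite -[X in X - _]big_filter; apply: HJ0.
  + by near: n; exists J0.
  + by rewrite filter_uniq// iota_uniq.
  + move=> j jJ0 _; rewrite mem_filter mem_index_iota /=.
    have [h1 h2 h3] := HN0 j jJ0.
    rewrite LP ?(leq_trans h1)// ?(leq_trans h2)// ?(leq_trans h3)//=.
    by apply: (leq_trans jJ0); near: n; exists J0.
Unshelve. all: end_near. Qed.

(** Coefficients bounded by 1 and no constant term: the norm is at most
    r + r^2 + ... = r / (1 - r), hence at most 2 r for r <= 1/2.  The condition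
    on the weight says that the monomial is a coordinate. *)
Lemma family_coord_series (be : idx) (s : nat -> R) (g : R -> R) :
  weight r be = r -> r <= 2^-1 ->
  s 0%N = 0 -> (forall n, `|s n| <= 1) ->
  (forall x, series (fun n => s n * x ^+ n) @ \oo --> g x) ->
  family (fun=> 2 * r) (fun _ h => g (monomial be h)).
Proof.
move=> wr r2 s0 s1 sg.
have hX : family (fun=> r) (fun _ h => monomial be h).
  have := family_mulmono r0 be (@measurable_cst _ _ Q R D 1)
    (family_cst r (@measurable_cst _ _ Q R D 1)).
  apply: family_ext => [q _|q h _ _]; first by rewrite normr1 wr !mulr1 mul1r.
  by rewrite mul1r mulr1.
apply: (@family_series _ _ _ _ _ r0 (fun n _ => `|s n| * r ^+ n) _
  (fun n _ h => s n * monomial be h ^+ n)).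
- move=> n; apply: (@family_scale _ _ _ _ _ r0 (fun=> s n)); first exact: measurable_cst.
  by apply: family_exp => // q _; exact: ltW.
- move=> q _ [|N]; first by rewrite big_geq// mulr_ge0// ltW.
  rewrite big_nat_recl// s0 normr0 mul0r add0r.
  have r1 : r < 1 by apply: le_lt_trans r2 _; rewrite invf_lt1 ?ltr1n.
  apply: (@le_trans _ _ (series (geometric r r) N)).
    apply: ler_sum => i _ /=; rewrite -exprS.
    by rewrite -[leRHS]mul1r ler_wpM2r// exprn_ge0// ltW.
  have := @geometric_le_lim R N r r (ltW r0) r0.
  rewrite (ger0_norm (ltW r0)) => /(_ r1) /le_trans; apply.
  rewrite ler_pdivrMr ?subr_gt0// mulrC mulrA ler_peMl ?(ltW r0)//; lra.
- by move=> q h _ _; exact: sg.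
Qed.

Lemma family_sin (be : idx) : weight r be = r -> r <= 2^-1 ->
  family (fun=> 2 * r) (fun _ h => sin (monomial be h)).
Proof.
move=> wr r2; apply: (@family_coord_series _
  (fun n => (odd n)%:R * (-1) ^+ n.-1./2 / n`!%:R)) => //.
- by rewrite !mul0r.
- move=> n; rewrite !normrM normrX normrN1 expr1n mulr1.
  rewrite ger0_norm// ger0_norm// ler_pdivrMr ?ltr0n ?fact_gt0// mul1r ler_nat.
  by rewrite (leq_trans (leq_b1 _))// fact_gt0.
- move=> x; have : series (sin_coeff x) @ \oo --> sin x.
    by rewrite sin.unlock; exact: is_cvg_series_sin_coeff.
  by apply: cvg_trans; apply: near_eq_cvg; apply: nearW => n;
    apply: eq_bigr => i _; rewrite /sin_coeff /= mulrAC.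
Qed.

Lemma family_cosm1 (be : idx) : weight r be = r -> r <= 2^-1 ->
  family (fun=> 2 * r) (fun _ h => cos (monomial be h) - 1).
Proof.
move=> wr r2; apply: (@family_coord_series _
  (fun n => if n == 0 then 0 else (~~ odd n)%:R * (-1) ^+ n./2 / n`!%:R)
  (fun x => cos x - 1)) => //.
- move=> n; case: ifP => _; first by rewrite normr0.
  rewrite !normrM normrX normrN1 expr1n mulr1.
  rewrite ger0_norm// ger0_norm// ler_pdivrMr ?ltr0n ?fact_gt0// mul1r ler_nat.
  by rewrite (leq_trans (leq_b1 _))// fact_gt0.
- move=> x; have : series (cos_coeff x) @ \oo --> cos x.
    by rewrite cos.unlock; exact: is_cvg_series_cos_coeff.
  move=> H; have : (fun n => series (cos_coeff x) n - 1) @ \oo --> cos x - 1.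
    by apply: cvgB => //; exact: cvg_cst.
  apply: cvg_trans; apply: near_eq_cvg; near=> n.
  have n0 : (0 < n)%N by near: n; exists 1%N.
  rewrite -(prednK n0) /series /= big_nat_recl//= [in RHS]big_nat_recl//=.
  rewrite mul0r add0r /cos_coeff/= fact0 divr1 !expr0 !mulr1.
  rewrite addrAC subrr add0r; apply: eq_bigr => i _.
  by rewrite mulrAC.
Unshelve. all: end_near. Qed.

End Families.

(** * Integrals over a period, and a cosine bound *)

Section LineIntegrals.
Variable R : realType.
Local Notation leb := (@lebesgue_measure R).

(** Lebesgue measure is determined by its values on half-open intervals, so it
    is enough to test the invariance on these. *)
Lemma lebesgue_measure_preserving (phi : measurableTypeR R -> measurableTypeR R) : measurable_fun setT phi ->
  (forall a b, leb (phi @^-1` `]a, b]) = leb `]a, b]) ->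
  forall (D : set R) (f : R -> \bar R), measurable D ->
  measurable_fun setT f -> (forall x, 0 <= f x)%E ->
  (\int[leb]_(x in phi @^-1` D) f (phi x) = \int[leb]_(x in D) f x)%E.
Proof.
move=> mphi hphi D f mD mf f0.
have mS (X : set (measurableTypeR R)) : measurable X -> leb X = pushforward leb phi X.
  move=> mX; apply: lebesgue_measure_unique => // _ [[a b] _ <-] /=.
  by rewrite /pushforward hphi.
rewrite -(ge0_integral_pushforward mphi leb mD)//; last exact: measurable_funTS.
apply: eq_measure_integral => A mA _; exact/esym/mS.
Qed.

Lemma integral_translate (a b c : R) (f : R -> \bar R) :
  measurable_fun setT f -> (forall x, 0 <= f x)%E ->
  (\int[leb]_(x in `]a, b]) f (x - c)%R =
   \int[leb]_(x in `](a - c)%R, (b - c)%R]) f x)%E.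
Proof.
move=> mf f0.
have pre (u v : R) : (fun x => x - c) @^-1` `]u, v] = `]u + c, v + c]%classic.
  by apply/seteqP; split => x /=; rewrite !in_itv/= ltrBrDr lerBlDr.
rewrite -[RHS](lebesgue_measure_preserving (phi := fun x => x - c))//.
- by rewrite pre !subrK.
- by apply: measurable_funB => //; exact: measurable_cst.
- move=> u v; rewrite pre !lebesgue_measure_itv/= !lte_fin ltrD2r -!EFinB.
  by congr (if _ then _%:E else _); ring.
Qed.

Lemma integral_reflect (a b : R) (f : R -> \bar R) :
  measurable_fun setT f -> (forall x, 0 <= f x)%E ->
  (\int[leb]_(x in `[(- b)%R, (- a)%R]) f (- x)%R = \int[leb]_(x in `[a, b]) f x)%E.
Proof.
move=> mf f0.
rewrite -[RHS](lebesgue_measure_preserving (phi := -%R))//.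
- congr (integral _ _ _); apply/seteqP; split => x /=; rewrite !in_itv/=; lra.
- move=> u v; rewrite (_ : _ @^-1` _ = `[- v, - u[%classic).
    by rewrite !lebesgue_measure_itv/= !lte_fin ltrN2 -!EFinB opprK addrC.
  by apply/seteqP; split => x /=; rewrite !in_itv/= ltrNr lerNl andbC.
Qed.

(** For 0 <= phi <= 2 pi, the translated period splits at -pi, and the part left of
    -pi is moved by one period to the right end. *)
Lemma integral_periodic (phi : R) (f : R -> \bar R) :
  measurable_fun setT f -> (forall x, 0 <= f x)%E ->
  (forall x, f (x + 2 * pi) = f x) -> - (2 * pi) <= phi <= 2 * pi ->
  (\int[leb]_(x in `](- pi)%R, pi]) f (x - phi)%R =
   \int[leb]_(x in `](- pi)%R, pi]) f x)%E.
Proof.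
move=> mf f0 fper; have pi0 := pi_gt0 R.
have fperN x : f (x - 2 * pi) = f x by rewrite -(fper (x - 2 * pi)) subrK.
suff pos p : 0 <= p <= 2 * pi ->
  (\int[leb]_(x in `](- pi)%R, pi]) f (x - p)%R = \int[leb]_(x in `](- pi)%R, pi]) f x)%E.
  move=> /andP[h1 h2]; have [p0|p0] := leP 0 phi; first by apply: pos; rewrite p0.
  rewrite -(pos (phi + 2 * pi)); last by lra.
  by apply: eq_integral => x _; rewrite opprD addrA fperN.
move=> /andP[p0 p2]; rewrite integral_translate//.
have split3 (a b c : R) : a <= b -> b <= c ->
   (\int[leb]_(x in `]a, c]) f x =
    \int[leb]_(x in `]a, b]) f x + \int[leb]_(x in `]b, c]) f x)%E.
  move=> ab bc; rewrite -ge0_integral_setU//=; last 2 first.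
  - exact: measurable_funTS.
  - by apply: lt_disjoint => x y; rewrite !in_itv/= => /andP[_ xb] /andP[bY _]; exact: le_lt_trans bY.
  congr (integral _ _ _); apply/seteqP; split => x /=; rewrite !in_itv/=.
    move=> /andP[ax xc]; case: (leP x b) => xb; [left|right]; lra.
  by case=> /andP[h1 h2]; lra.
rewrite (split3 (- pi - p) (- pi) (pi - p)); [|lra|lra].
rewrite [RHS](split3 _ (pi - p) _); [|lra|lra].
rewrite [RHS]addeC; congr (_ + _)%E.
have := integral_translate (pi - p) pi (2 * pi) mf f0.
rewrite (_ : pi - p - 2 * pi = - pi - p); last by ring.
rewrite (_ : pi - 2 * pi = - pi); last by ring.
by move=> <-; apply: eq_integral => x _; rewrite fperN.
Qed.

Lemma sin_le_id (y : R) : 0 <= y -> sin y <= y.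
Proof.
rewrite le_eqVlt => /predU1P[<-|y0]; first by rewrite sin0.
have [c hc] := MVT (f := sin) (df := cos) y0
  (fun x _ => is_derive_sin x) (continuous_subspaceT (@continuous_sin R)).
rewrite sin0 !subr0 => ->; have := cos_le1 c; nra.
Qed.

(** On [0, 1] the sine is at least y / 2 by the mean value theorem, and on
    [1, pi / 2], where y <= 2, it is at least its value at 1. *)
Lemma sin_lower (y : R) : 0 <= y <= pi / 2 -> y <= 4 * sin y.
Proof.
have pi4 : (pi : R) / 2 <= 2 by have [/andP[]] := pihalf_02_cos_pihalf R.
have pi2 := pi_ge2 R.
have small (x : R) : 0 <= x <= 1 -> x / 2 <= sin x.
  rewrite le_eqVlt => /andP[/predU1P[<-|x0] x1]; first by rewrite sin0 mul0r.
  have [c] := MVT (f := sin) (df := cos) x0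
    (fun x _ => is_derive_sin x) (continuous_subspaceT (@continuous_sin R)).
  rewrite in_itv/= sin0 !subr0 => /andP[c0 cx] ->.
  have h : sin (c / 2) <= c / 2 by apply: sin_le_id; lra.
  have h0 : 0 <= sin (c / 2) by apply: sin_ge0_pi; lra.
  have : cos c = 1 - 2 * sin (c / 2) ^+ 2.
    by rewrite {1}(splitr c) cosD -!expr2 cos2sin2; ring.
  move=> ->; nra.
move=> /andP[y0 y1]; have [yle1|ygt1] := leP y 1.
  by have := small y; rewrite y0 yle1 => /(_ isT); lra.
have : sin 1 < sin y by rewrite ltr_sin ?in_itv/=; lra.
have := small 1; rewrite lexx ler01 => /(_ isT); lra.
Qed.

(** The quadratic lower bound 1 - cos x >= x^2 / 32, from
    1 - cos x = 2 sin(x / 2)^2 and [sin_lower]; the constant is not optimal. *)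
Lemma cos_upper (x : R) : - pi <= x <= pi -> x ^+ 2 <= 32 * (1 - cos x).
Proof.
move=> hx.
have -> : 1 - cos x = 2 * sin (x / 2) ^+ 2.
  by rewrite {1}(splitr x) cosD -!expr2 cos2sin2; ring.
wlog x0 : x hx / 0 <= x.
  move=> H; have [/H|x0] := leP 0 x; first exact.
  have := H (- x); rewrite mulNr sinN !sqrrN; apply; lra.
have h := @sin_lower (x / 2); set s := sin _ in h *.
have {h} : x / 2 <= 4 * s by apply: h; lra.
nra.
Qed.

Lemma is_derive_powR_shift (de x a : R) : 0 < x + de ->
  is_derive x 1 (fun t : R => (t + de) `^ a) (a * (x + de) `^ (a - 1)).
Proof.
move=> xde.
have h : is_derive (x + de) 1 (fun t : R => t `^ a) (a * (x + de) `^ (a - 1)).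
  apply: DeriveDef; first by apply: derivable_powR; rewrite in_itv/= xde.
  by rewrite -derive1E powR_derive1// in_itv/= xde.
have := @is_derive1_comp R (fun t : R => t `^ a) (fun t => t + de) x _ 1 h.
rewrite mulr1; apply.
have := @is_deriveD R R R id (cst de) x 1 1 0 (is_derive_id _ _) (is_derive_cst _ _ _).
by rewrite addr0.
Qed.

(** The integrand is the derivative of (x + de)^(1/3). *)
Lemma powR_int_half (de : R) : 0 < de <= 1 ->
  (\int[leb]_(x in `[0%R, pi]) (3^-1 * (x + de) `^ (3^-1 - 1))%R%:E
   <= ((pi + 1) `^ 3^-1)%R%:E)%E.
Proof.
move=> /andP[d0 d1]; have p0 := pi_gt0 R.
have der (x : R) : 0 <= x ->
    is_derive x 1 (fun t : R => (t + de) `^ 3^-1) (3^-1 * (x + de) `^ (3^-1 - 1)).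
  by move=> x0; apply: is_derive_powR_shift; lra.
have cont (a x : R) : 0 <= x -> {for x, continuous (fun t : R => (t + de) `^ a)}.
  move=> x0; apply: differentiable_continuous; apply/derivable1_diffP.
  by have [] : is_derive x 1 (fun t : R => (t + de) `^ a) (a * (x + de) `^ (a - 1))
    by apply: is_derive_powR_shift; lra.
rewrite (continuous_FTC2 (F := fun t => (t + de) `^ 3^-1))//.
- rewrite -EFinB lee_fin lerBlDr -[leLHS]addr0 lerD ?powR_ge0//.
  by apply: ge0_ler_powR; rewrite ?nnegrE; lra.
- apply: continuous_in_subspaceT => x; rewrite inE/= in_itv/= => /andP[x0 _].
  by apply: cvgM; [exact: cvg_cst|exact: cont].
- split.
  + by move=> x; rewrite in_itv/= => /andP[/ltW/der[] + _].
  + by apply: cvg_at_right_filter; exact: cont.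
  + by apply: cvg_at_left_filter; apply: cont; lra.
- move=> x; rewrite in_itv/= => /andP[/ltW/der H _].
  by rewrite derive1E; exact: derive_val.
Qed.

Lemma measurable_powR_shift (de a : R) :
  measurable_fun setT (fun x : R => ((`|x| + de) `^ a)%:E).
Proof.
apply/measurable_EFinP; apply: (measurableT_comp (measurable_powR a)).
by apply: measurable_funD => //; exact: measurable_cst.
Qed.

(** A bound uniform in [de]: the singularity |x|^(-2/3) is integrable on the
    line.  The exponent is the one that appears when the three coordinates of
    1 / |q|^2 are separated. *)
Lemma powR_int_bound (de : R) : 0 < de <= 1 ->
  (\int[leb]_(x in `](- pi)%R, pi]) ((`|x| + de) `^ (3^-1 - 1))%R%:E
   <= (6 * (pi + 1) `^ 3^-1)%R%:E)%E.
Proof.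
move=> hde; have p0 := pi_gt0 R.
pose f (x : R) := ((`|x| + de) `^ (3^-1 - 1))%:E.
have f0 x : (0 <= f x)%E by rewrite lee_fin powR_ge0.
have mf := @measurable_powR_shift de (3^-1 - 1).
have half : (\int[leb]_(x in `[0%R, pi]) f x <= (3 * (pi + 1) `^ 3^-1)%R%:E)%E.
  have := powR_int_half hde.
  under [X in (X <= _)%E -> _]eq_integral.
    move=> x; rewrite inE/= in_itv/= => /andP[x0 _].
    rewrite (_ : _%:E = (3^-1)%:E * f x)%E; last by rewrite /f ger0_norm.
    over.
  rewrite ge0_integralZl//; last exact: measurable_funTS.
  by rewrite lee_pdivrMl// EFinM.
have -> : 6 * (pi + 1) `^ 3^-1 = 3 * (pi + 1) `^ 3^-1 + 3 * (pi + 1) `^ 3^-1 :> R.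
  by ring.
rewrite EFinD.
rewrite (_ : `](- pi), pi]%classic = `](- pi), (- 0)] `|` `]0, pi]); last first.
  apply/seteqP; split => x /=; rewrite !in_itv/= oppr0.
    by move=> /andP[h1 h2]; case: (leP x 0) => h; [left|right]; lra.
  by case=> /andP[h1 h2]; lra.
rewrite ge0_integral_setU//=; last 3 first.
- exact: (measurable_funTS mf).
- by move=> x _; exact: f0.
- apply: lt_disjoint => x y; rewrite !in_itv/= oppr0 => /andP[_ xb] /andP[bY _].
  exact: le_lt_trans bY.
apply: leeD; last first.
  apply: le_trans half; apply: ge0_subset_integral => //.
    exact: (measurable_funTS mf).
    by move=> x _; exact: f0.
  by move=> x /=; rewrite !in_itv/= => /andP[h1 h2]; rewrite h2 ltW.
apply: (@le_trans _ _ (\int[leb]_(x in `[(- pi)%R, (- 0)%R]) f x)%E).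
  apply: ge0_subset_integral => //.
    exact: (measurable_funTS mf).
    by move=> x _; exact: f0.
  by move=> x /=; rewrite !in_itv/= => /andP[h1 h2]; rewrite h2 ltW.
rewrite -(integral_reflect 0 pi mf f0) in half.
apply: le_trans half; rewrite le_eqVlt; apply/orP; left; apply/eqP.
by apply: eq_integral => x _; rewrite /f normrN.
Qed.

End LineIntegrals.

(** * Integration on the torus *)

Section Tonelli.
Context d1 d2 (T1 : measurableType d1) (T2 : measurableType d2) (R : realType).
Variables (m2 : {sigma_finite_measure set T2 -> \bar R}).
Variables (f : T1 * T2 -> \bar R).
Hypotheses (mf : measurable_fun setT f) (f0 : forall z, (0 <= f z)%E).

Lemma measurable_marginal (B : set T2) : measurable B ->
  measurable_fun setT (fun x => \int[m2]_(y in B) f (x, y))%E.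
Proof.
move=> mB.
have mg : measurable_fun setT (f \_ ([set: T1] `*` B)).
  by apply/(measurable_restrictT f (measurableX measurableT mB)); exact: measurable_funTS.
have g0 z : (0 <= (f \_ ([set: T1] `*` B)) z)%E by rewrite patchE; case: ifP.
have := measurable_fun_fubini_tonelli_F (m2 := m2) _ mg g0.
congr measurable_fun; apply/funext => x; rewrite /fubini_F [RHS]integral_mkcond.
apply: eq_integral => y _; rewrite !patchE.
congr (if _ then _ else _); apply/idP/idP; rewrite !inE/=; first by case.
by move=> By; split.
Qed.

Variables (m1 : {sigma_finite_measure set T1 -> \bar R}).

Lemma integral_setX (A : set T1) (B : set T2) : measurable A -> measurable B ->
  (\int[m1 \x m2]_(z in A `*` B) f z =
   \int[m1]_(x in A) \int[m2]_(y in B) f (x, y))%E.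
Proof.
move=> mA mB; rewrite integral_mkcond fubini_tonelli1; last 2 first.
- by apply/(measurable_restrictT f (measurableX mA mB)); exact: measurable_funTS.
- by move=> z; rewrite patchE; case: ifP.
rewrite [RHS]integral_mkcond; apply: eq_integral => x _; rewrite /fubini_F.
rewrite patchE; case: ifPn => xA.
  rewrite [RHS]integral_mkcond; apply: eq_integral => y _; rewrite !patchE.
  congr (if _ then _ else _); apply/idP/idP; rewrite !inE; first by case.
  by move=> yB; split => //; rewrite inE in xA.
rewrite integral0_eq// => y _; rewrite patchE ifN//.
by apply: contra xA; rewrite !inE => -[].
Qed.

End Tonelli.

(** The product of two Lebesgue measures, under a name of its own so that it can
    carry the sigma-finiteness that the iterated integrals over the torus
    require. *)
Definition leb2 (R : realType) :
    set (measurableTypeR R * measurableTypeR R)%type -> \bar R :=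
  (@lebesgue_measure R \x @lebesgue_measure R)%E.

Arguments leb2 : clear implicits.

HB.instance Definition _ (R : realType) := Measure.on (leb2 R).

Lemma leb2_sigma_finite (R : realType) : sigma_finite setT (leb2 R).
Proof.
exists (fun n : nat => `](- n%:R), (n%:R : R)] `*` `](- n%:R), (n%:R : R)]).
  apply/seteqP; split => // -[x y] _.
  have [n xyn] : exists n : nat, `|x| + `|y| < n%:R.
    by exists (Num.truncn (`|x| + `|y|)).+1; rewrite truncnS_gt.
  have hx := ler_norm x; have hy := ler_norm y.
  have hx' := ler_norm (- x); have hy' := ler_norm (- y).
  have nx := normr_ge0 x; have ny := normr_ge0 y; rewrite !normrN in hx' hy'.
  by exists n => //; split; rewrite /= in_itv/=; lra.
move=> n; split; first exact: measurableX.
rewrite /leb2 product_measure1E//=.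
by apply: lte_mul_pinfty => //; rewrite ?ge0_fin_numE// lebesgue_measure_itv/=;
  case: ifP => _; rewrite ?ltry// -EFinB ltry.
Qed.

HB.instance Definition _ (R : realType) :=
  Measure_isSigmaFinite.Build _ _ _ (leb2 R) (leb2_sigma_finite R).

Section Torus.
Variable R : realType.
Local Notation mu := (leb3 R).
Local Notation MR := (measurableTypeR R).
Local Notation T := (@torus R : set (R3 MR)).
Local Notation Ipi := (`]- pi, (pi : R)]%classic : set MR).

Lemma measurable_torus : measurable T.
Proof. by apply: measurableX => //; exact: measurableX. Qed.

Lemma leb3_box (a b c a' b' c' : R) : a <= a' -> b <= b' -> c <= c' ->
  mu (`]a, a'] `*` `]b, b'] `*` `]c, c'] : set (R3 MR)) =
  ((a' - a) * (b' - b) * (c' - c))%:E.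
Proof.
have itv (u v : R) : u <= v ->
    @lebesgue_measure R `]u, v]%classic = (v - u)%:E.
  move=> uv; rewrite lebesgue_measure_itv/= lte_fin; case: ltP => //.
  by move=> vu; rewrite (_ : v = u) ?subrr//; apply/eqP; rewrite eq_le uv vu.
move=> ha hb hc.
transitivity ((@lebesgue_measure R \x @lebesgue_measure R)%E (`]a, a'] `*` `]b, b'])
  * @lebesgue_measure R `]c, c']%classic)%E.
  by apply: product_measure1E => //; exact: measurableX.
rewrite itv// [in RHS]EFinM; congr (_ * _)%E.
rewrite EFinM -!itv//; exact: product_measure1E.
Qed.

Lemma leb3_torus : mu T = ((2 * pi) ^+ 3)%:E.
Proof.
have p0 := pi_gt0 R; rewrite /torus leb3_box; [|lra|lra|lra].
by congr _%:E; ring.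
Qed.

Lemma leb3_torus_fin : (mu T < +oo)%E.
Proof. by rewrite leb3_torus ltry. Qed.

Lemma measurable_coord1 (g : R -> R) : measurable_fun setT g ->
  measurable_fun setT (fun q : R3 MR => g q.1.1).
Proof.
move=> mg; apply: (measurableT_comp mg).
exact: (measurableT_comp measurable_fst measurable_fst).
Qed.

Lemma measurable_coord2 (g : R -> R) : measurable_fun setT g ->
  measurable_fun setT (fun q : R3 MR => g q.1.2).
Proof.
move=> mg; apply: (measurableT_comp mg).
exact: (measurableT_comp measurable_snd measurable_fst).
Qed.

Lemma measurable_coord3 (g : R -> R) : measurable_fun setT g ->
  measurable_fun setT (fun q : R3 MR => g q.2).
Proof. by move=> mg; apply: (measurableT_comp mg); exact: measurable_snd. Qed.

Lemma measurable_sum3 (g1 g2 g3 : R -> R) :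
  continuous g1 -> continuous g2 -> continuous g3 ->
  measurable_fun setT (fun q : R3 MR => g1 q.1.1 + g2 q.1.2 + g3 q.2).
Proof.
move=> c1 c2 c3; apply: measurable_funD; first apply: measurable_funD.
- by apply: measurable_coord1; exact: continuous_measurable_fun.
- by apply: measurable_coord2; exact: continuous_measurable_fun.
- by apply: measurable_coord3; exact: continuous_measurable_fun.
Qed.

Lemma torus_integralE (f : R3 MR -> \bar R) : measurable_fun setT f ->
  (forall q, 0 <= f q)%E ->
  (\int[mu]_(q in T) f q = \int[@lebesgue_measure R]_(x in Ipi)
    \int[@lebesgue_measure R]_(y in Ipi) \int[@lebesgue_measure R]_(z in Ipi) f (x, y, z))%E.
Proof.
move=> mf f0; have mI := measurable_itv (`]- pi, (pi : R)]).
have m3 := measurable_marginal (@lebesgue_measure R) mf f0 mI.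
rewrite (@integral_setX _ _ _ _ R (@lebesgue_measure R) f mf f0
  (leb2 R) _ _ (measurableX mI mI) mI).
rewrite (@integral_setX _ _ _ _ R (@lebesgue_measure R) _
  m3 (fun z => integral_ge0 _ (fun x _ => f0 (z, x))) (@lebesgue_measure R) _ _ mI mI).
by [].
Qed.

(** Translation invariance on the torus for 2 pi-periodic functions, one
    coordinate at a time. *)
Lemma torus_shift (phi : R3 R) (f : R3 MR -> \bar R) :
  measurable_fun setT f -> (forall q, 0 <= f q)%E ->
  (forall x y z, f (x + 2 * pi, y, z) = f (x, y, z)) ->
  (forall x y z, f (x, y + 2 * pi, z) = f (x, y, z)) ->
  (forall x y z, f (x, y, z + 2 * pi) = f (x, y, z)) ->
  `|phi.1.1| <= pi -> `|phi.1.2| <= pi -> `|phi.2| <= pi ->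
  (\int[mu]_(q in T) f (q - phi)%R = \int[mu]_(q in T) f q)%E.
Proof.
move=> mf f0 p1 p2 p3 h1 h2 h3; have pi0 := pi_gt0 R.
have r (u : R) : `|u| <= pi -> - (2 * pi) <= u <= 2 * pi.
  by rewrite ler_norml => /andP[? ?]; lra.
have mshift : measurable_fun setT (fun q : R3 MR => q - phi : R3 MR).
  have ms (c : R) : measurable_fun setT (fun x : MR => x - c : MR).
    by apply: measurable_funB => //; exact: measurable_cst.
  apply/measurable_fun_pairP; split.
    apply/measurable_fun_pairP; split.
      exact: (measurable_coord1 (ms phi.1.1)).
    exact: (measurable_coord2 (ms phi.1.2)).
  exact: (measurable_coord3 (ms phi.2)).
rewrite [RHS](torus_integralE mf f0).
apply: (etrans (torus_integralE (measurableT_comp mf mshift) (fun q => f0 _))).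
have m3 := measurable_marginal (@lebesgue_measure R) mf f0 (measurable_itv `]- pi, pi]).
have m2 := measurable_marginal (@lebesgue_measure R) m3
  (fun z => integral_ge0 _ (fun x _ => f0 (z, x))) (measurable_itv `]- pi, pi]).
rewrite -(integral_periodic m2 _ _ (r _ h1)).
- apply: eq_integral => x _.
  have my : measurable_fun setT (fun y => \int[@lebesgue_measure R]_(z in Ipi) f ((x - phi.1.1)%R, y, z))%E.
    exact: (measurableT_comp m3 (pair1_measurable _)).
  rewrite -(integral_periodic my _ _ (r _ h2)).
  + apply: eq_integral => y _.
    have mz : measurable_fun setT (fun z => f ((x - phi.1.1)%R, (y - phi.1.2)%R, z))%E.
      exact: (measurableT_comp mf (pair1_measurable _)).
    by rewrite -(integral_periodic mz _ _ (r _ h3)).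
  + by move=> y; apply: integral_ge0.
  + by move=> y; apply: eq_integral => z _; rewrite p2.
- by move=> x; apply: integral_ge0 => y _; apply: integral_ge0.
- by move=> x; apply: eq_integral => y _; apply: eq_integral => z _; rewrite p1.
Qed.

End Torus.

(** * Integrability of the inverse dispersion *)

Section Dispersion.
Variable R : realType.
Local Notation mu := (leb3 R).
Local Notation MR := (measurableTypeR R).
Local Notation T := (@torus R : set (R3 MR)).

(** The contribution of one coordinate to the symbol, which is a sum of three
    functions of one variable. *)
Definition dispersion1 (ga ka t : R) : R := (1 - cos t) + ga * (1 - cos (ka - t)).

Lemma calE_sum ga (k q : R3 R) : calE k ga q =
  dispersion1 ga k.1.1 q.1.1 + dispersion1 ga k.1.2 q.1.2 + dispersion1 ga k.2 q.2.
Proof. by rewrite /calE /dispersion /dispersion1 /=; ring. Qed.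

Lemma continuous_dispersion1 ga ka : continuous (dispersion1 ga ka).
Proof.
have c1 : continuous (fun t : R => 1 - cos t).
  by move=> t; apply: cvgB; [exact: cvg_cst|exact: continuous_cos].
have c2 : continuous (fun t : R => ka - t).
  by move=> t; apply: cvgB; [exact: cvg_cst|exact: cvg_id].
move=> t; apply: cvgD; first exact: c1.
apply: cvgM; first exact: cvg_cst.
by have := @continuous_comp _ _ _ _ _ t (c2 t) (c1 (ka - t)).
Qed.

Lemma measurable_calE k ga : measurable_fun setT (calE k ga : R3 MR -> R).
Proof.
rewrite (_ : calE k ga = fun q => dispersion1 ga k.1.1 q.1.1 +
  dispersion1 ga k.1.2 q.1.2 + dispersion1 ga k.2 q.2); last first.
  by apply/funext => q; rewrite calE_sum.
by apply: measurable_sum3; exact: continuous_dispersion1.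
Qed.

Lemma calE0 (k q : R3 R) : calE k 0 q = dispersion q.
Proof. by rewrite /calE mul0r addr0. Qed.

Lemma measurable_dispersion : measurable_fun setT (@dispersion R : R3 MR -> R).
Proof.
rewrite (_ : @dispersion R = calE 0 0); first exact: measurable_calE.
by apply/funext => q; rewrite calE0.
Qed.

Lemma dispersion_ge0 (q : R3 R) : 0 <= dispersion q.
Proof.
by rewrite /dispersion; have := cos_le1 q.1.1; have := cos_le1 q.1.2;
  have := cos_le1 q.2; lra.
Qed.

Lemma dispersionN (q : R3 R) : dispersion (- q) = dispersion q.
Proof. by rewrite /dispersion /= !cosN. Qed.

Lemma cosD2pi1 (x : R) : cos (x + 2 * pi) = cos x.
Proof. by rewrite mulr_natl cosD2pi. Qed.

Let amgm3 (a b c : R) : 0 <= a -> 0 <= b -> 0 <= c ->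
  3 * (a * b * c) <= a ^+ 3 + b ^+ 3 + c ^+ 3.
Proof.
move=> a0 b0 c0; rewrite -subr_ge0.
have -> : a ^+ 3 + b ^+ 3 + c ^+ 3 - 3 * (a * b * c) =
  (a + b + c) * ((a - b) ^+ 2 + (b - c) ^+ 2 + (c - a) ^+ 2) / 2 by field.
by rewrite divr_ge0// mulr_ge0 ?addr_ge0 ?sqr_ge0.
Qed.

Let phi3 (de t : R) : R := (`|t| + de) `^ (3^-1 - 1).

(** The dispersion dominates |q|^2 / 32, and by the inequality of arithmetic and
    geometric means |q|^2 dominates the product of the |q_i|^(2/3): this
    separates the variables.  The regularisation [de] keeps all quantities
    finite; 64 = 2 * 32 comes from (|t| + de)^2 <= 2 t^2 + 2 de^2 and
    [cos_upper]. *)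
Lemma dispersion_reg_le (de : R) (q : R3 R) : 0 < de -> torus q ->
  (dispersion q + 6 * de ^+ 2 / 64)^-1 <=
  64 / 3 * phi3 de q.1.1 * phi3 de q.1.2 * phi3 de q.2.
Proof.
move=> d0 [[h1 h2] h3].
have P (t : R) : t \in `]- pi, pi] ->
   [/\ 0 < phi3 de t & (phi3 de t)^-1 ^+ 3 <= 64 * (1 - cos t) + 2 * de ^+ 2].
  rewrite in_itv/= => /andP[t1 t2].
  have p0 : 0 < `|t| + de by rewrite ltr_wpDl.
  split; first exact: powR_gt0.
  rewrite /phi3 -powRN opprB -(@powR_mulrn _ _ 3) ?powR_ge0// -powRrM.
  rewrite (_ : (1 - 3^-1) * 3%:R = 2%:R :> R); last by field.
  rewrite powR_mulrn ?(ltW p0)//.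
  have ht : t ^+ 2 <= 32 * (1 - cos t) by apply: cos_upper; rewrite t2 ltW.
  have h2' : `|t| ^+ 2 = t ^+ 2 by rewrite real_normK ?num_real.
  have := sqr_ge0 (`|t| - de); rewrite sqrrB sqrrD h2' => h3'; lra.
have [a0 ha] := P _ h1; have [b0 hb] := P _ h2; have [c0 hc] := P _ h3.
set a := phi3 de q.1.1 in a0 ha *; set b := phi3 de q.1.2 in b0 hb *.
set c := phi3 de q.2 in c0 hc *.
have h : 3 * (a^-1 * b^-1 * c^-1) <= a^-1 ^+ 3 + b^-1 ^+ 3 + c^-1 ^+ 3.
  by apply: amgm3; rewrite invr_ge0 ltW.
have pos : 0 < 3 / 64 * (a^-1 * b^-1 * c^-1) by rewrite !mulr_gt0 ?invr_gt0.
have -> : 64 / 3 * a * b * c = (3 / 64 * (a^-1 * b^-1 * c^-1))^-1.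
  by field; rewrite !gt_eqF.
rewrite lef_pV2 ?posrE//; first by rewrite /dispersion; lra.
by apply: (lt_le_trans pos); rewrite /dispersion; lra.
Qed.

Lemma integral_dispersion_reg (de : R) : 0 < de <= 1 ->
  (\int[mu]_(q in T) ((dispersion q + 6 * de ^+ 2 / 64)^-1)%:E <=
  (64 / 3 * (6 * (pi + 1) `^ 3^-1) ^+ 3)%:E)%E.
Proof.
move=> hde; have /andP[d0 d1] := hde.
pose f (q : R3 MR) := 64 / 3 * phi3 de q.1.1 * phi3 de q.1.2 * phi3 de q.2.
have mphi : measurable_fun setT (phi3 de : MR -> MR).
  by have /measurable_EFinP := @measurable_powR_shift R de (3^-1 - 1).
have mf : measurable_fun setT (fun q => (f q)%:E).
  apply/measurable_EFinP; apply: measurable_funM; last exact: measurable_coord3.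
  apply: measurable_funM; last exact: measurable_coord2.
  apply: measurable_funM; last exact: measurable_coord1.
  exact: measurable_cst.
have phi0 t : 0 <= phi3 de t by exact: powR_ge0.
have f0 q : (0 <= (f q)%:E)%E by rewrite lee_fin /f !mulr_ge0.
have mT := @measurable_torus R.
have m1 : measurable_fun T (fun q => ((dispersion q + 6 * de ^+ 2 / 64)^-1)%:E).
  apply/measurable_EFinP; apply: measurable_funTS; apply: measurable_funV.
  by apply: measurable_funD; [exact: measurable_dispersion|exact: measurable_cst].
apply: (@le_trans _ _ (\int[mu]_(q in T) (f q)%:E)%E).
  apply: ge0_le_integral => //.
  - move=> q Tq; rewrite lee_fin invr_ge0 addr_ge0 ?dispersion_ge0//.
    by rewrite divr_ge0// mulr_ge0// sqr_ge0.
  - exact: measurable_funTS.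
  - by move=> q Tq; rewrite lee_fin; exact: dispersion_reg_le.
rewrite torus_integralE//; have := powR_int_bound hde.
set J := integral _ _ _ => JK.
have J0 : (0 <= J)%E by apply: integral_ge0 => t _; rewrite lee_fin powR_ge0.
have [j Jj] : exists j : R, J = j%:E.
  exists (fine J); rewrite fineK// ge0_fin_numE//.
  exact: le_lt_trans JK (ltry _).
rewrite Jj in JK J0; rewrite !lee_fin in J0 JK.
have Z c : 0 <= c ->
   (\int[@lebesgue_measure R]_(t in `](- pi)%R, pi]) (c * phi3 de t)%:E = (c * j)%:E)%E.
  move=> c0; under eq_integral do rewrite EFinM.
  rewrite ge0_integralZl_EFin//; first by rewrite EFinM -Jj.
  - by move=> t _; rewrite lee_fin.
  - by apply: measurable_funTS; exact/measurable_EFinP.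
have E1 x y : (\int[@lebesgue_measure R]_(z in `](- pi)%R, pi]) (f (x, y, z))%:E =
    (64 / 3 * phi3 de x * j * phi3 de y)%:E)%E.
  rewrite /f /= Z; last by rewrite !mulr_ge0.
  by congr EFin; rewrite mulrAC.
have E2 x : (\int[@lebesgue_measure R]_(y in `](- pi)%R, pi])
    \int[@lebesgue_measure R]_(z in `](- pi)%R, pi]) (f (x, y, z))%:E =
    (64 / 3 * j * j * phi3 de x)%:E)%E.
  under eq_integral => y _ do rewrite E1.
  rewrite Z; last by rewrite !mulr_ge0.
  by congr EFin; ring.
under eq_integral => x _ do rewrite E2.
rewrite Z; last by rewrite !mulr_ge0.
rewrite lee_fin (_ : 64 / 3 * j * j * j = 64 / 3 * j ^+ 3); last by ring.
have B0 := le_trans J0 JK.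
by rewrite ler_wpM2l// lerXn2r// nnegrE.
Qed.

(** The bound on the regularised integrals is uniform, and they increase to the
    integral of 1 / dispersion as the regularisation disappears. *)
Lemma integrable_inv_dispersion :
  mu.-integrable T (EFin \o (fun q => (dispersion q)^-1)).
Proof.
have mT := @measurable_torus R.
have md : measurable_fun T (fun q : R3 MR => (dispersion q)^-1).
  by apply: measurable_funTS; apply: measurable_funV; exact: measurable_dispersion.
have d0 (q : R3 R) := dispersion_ge0 q.
apply/integrableP; split; first exact/measurable_EFinP.
under eq_integral => q _ do rewrite /= ger0_norm ?invr_ge0//.
pose de n : R := n.+1%:R^-1.
have hde n : 0 < de n <= 1 by rewrite invr_gt0 ltr0n/= invf_le1 ?ltr0n// ler1n.
pose f n (q : R3 R) := (dispersion q + 6 * de n ^+ 2 / 64)^-1.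
have pos n q : 0 < dispersion q + 6 * de n ^+ 2 / 64.
  have /andP[h _] := hde n; rewrite ltr_wpDl// divr_gt0// mulr_gt0//.
  by rewrite exprn_gt0.
have mf n : measurable_fun T (fun q : R3 MR => (f n q)%:E).
  apply/measurable_EFinP; apply: measurable_funTS; apply: measurable_funV.
  by apply: measurable_funD; [exact: measurable_dispersion|exact: measurable_cst].
have f0 n q : T q -> (0 <= (f n q)%:E)%E.
  by move=> _; rewrite lee_fin invr_ge0 ltW.
have homo q : T q -> {homo (fun n => (f n q)%:E) : n p / (n <= p)%N >-> (n <= p)%E}.
  move=> _ n p np; rewrite lee_fin lef_pV2 ?posrE// lerD2l ler_pM2r ?invr_gt0//.
  rewrite ler_pM2l// lerXn2r ?nnegrE ?invr_ge0// lef_pV2 ?posrE ?ltr0n//.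
  by rewrite ler_nat.
have cv := @cvg_monotone_convergence _ _ _ mu _ mT _ mf f0 homo.
apply: (@le_lt_trans _ _ (\int[mu]_(q in T) limn (fun n => (f n q)%:E))%E).
  apply: ge0_le_integral => //.
  - by move=> q _; rewrite lee_fin invr_ge0.
  - exact/measurable_EFinP.
  - apply: (emeasurable_fun_cvg (fun n q => (f n q)%:E)) => // q Tq.
    by apply: ereal_nondecreasing_is_cvgn; exact: homo.
  (* Where the dispersion vanishes its inverse is 0 by convention, and only an
     inequality survives in the limit. *)
  - move=> q Tq; have [e0|en0] := eqVneq (dispersion q) 0.
      rewrite e0 invr0; apply: lime_ge.
        by apply: ereal_nondecreasing_is_cvgn; exact: homo.
      by apply: nearW => n; exact: f0.
    rewrite (_ : limn _ = ((dispersion q)^-1)%:E)//; apply/cvg_lim => //.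
    apply: cvg_EFin; first exact: nearW.
    apply: cvgV => //; rewrite -[X in _ --> X]addr0; apply: cvgD; first exact: cvg_cst.
    rewrite (_ : 0 = 6 * 0 ^+ 2 / 64 :> R); last by ring.
    apply: cvgMl; apply: cvgMr; rewrite expr2.
    under eq_fun do rewrite expr2.
    by apply: cvgM; exact: cvg_harmonic.
apply: (@le_lt_trans _ _ (64 / 3 * (6 * (pi + 1) `^ 3^-1) ^+ 3)%:E%E); last exact: ltry.
rewrite -(cvg_lim _ cv)//; apply: lime_le; first exact: cvgP cv.
by apply: nearW => n; exact: integral_dispersion_reg.
Qed.

End Dispersion.

(** * The integral of the resolvent of a bounded symbol *)

Section Symbol.
Variable R : realType.
Local Notation mu := (leb3 R).
Local Notation MR := (measurableTypeR R).
Local Notation T := (@torus R : set (R3 MR)).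
Local Notation vol := ((2 * pi) ^+ 3 : R).

Lemma vol_gt0 : 0 < vol.
Proof. by rewrite exprn_gt0// mulr_gt0// pi_gt0. Qed.

Lemma fine_torus : fine (mu T) = vol.
Proof. by rewrite leb3_torus. Qed.

Lemma integrable_torus (f : R3 MR -> R) C : measurable_fun T f ->
  (forall q, torus q -> `|f q| <= C) -> mu.-integrable T (EFin \o f).
Proof.
move=> mf fC.
exact: (integrable_of_bounded (@measurable_torus R) (leb3_torus_fin R) mf fC).
Qed.

(** Strict comparison of integrals: a pointwise inequality with a gain [c] on a
    set B improves the integral by c times the measure of B. *)
Lemma Rintegral_gain (f g : R3 MR -> R) (c : R) (B : set (R3 MR)) :
  mu.-integrable T (EFin \o f) -> mu.-integrable T (EFin \o g) ->
  measurable B -> B `<=` T -> (forall q, torus q -> f q <= g q) ->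
  (forall q, B q -> f q + c <= g q) ->
  \int[mu]_(q in T) f q + c * fine (mu B) <= \int[mu]_(q in T) g q.
Proof.
move=> If Ig mB BT fg fcg; have mT := @measurable_torus R.
have Boo : (mu B < +oo)%E.
  by apply: le_lt_trans (leb3_torus_fin R); apply: le_measure => //; rewrite inE.
have I1 : mu.-integrable T (EFin \o (fun q => c * \1_B q)).
  apply: (@integrable_torus _ `|c|).
    by apply: measurable_funM; [exact: measurable_cst|exact: measurable_indic].
  move=> q _; rewrite normrM indicE; case: (q \in B); rewrite ?normr1 ?normr0 ?mulr1//.
  by rewrite mulr0.
have eB : \int[mu]_(q in T) (\1_B q : R) = fine (mu B).
  by rewrite /Rintegral integral_indic// setIidl.
have I0 : mu.-integrable T (EFin \o (\1_B : R3 MR -> R)).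
  apply: (@integrable_torus _ 1); first exact: measurable_indic.
  by move=> q _; rewrite indicE; case: (q \in B); rewrite ?normr1 ?normr0.
rewrite -eB -RintegralZl// -RintegralD//; apply: le_Rintegral => //.
  exact: (integrableD mT If I1).
move=> q Tq; rewrite indicE; case: (boolP (q \in B)) => [|_].
  by rewrite inE mulr1 => /fcg.
by rewrite mulr0 addr0 fg.
Qed.

Variables (E : R3 R -> R) (lo hi : R).
Hypotheses (mE : measurable_fun setT (E : R3 MR -> R)).
Hypotheses (loE : forall q, lo <= E q) (Ehi : forall q, E q <= hi).

Definition inv_symbol_integral (l : R) : R := \int[mu]_(q in T) (E q - l)^-1.
Local Notation F := inv_symbol_integral.

Lemma measurable_inv_symbol l :
  measurable_fun T (fun q : R3 MR => (E q - l)^-1).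
Proof.
apply: measurable_funTS; apply: measurable_funV.
by apply: measurable_funB => //; exact: measurable_cst.
Qed.

Lemma inv_symbol_bounds l q : l < lo -> 0 < (E q - l)^-1 <= (lo - l)^-1.
Proof.
move=> llo; have d0 : 0 < lo - l by rewrite subr_gt0.
have := loE q => h; have e0 : 0 < E q - l by lra.
by rewrite invr_gt0 e0/= lef_pV2 ?posrE//; lra.
Qed.

Lemma integrable_inv_symbol l : l < lo ->
  mu.-integrable T (EFin \o (fun q => (E q - l)^-1)).
Proof.
move=> llo; apply: (@integrable_torus _ (lo - l)^-1).
  exact: measurable_inv_symbol.
by move=> q _; have /andP[h1 h2] := inv_symbol_bounds q llo; rewrite gtr0_norm.
Qed.

Lemma inv_symbol_diff l l' q : l < lo -> l' < lo ->
  (E q - l')^-1 - (E q - l)^-1 = (l' - l) * ((E q - l')^-1 * (E q - l)^-1).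
Proof.
move=> h h'; have := loE q => hq.
by field; apply/andP; split; rewrite gt_eqF//; lra.
Qed.

Lemma inv_symbol_integral_lip l l' l1 : l <= l1 -> l' <= l1 -> l1 < lo ->
  `|F l' - F l| <= vol / (lo - l1) ^+ 2 * `|l' - l|.
Proof.
move=> h h' h1; have llo : l < lo by lra.
have llo' : l' < lo by lra.
have mT := @measurable_torus R.
rewrite /F -RintegralB//; last 2 first.
- exact: integrable_inv_symbol.
- exact: integrable_inv_symbol.
have Id : mu.-integrable T (EFin \o (fun q => (E q - l')^-1 - (E q - l)^-1)).
  by apply: (integrableB mT (integrable_inv_symbol llo') (integrable_inv_symbol llo)).
apply: (le_trans (le_normr_Rintegral mT Id)).
have -> : vol / (lo - l1) ^+ 2 * `|l' - l| =
   \int[mu]_(q in T) (`|l' - l| / (lo - l1) ^+ 2).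
  by rewrite Rintegral_cst// fine_torus mulrC mulrA mulrAC.
apply: le_Rintegral => //.
- exact: (integrable_norm Id).
- by apply: integrable_torus => [|q _]; [exact: measurable_cst|exact: lexx].
move=> q _; rewrite inv_symbol_diff// normrM ler_wpM2l//.
have /andP[a0 a1] := inv_symbol_bounds q llo.
have /andP[b0 b1] := inv_symbol_bounds q llo'.
rewrite gtr0_norm ?mulr_gt0// expr2 invfM ler_pM ?(ltW a0) ?(ltW b0)//.
- by apply: (le_trans b1); rewrite lef_pV2 ?posrE; lra.
- by apply: (le_trans a1); rewrite lef_pV2 ?posrE; lra.
Qed.

(** Since the symbol is bounded above, the inverse grows with l by an amount
    bounded below uniformly in q. *)
Lemma inv_symbol_integral_mono l l' : l < l' -> l' < lo -> F l < F l'.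
Proof.
move=> ll' llo'; have llo : l < lo by lra.
pose c := (l' - l) / (hi - l) ^+ 2.
have lohi : lo <= hi by have := loE 0; have := Ehi 0; lra.
have hl : 0 < hi - l by lra.
have c0 : 0 < c by rewrite divr_gt0 ?subr_gt0// exprn_gt0.
have gain q : (E q - l)^-1 + c <= (E q - l')^-1.
  rewrite -lerBrDl inv_symbol_diff// /c ler_wpM2l//; first by lra.
  have h := loE q; have h' := Ehi q.
  by rewrite expr2 invfM; apply: ler_pM; rewrite ?invr_ge0 ?lef_pV2 ?posrE; lra.
have := @Rintegral_gain _ _ c T (integrable_inv_symbol llo)
  (integrable_inv_symbol llo') (@measurable_torus R) (fun q Tq => Tq).
rewrite fine_torus => H; apply: lt_le_trans (H _ _).
- by rewrite ltrDl mulr_gt0// vol_gt0.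
- by move=> q _; apply: le_trans (gain q); rewrite lerDl ltW.
- by move=> q _; exact: gain.
Qed.

Lemma inv_symbol_integral_inj l l' : l < lo -> l' < lo -> F l = F l' -> l = l'.
Proof.
move=> h h' e; have [ll|ll|//] := ltgtP l l'.
- by have := inv_symbol_integral_mono ll h'; rewrite e ltxx.
- by have := inv_symbol_integral_mono ll h; rewrite e ltxx.
Qed.

(** The intermediate value theorem, applied to the Lipschitz function obtained
    by making F constant beyond l1, since the Lipschitz bounds blow up at the edge
    [lo]. *)
Lemma inv_symbol_integral_ivt l0 l1 c : l0 < l1 -> l1 < lo ->
  F l0 < c -> c < F l1 -> exists l, [/\ l0 < l, l < lo & F l = c].
Proof.
move=> l01 l1lo h0 h1.
pose G l := F (Num.min l l1).
pose K := vol / (lo - l1) ^+ 2.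
have K0 : 0 < K.
  by rewrite divr_gt0 ?vol_gt0// exprn_gt0// subr_gt0.
have GL x y : `|G x - G y| <= K * `|x - y|.
  apply: le_trans (inv_symbol_integral_lip _ _ l1lo) _.
  - by rewrite ge_min lexx orbT.
  - by rewrite ge_min lexx orbT.
  rewrite ler_wpM2l ?(ltW K0)//.
  have h := ler_norm (x - y); have h' := ler_norm (- (x - y)); rewrite normrN in h'.
  rewrite ler_norml /Num.min; case: ltP => h2; case: ltP => h3; apply/andP; split; lra.
have cG : continuous G.
  move=> x; apply/cvgrPdist_le => e e0; near=> y.
  apply: le_trans (GL x y) _; rewrite mulrC -ler_pdivlMr//; apply: ltW.
  near: y; apply: (@cvgr_dist_lt _ _ _ (nbhs x) _ id); first exact: cvg_id.
  by rewrite divr_gt0.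
have G0 : G l0 = F l0 by rewrite /G min_l// ltW.
have G1 : G l1 = F l1 by rewrite /G minxx.
have [|l + Gl] := @IVT R G l0 l1 c (ltW l01) (continuous_subspaceT cG).
  by rewrite G0 G1 ge_min (ltW h0)/= le_max (ltW h1) orbT.
rewrite in_itv/= => /andP[hl0 hl1].
have Fl : F l = c by rewrite -Gl /G min_l.
exists l; split => //; last by lra.
by rewrite lt_neqAle hl0 andbT; apply/negP => /eqP e; move: h0; rewrite e Fl ltxx.
Unshelve. all: end_near. Qed.

End Symbol.

(** * The symbol in phase form and the bottom of the band *)

Section Model.
Variable R : realType.
Local Notation mu := (leb3 R).
Local Notation MR := (measurableTypeR R).
Local Notation T := (@torus R : set (R3 MR)).
Local Notation vol := ((2 * pi) ^+ 3 : R).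

(** The product formula for a difference of cosines, with |sin u| <= |u|. *)
Lemma cos_lip (x y : R) : `|cos x - cos y| <= `|x - y|.
Proof.
have sl (u : R) : `|sin u| <= `|u|.
  wlog u0 : u / 0 <= u.
    move=> H; have [/H//|u0] := leP 0 u.
    by rewrite -normrN -[leRHS]normrN -sinN; apply: H; lra.
  have [u1|u1] := leP u 1.
    rewrite (ger0_norm u0) ger0_norm ?sin_le_id//.
    by apply: sin_ge0_pi; have := pi_ge2 R; lra.
  by rewrite (ger0_norm u0) (le_trans (sin_max u))// ltW.
have -> : cos x - cos y = - 2 * (sin ((x + y) / 2) * sin ((x - y) / 2)).
  have -> : cos x = cos ((x + y) / 2 + (x - y) / 2) by congr cos; field.
  have -> : cos y = cos ((x + y) / 2 - (x - y) / 2) by congr cos; field.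
  by rewrite cosD cosB; ring.
rewrite !normrM normrN (ger0_norm (ler0n _ 2)).
have h1 := sin_max ((x + y) / 2); have h2 := sl ((x - y) / 2).
rewrite normrM (ger0_norm (_ : 0 <= 2^-1)) in h2; last by rewrite invr_ge0.
have := normr_ge0 (sin ((x + y) / 2)); have := normr_ge0 (sin ((x - y) / 2)).
nra.
Qed.

Lemma cos_lt1 (x : R) : x \in `]- pi, pi] -> x != 0 -> cos x < 1.
Proof.
rewrite in_itv/= => /andP[h1 h2] x0.
have := @cos_upper R x; rewrite h2 ltW// => /(_ isT).
have : 0 < x ^+ 2 by rewrite exprn_even_gt0.
lra.
Qed.

Lemma dispersion_le6 (q : R3 R) : dispersion q <= 6.
Proof.
by rewrite /dispersion; have := cos_geN1 q.1.1; have := cos_geN1 q.1.2;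
  have := cos_geN1 q.2; lra.
Qed.

Lemma dispersion_gt0 (q : R3 R) : torus q -> q != 0 -> 0 < dispersion q.
Proof.
move: q => [[x y] z] [[/= hx hy] hz].
rewrite -!pair_eqE /= => /nandP q0; rewrite /dispersion /=.
have := cos_le1 x; have := cos_le1 y; have := cos_le1 z.
case: q0 => [/nandP[x0|y0]|z0].
- by have := cos_lt1 hx x0; lra.
- by have := cos_lt1 hy y0; lra.
- by have := cos_lt1 hz z0; lra.
Qed.

Lemma dispersion_lip (p q : R3 R) (h : R) : `|p.1.1 - q.1.1| <= h ->
  `|p.1.2 - q.1.2| <= h -> `|p.2 - q.2| <= h ->
  `|dispersion p - dispersion q| <= 3 * h.
Proof.
move=> h1 h2 h3.
have := le_trans (cos_lip _ _) h1; have := le_trans (cos_lip _ _) h2.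
have := le_trans (cos_lip _ _) h3; rewrite /dispersion.
rewrite !ler_norml => /andP[? ?] /andP[? ?] /andP[? ?]; apply/andP; split; lra.
Qed.

Lemma negligible_point (p : R3 MR) : mu [set p] = 0%E.
Proof.
case: p => [[x y] z].
rewrite (_ : [set _] = [set x] `*` [set y] `*` [set z]); last first.
  by apply/seteqP; split => [_ ->//|[[a b] c] [[/= -> ->] ->]].
transitivity ((@lebesgue_measure R \x @lebesgue_measure R)%E ([set x] `*` [set y])
  * @lebesgue_measure R [set z])%E.
  by apply: product_measure1E => //; exact: measurableX.
by rewrite lebesgue_measure_set1 mule0.
Qed.

(** Two points are allowed to differ because the symbols of interest involve
    1 / dispersion at q and at q - k, each with one zero. *)
Lemma Rintegral_off_points (p1 p2 : R3 R) (f g : R3 MR -> R) :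
  measurable_fun T f -> measurable_fun T g ->
  (forall q, torus q -> q != p1 -> q != p2 -> f q = g q) ->
  \int[mu]_(q in T) f q = \int[mu]_(q in T) g q.
Proof.
move=> mf mg fg; rewrite /Rintegral; congr fine; apply: ae_eq_integral => //.
- exact: measurable_torus.
- exact/measurable_EFinP.
- exact/measurable_EFinP.
have mS (p : R3 MR) : measurable [set p].
  case: p => [[x y] z].
  rewrite (_ : [set _] = [set x] `*` [set y] `*` [set z]); last first.
    by apply/seteqP; split => [_ ->//|[[a b] c] [[/= -> ->] ->]].
  by apply: measurableX => //; exact: measurableX.
exists ([set p1] `|` [set p2]); split.
- by apply: measurableU; exact: mS.
- apply/eqP; rewrite eq_le measure_ge0 andbT.
  apply: (le_trans (measureU2 _ (mS p1) (mS p2))).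
  rewrite -[leRHS]adde0; apply: leeD;
    by rewrite le_eqVlt; apply/orP; left; apply/eqP; exact: negligible_point.
- move=> q /= /not_implyP[Tq]; apply: contra_notP => /not_orP[/eqP h1 /eqP h2].
  by rewrite fg.
Qed.

Lemma torus_Rshift (phi : R3 R) (f : R3 MR -> R) :
  measurable_fun setT f -> (forall q, 0 <= f q) ->
  (forall x y z, f (x + 2 * pi, y, z) = f (x, y, z)) ->
  (forall x y z, f (x, y + 2 * pi, z) = f (x, y, z)) ->
  (forall x y z, f (x, y, z + 2 * pi) = f (x, y, z)) ->
  `|phi.1.1| <= pi -> `|phi.1.2| <= pi -> `|phi.2| <= pi ->
  \int[mu]_(q in T) f (q - phi) = \int[mu]_(q in T) f q /\
  (mu.-integrable T (EFin \o f) ->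
   mu.-integrable T (EFin \o (fun q => f (q - phi)))).
Proof.
move=> mf f0 p1 p2 p3 h1 h2 h3.
have mfE : measurable_fun setT (EFin \o f) by exact/measurable_EFinP.
have e : (\int[mu]_(q in T) (f (q - phi)%R)%:E = \int[mu]_(q in T) (f q)%:E)%E.
  have f0E q : (0 <= (EFin \o f) q)%E by rewrite lee_fin.
  by apply: (torus_shift mfE f0E) => // x y z /=; rewrite ?p1 ?p2 ?p3.
split; first by rewrite /Rintegral e.
move=> /integrableP[_ If]; apply/integrableP; split.
  apply: measurable_funTS; apply/measurable_EFinP.
  apply: (measurableT_comp mf).
  have ms (c : R) : measurable_fun setT (fun x : MR => x - c : MR).
    by apply: measurable_funB => //; exact: measurable_cst.
  apply/measurable_fun_pairP; split.
    apply/measurable_fun_pairP; split.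
      exact: (measurable_coord1 (ms phi.1.1)).
    exact: (measurable_coord2 (ms phi.1.2)).
  exact: (measurable_coord3 (ms phi.2)).
rewrite (_ : integral _ _ _ = \int[mu]_(q in T) (f q)%:E)%E; last first.
  by rewrite -e; apply: eq_integral => q _; rewrite /= ger0_norm.
by apply: le_lt_trans If; rewrite le_eqVlt; apply/orP; left; apply/eqP;
  apply: eq_integral => q _; rewrite /= ger0_norm.
Qed.

Variable ga : R.
Hypothesis ga0 : 0 < ga.

(** The modulus of 1 + ga * exp (i ka). *)
Definition amplitude (ka : R) : R := Num.sqrt (1 + ga ^+ 2 + 2 * ga * cos ka).

Lemma amplitude_le ka : amplitude ka <= 1 + ga.
Proof.
have g0 := ga0; rewrite -(@ger0_norm _ (1 + ga)); last by lra.
rewrite -sqrtr_sqr ler_wsqrtr//; have := cos_le1 ka; nra.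
Qed.

Lemma amplitude_lt ka : cos ka < 1 -> amplitude ka < 1 + ga.
Proof.
have g0 := ga0; move=> c1; rewrite -(@ger0_norm _ (1 + ga)); last by lra.
rewrite -sqrtr_sqr ltr_sqrt; first by nra.
by rewrite exprn_gt0//; lra.
Qed.

Lemma polar (x y : R) : exists2 phi : R, phi \in `]- pi, pi] &
  x = Num.sqrt (x ^+ 2 + y ^+ 2) * cos phi /\
  y = Num.sqrt (x ^+ 2 + y ^+ 2) * sin phi.
Proof.
set a := Num.sqrt _; have p0 := pi_gt0 R.
have xy0 : 0 <= x ^+ 2 + y ^+ 2 by rewrite addr_ge0 ?sqr_ge0.
have a2 : a ^+ 2 = x ^+ 2 + y ^+ 2 by rewrite sqr_sqrtr.
have a0 : 0 <= a := sqrtr_ge0 _.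
have [a00|an0] := eqVneq a 0.
  exists 0; first by rewrite in_itv/= oppr_lt0 p0 ltW.
  rewrite a00 !mul0r; have x2 := sqr_ge0 x; have y2 := sqr_ge0 y.
  by rewrite a00 expr0n/= in a2; split; apply/eqP; rewrite -sqrf_eq0; apply/eqP; lra.
have ap : 0 < a by rewrite lt_neqAle eq_sym an0.
have u2 : (x / a) ^+ 2 + (y / a) ^+ 2 = 1.
  by rewrite !expr_div_n -mulrDl -a2 divff// expf_neq0.
set u := x / a in u2; set w := y / a in u2.
have xu : x = a * u by rewrite mulrC divfK.
have yw : y = a * w by rewrite mulrC divfK.
have w2 := sqr_ge0 w.
have u1 : -1 <= u <= 1 by apply/andP; split; nra.
have [+ cu] := acos_def u1 => /andP[c0 c1].
have su : sin (acos u) = `|w| by rewrite sin_acos// -u2 addrC addKr sqrtr_sqr.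
have [w0|w0] := leP 0 w.
  exists (acos u); first by rewrite in_itv/= c1 andbT; lra.
  by rewrite cu su ger0_norm// -xu -yw.
exists (- acos u).
  rewrite in_itv/= ltrN2 acos_ltpi; first by rewrite /=; lra.
  by apply/andP; split; nra.
by rewrite cosN sinN cu su ltr0_norm// opprK -xu -yw.
Qed.

(** The sum cos t + ga * cos (ka - t) is the real part of
    (1 + ga * exp (i ka)) exp (- i t), a single cosine with amplitude the
    modulus and phase the argument of the bracket. *)
Lemma phase ka : exists2 phi : R, phi \in `]- pi, pi] &
  forall t, dispersion1 ga ka t = 1 + ga - amplitude ka * cos (t - phi).
Proof.
have [phi hphi [hx hy]] := polar (1 + ga * cos ka) (ga * sin ka).
have e : (1 + ga * cos ka) ^+ 2 + (ga * sin ka) ^+ 2 =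
   1 + ga ^+ 2 + 2 * ga * cos ka.
  by rewrite !exprMn sin2cos2; ring.
rewrite e -/(amplitude ka) in hx hy.
exists phi => // t.
have -> : amplitude ka * cos (t - phi) =
    cos t * (1 + ga * cos ka) + sin t * (ga * sin ka).
  by rewrite {1}hx {1}hy cosB; ring.
by rewrite /dispersion1 cosB; ring.
Qed.

Definition band_bottom (k : R3 R) : R := (1 + ga - amplitude k.1.1) +
  (1 + ga - amplitude k.1.2) + (1 + ga - amplitude k.2).

Lemma calE_shift (k : R3 R) : exists2 phi : R3 R, torus phi &
  forall q, calE k ga q = band_bottom k +
    (amplitude k.1.1 * (1 - cos (q - phi).1.1) +
     amplitude k.1.2 * (1 - cos (q - phi).1.2) +
     amplitude k.2 * (1 - cos (q - phi).2)).
Proof.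
have [p1 h1 e1] := phase k.1.1; have [p2 h2 e2] := phase k.1.2.
have [p3 h3 e3] := phase k.2; exists (p1, p2, p3); first by split.
by move=> q; rewrite calE_sum e1 e2 e3 /band_bottom /=; ring.
Qed.

Lemma calE_ge k q : band_bottom k <= calE k ga q.
Proof.
have [phi _ ->] := calE_shift k; rewrite lerDl !addr_ge0// mulr_ge0 ?sqrtr_ge0//;
  by rewrite subr_ge0 cos_le1.
Qed.

Lemma calE_attained k : exists2 q, torus q & calE k ga q = band_bottom k.
Proof.
have [phi Tphi e] := calE_shift k; exists phi => //.
by rewrite e subrr /= cos0; ring.
Qed.

Lemma calE_le k q : calE k ga q <= 6 * (1 + ga).
Proof.
have g0 := ga0; rewrite /calE; have := dispersion_le6 q; have := dispersion_le6 (k - q); nra.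
Qed.

Lemma band_bottom_gt0 k : torus k -> k != 0 -> 0 < band_bottom k.
Proof.
move: k => [[x y] z] [[/= hx hy] hz].
rewrite -!pair_eqE /= => /nandP q0; rewrite /band_bottom /=.
have := amplitude_le x; have := amplitude_le y; have := amplitude_le z.
case: q0 => [/nandP[x0|y0]|z0].
- by have := amplitude_lt (cos_lt1 hx x0); lra.
- by have := amplitude_lt (cos_lt1 hy y0); lra.
- by have := amplitude_lt (cos_lt1 hz z0); lra.
Qed.

End Model.

(** * At energy zero the resolvent integral is subcritical *)

Section Threshold.
Variables (R : realType) (ga : R).
Hypothesis ga0 : 0 < ga.
Local Notation mu := (leb3 R).
Local Notation MR := (measurableTypeR R).
Local Notation T := (@torus R : set (R3 MR)).
Local Notation vol := ((2 * pi) ^+ 3 : R).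
Local Notation watson := (\int[mu]_(q in T) (dispersion q)^-1).

Lemma cos_lt1_2pi (x : R) : `|x| < 2 * pi -> x != 0 -> cos x < 1.
Proof.
rewrite ltr_norml => /andP[h1 h2] x0.
wlog xp : x h1 h2 x0 / 0 < x.
  move=> H; have [/H->//|xn|x00] := ltgtP 0 x; last by rewrite -x00 eqxx in x0.
  by rewrite -cosN; apply: H; rewrite ?oppr_eq0//; lra.
have : 0 < sin (x / 2) by apply: sin_gt0_pi; lra.
rewrite {2}(splitr x) cosD -!expr2 cos2sin2; nra.
Qed.

Lemma dispersion_sub_gt0 (q k : R3 R) : torus q -> torus k -> q != k ->
  0 < dispersion (q - k).
Proof.
move: q k => [[x y] z] [[x' y'] z'] [[/= hx hy] hz] [[/= hx' hy'] hz'].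
have n (s t : R) : s \in `]- pi, pi] -> t \in `]- pi, pi] -> s != t ->
    cos (s - t) < 1.
  rewrite !in_itv/= => hs ht st; apply: cos_lt1_2pi; last by rewrite subr_eq0.
  by rewrite ltr_norml; lra.
rewrite -!pair_eqE /= => /nandP q0; rewrite /dispersion /=.
have := cos_le1 (x - x'); have := cos_le1 (y - y'); have := cos_le1 (z - z').
case: q0 => [/nandP[x0|y0]|z0].
- by have := n _ _ hx hx' x0; lra.
- by have := n _ _ hy hy' y0; lra.
- by have := n _ _ hz hz' z0; lra.
Qed.

(** A box of positive measure on which all three cosines are nonpositive, so that
    the dispersion and its variants have explicit lower bounds. *)
Definition corner : set (R3 MR) := `]pi / 2, pi] `*` `]pi / 2, pi] `*` `]pi / 2, pi].

Lemma measurable_corner : measurable corner.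
Proof. by apply: measurableX => //; exact: measurableX. Qed.

Lemma corner_torus : corner `<=` T.
Proof.
have p0 := pi_gt0 R.
by move=> [[x y] z] [[/= hx hy] hz]; split; [split|]; move: hx hy hz;
  rewrite /= !in_itv/=; lra.
Qed.

Lemma corner_gt0 : 0 < fine (mu corner).
Proof.
have p0 := pi_gt0 R.
by rewrite leb3_box /=; [rewrite !mulr_gt0//; lra|lra|lra|lra].
Qed.

Lemma corner_cos (q : R3 R) : corner q ->
  [/\ cos q.1.1 <= 0, cos q.1.2 <= 0 & cos q.2 <= 0].
Proof.
have p0 := pi_gt0 R.
have h (t : R) : t \in `]pi / 2, pi] -> cos t <= 0.
  rewrite in_itv/= => /andP[t1 t2]; rewrite -cos_pihalf leNgt ltr_cos ?in_itv/=; lra.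
by case=> [[/h h1 /h h2] /h h3].
Qed.

Lemma watson_gt0 : 0 < watson.
Proof.
have I0 : mu.-integrable T (EFin \o (fun=> 0 : R)).
  by apply: (@integrable_torus _ _ 0) => [|q _]; [exact: measurable_cst|rewrite normr0].
have := @Rintegral_gain R _ _ 6^-1 _ I0 (@integrable_inv_dispersion R)
  measurable_corner corner_torus.
rewrite Rintegral_cst ?mul0r ?add0r; last exact: measurable_torus.
move=> H; apply: lt_le_trans (H _ _).
- by rewrite mulr_gt0 ?corner_gt0// invr_gt0.
- by move=> q _; rewrite invr_ge0 dispersion_ge0.
- move=> q /corner_cos[h1 h2 h3].
  have d0 : 0 < dispersion q by rewrite /dispersion; lra.
  by rewrite lef_pV2 ?posrE// dispersion_le6.
Qed.

(** The value that the resolvent integral takes at an eigenvalue; it is also the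
    resolvent integral at k = 0 and energy 0. *)
Definition critical : R := watson / (1 + ga).

Lemma critical_gt0 : 0 < critical.
Proof. by have g0 := ga0; rewrite divr_gt0 ?watson_gt0//; lra. Qed.

Lemma coupling_critical : coupling ga = vol / critical.
Proof.
have g0 := ga0; have w0 := watson_gt0.
rewrite /coupling /mu0 /critical -/watson invf_div; field.
by rewrite gt_eqF.
Qed.

(** The defect in the convexity inequality for the inverse, which shows that the
    inequality is strict unless a = b. *)
Lemma harmonic_mean (a b : R) : 0 < a -> 0 < b ->
  (1 + ga) ^- 2 * (a^-1 + ga * b^-1) - (a + ga * b)^-1 =
  ga * (a - b) ^+ 2 / ((1 + ga) ^+ 2 * (a * b * (a + ga * b))).
Proof.
have g0 := ga0; move=> a0 b0; have gb : 0 < ga * b by rewrite mulr_gt0.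
by field; rewrite !gt_eqF//; lra.
Qed.

(** The convexity inequality bounds the integrand by a combination of the
    inverse dispersions at q and q - k, whose integral is [critical].  Near
    q = 0 the dispersion at q is small while the one at q - k is close to that
    of k, which is positive: there the defect is bounded below. *)
Lemma inv_symbol_integral0_lt (k : R3 R) : torus k -> k != 0 ->
  inv_symbol_integral (calE k ga) 0 < critical.
Proof.
have g0 := ga0; have p0 := pi_gt0 R; move=> Tk k0.
have [[hk1 hk2] hk3] := Tk.
have nk (t : R) : t \in `]- pi, pi] -> `|t| <= pi.
  by rewrite in_itv/= ler_norml => /andP[? ->]; rewrite andbT ltW.
pose f1 (q : R3 R) := (dispersion q)^-1.
have mf1 : measurable_fun setT (f1 : R3 MR -> R).
  by apply: measurable_funV; exact: measurable_dispersion.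
have cosper (x : R) : cos (x + 2 * pi) = cos x := cosD2pi1 x.
have [e2] : \int[mu]_(q in T) f1 (q - k) = \int[mu]_(q in T) f1 q /\
  (mu.-integrable T (EFin \o f1) -> mu.-integrable T (EFin \o (fun q => f1 (q - k)))).
  apply: torus_Rshift; rewrite ?nk//.
  - by move=> q; rewrite invr_ge0 dispersion_ge0.
  - by move=> x y z; rewrite /f1 /dispersion /= cosper.
  - by move=> x y z; rewrite /f1 /dispersion /= cosper.
  - by move=> x y z; rewrite /f1 /dispersion /= cosper.
move=> /(_ (@integrable_inv_dispersion R)) I2.
pose g (q : R3 R) := (1 + ga) ^- 2 * f1 q + (1 + ga) ^- 2 * ga * f1 (q - k).
have mT := @measurable_torus R.
have I1a := integrableZl mT ((1 + ga) ^- 2) (@integrable_inv_dispersion R).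
have I2a := integrableZl mT ((1 + ga) ^- 2 * ga) I2.
have Ig : mu.-integrable T (EFin \o g) := integrableD mT I1a I2a.
have eg : \int[mu]_(q in T) g q = critical.
  rewrite /g RintegralD// !RintegralZl//; last exact: integrable_inv_dispersion.
  by rewrite e2 /critical -/f1; field; lra.
have Ek q : calE k ga q = dispersion q + ga * dispersion (q - k).
  by rewrite /calE -(dispersionN (k - q)) opprB.
(* The indicator of the points where neither dispersion vanishes: the
   inequality fails where an inverse is 0 by convention. *)
pose ind (q : R3 R) := (dispersion q / dispersion q) *
   (dispersion (q - k) / dispersion (q - k)).
pose f (q : R3 R) := (calE k ga q - 0)^-1 * ind q.
have mdk : measurable_fun setT (fun q : R3 MR => dispersion (q - k)).
  rewrite (_ : (fun _ => _) = fun q => ga^-1 * (calE k ga q - dispersion q)).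
    apply: measurable_funM; first exact: measurable_cst.
    by apply: measurable_funB; [exact: measurable_calE|exact: measurable_dispersion].
  by apply/funext => q; rewrite Ek; field; rewrite gt_eqF.
have mind : measurable_fun T (ind : R3 MR -> R).
  apply: measurable_funTS; apply: measurable_funM.
    apply: measurable_funM; first exact: measurable_dispersion.
    by apply: measurable_funV; exact: measurable_dispersion.
  by apply: measurable_funM => //; exact: measurable_funV.
have m0 := band_bottom_gt0 ga0 Tk k0.
have mF := measurable_inv_symbol (measurable_calE k ga) 0.
have mf : measurable_fun T (f : R3 MR -> R) by exact: measurable_funM.
have If : mu.-integrable T (EFin \o f).
  apply: (@integrable_torus _ _ (band_bottom ga k - 0)^-1) => // q Tq.
  have /andP[h1 h2] := inv_symbol_bounds (fun q => calE_ge ga k q) q m0.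
  apply: le_trans h2; rewrite normrM (gtr0_norm h1) ler_piMr ?(ltW h1)//.
  rewrite /ind normrM; have [->|n1] := eqVneq (dispersion q) 0.
    by rewrite mul0r normr0 mul0r.
  have [->|n2] := eqVneq (dispersion (q - k)) 0.
    by rewrite mul0r normr0 mulr0.
  by rewrite !divff// normr1 mulr1.
have dk0 q : torus q -> q != k -> 0 < dispersion (q - k).
  move=> [[q1 q2] q3] qk; apply: dispersion_sub_gt0 => //.
have -> : inv_symbol_integral (calE k ga) 0 = \int[mu]_(q in T) f q.
  apply: (@Rintegral_off_points R 0 k) => // q Tq q0 qk.
  have n1 : dispersion q != 0 by rewrite gt_eqF// dispersion_gt0.
  have n2 : dispersion (q - k) != 0 by rewrite gt_eqF// dk0.
  by rewrite /f /ind !divff// !mulr1.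
rewrite -eg.
pose e := dispersion k; have e0 : 0 < e := dispersion_gt0 Tk k0.
have e6 : e <= 6 := dispersion_le6 k.
(* The dispersion is 3-Lipschitz for the sup norm, so at distance h = e / 12 of
   the origin it is at most e / 4, and at q - k it is at least 3 e / 4. *)
pose h := e / 12.
pose c := ga * (e / 4) ^+ 2 / ((1 + ga) ^+ 2 * (6 * 6 * (6 * (1 + ga)))).
have s0 : 0 < 1 + ga by rewrite addr_gt0.
have e4 : 0 < e / 4 by rewrite divr_gt0.
have c0 : 0 < c by apply: divr_gt0; rewrite !(mulr_gt0, exprn_gt0).
(* A box away from the origin, all of whose coordinates are nonzero. *)
pose B : set (R3 MR) := `]- h, - h / 2] `*` `]- h, - h / 2] `*` `]- h, - h / 2].
have he : h = e / 12 by [].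
have h0 : 0 < h by rewrite divr_gt0.
have hle : h <= 2^-1 by rewrite he; clear -e6; lra.
have pi2 := pi_ge2 R.
have hle2 : - h <= - h / 2 by clear -h0; lra.
have hd : 0 < - h / 2 - - h by clear -h0; lra.
have B0 : 0 < fine (mu B) by rewrite leb3_box //= !mulr_gt0.
have hI (t : R) : t \in `]- h, - h / 2] -> (t \in `]- pi, pi]) && (`|t - 0| <= h) && (t < 0).
  by rewrite !in_itv/= subr0 ler_norml; clear -h0 hle pi2; lra.
have mB : measurable B by apply: measurableX => //; exact: measurableX.
have BT : B `<=` T.
  by move=> [[x y] z] [[/hI/andP[/andP[? _] _] /hI/andP[/andP[? _] _]]
    /hI/andP[/andP[? _] _]]; split; [split|].
have fg q : torus q -> f q <= g q.
  move=> Tq; rewrite /f /g subr0 Ek /ind.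
  have g1 : 0 <= g q.
    have s2 : 0 <= (1 + ga) ^- 2 by rewrite invr_ge0 exprn_ge0// ltW.
    by rewrite /g addr_ge0// !mulr_ge0// ?invr_ge0 ?dispersion_ge0// ltW.
  have [d0|n1] := eqVneq (dispersion q) 0; first by rewrite {2}d0 !mul0r mulr0.
  have [d0|n2] := eqVneq (dispersion (q - k)) 0.
    by rewrite {2}d0 !mul0r !mulr0.
  have d1 : 0 < dispersion q by rewrite lt_neqAle eq_sym n1 dispersion_ge0.
  have d2 : 0 < dispersion (q - k) by rewrite lt_neqAle eq_sym n2 dispersion_ge0.
  rewrite !divff// !mulr1 -subr_ge0 /f1 -mulrA -mulrDr harmonic_mean//.
  move: (dispersion q) (dispersion (q - k)) d1 d2 => u w d1 d2.
  apply: divr_ge0; first by rewrite mulr_ge0 ?sqr_ge0// ltW.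
  by apply: ltW; rewrite !(mulr_gt0, addr_gt0, exprn_gt0).
have := Rintegral_gain If Ig mB BT fg (c := c).
move=> H; apply: lt_le_trans (H _); first by rewrite ltrDl mulr_gt0.
move=> q Bq; have Tq := BT q Bq.
have nrm (t : R) : t \in `]- h, - h / 2] -> `|t - 0| <= h.
  by move=> /hI/andP[/andP[]].
have [[q1 q2] q3] := Bq.
have := @dispersion_lip R q 0 h (nrm _ q1) (nrm _ q2) (nrm _ q3).
have -> : dispersion (0 : R3 R) = 0 by rewrite /dispersion /= cos0 subrr !addr0.
rewrite subr0 ger0_norm ?dispersion_ge0// => E1.
have E2 : `|dispersion (q - k) - dispersion (- k)| <= 3 * h.
  by apply: dispersion_lip => /=; rewrite opprK subrK -[X in `|X|]subr0 nrm.
rewrite dispersionN -/e ler_norml in E2.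
have d1 : 0 < dispersion q.
  apply: dispersion_gt0 => //; apply/negP => /eqP q00.
  by move: q1; rewrite q00 => /hI/andP[_]; rewrite ltxx.
have d2 : 0 < dispersion (q - k).
  by move: E2 e0; clear; rewrite /h => /andP[E2 _] e0; lra.
rewrite -lerBrDl /f /ind !divff ?gt_eqF// !mulr1 subr0 Ek /g /f1 -mulrA -mulrDr.
rewrite harmonic_mean// /c ler_pM//.
- by rewrite mulr_ge0 ?sqr_ge0// ltW.
- by rewrite invr_ge0 !(mulr_ge0, exprn_ge0)// ltW.
- rewrite ler_pM2l// -[leRHS]sqrrN opprB; apply: lerXn2r; rewrite ?nnegrE.
  + exact: ltW.
  + by move: E1 E2 e0; clear; rewrite /h => E1 /andP[E2 _] e0; lra.
  + by move: E1 E2 e0; clear; rewrite /h => E1 /andP[E2 _] e0; lra.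
have u1 := dispersion_le6 q; have u2 := dispersion_le6 (q - k).
have u3 : 0 < dispersion q + ga * dispersion (q - k) by rewrite addr_gt0// mulr_gt0.
have u4 : dispersion q + ga * dispersion (q - k) <= 6 * (1 + ga).
  by clear -u1 u2 g0; nra.
move: (dispersion q) (dispersion (q - k)) d1 d2 u1 u2 u3 u4 => u w d1 d2 u1 u2 u3 u4.
rewrite lef_pV2 ?posrE; last 2 first.
- by rewrite !(mulr_gt0, exprn_gt0).
- by rewrite !(mulr_gt0, exprn_gt0).
rewrite ler_pM2l ?exprn_gt0//; apply: ler_pM => //.
- by rewrite mulr_ge0// ltW.
- exact: ltW.
- by apply: ler_pM => //; exact: ltW.
Qed.

End Threshold.

(** * Near the bottom of the band the resolvent integral is supercritical *)

Section BandEdge.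
Variables (R : realType) (ga : R).
Hypothesis ga0 : 0 < ga.
Local Notation mu := (leb3 R).
Local Notation MR := (measurableTypeR R).
Local Notation T := (@torus R : set (R3 MR)).
Local Notation watson := (\int[mu]_(q in T) (dispersion q)^-1).

(** Dominated convergence as the regularisation de tends to 0; later, de is the
    distance from the energy to the edge of the band. *)
Lemma watson_reg_lim (eta d : R) : 0 < eta -> 0 < d -> exists de,
  [/\ 0 < de, de < d & critical ga - eta <=
    \int[mu]_(q in T) (de + (1 + ga) * dispersion q)^-1].
Proof.
move=> eta0 d0; have g0 : 0 < 1 + ga by rewrite addr_gt0.
pose x (q : R3 R) := (1 + ga) * dispersion q.
have x0 q : 0 <= x q by rewrite mulr_ge0 ?dispersion_ge0// ltW.
have mx : measurable_fun T (x : R3 MR -> R).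
  apply: measurable_funTS; apply: measurable_funM; first exact: measurable_cst.
  exact: measurable_dispersion.
have mT := @measurable_torus R.
pose de n : R := n.+1%:R^-1.
have de0 n : 0 < de n by rewrite invr_gt0.
(* The factor x / x removes the zeros of x, where the limit would be infinite
   while the inverse of x is 0 by convention. *)
pose f n (q : R3 R) := (de n + x q)^-1 * (x q / x q).
have mde n : measurable_fun T (fun q : R3 MR => (de n + x q)^-1).
  by apply: measurable_funV; apply: measurable_funD => //; exact: measurable_cst.
have mf n : measurable_fun T (f n : R3 MR -> R).
  apply: measurable_funM => //; apply: measurable_funM => //; exact: measurable_funV.
have Ix : mu.-integrable T (EFin \o (fun q => (x q)^-1)).
  have := integrableZl mT (1 + ga)^-1 (@integrable_inv_dispersion R).
  by congr integrable; apply/funext => q /=; rewrite /x invfM EFinM.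
have f1 n q : f n q <= (de n + x q)^-1.
  rewrite /f; have [->|n0] := eqVneq (x q) 0.
    by rewrite mul0r mulr0 invr_ge0 addr0 ltW.
  by rewrite divff// mulr1.
have f0 n q : 0 <= f n q.
  have xx : 0 <= x q / x q by rewrite divr_ge0.
  by apply: mulr_ge0 => //; rewrite invr_ge0 addr_ge0// ltW.
have f2 n q : f n q <= (x q)^-1.
  rewrite /f; have [->|n0] := eqVneq (x q) 0; first by rewrite mul0r mulr0 invr0.
  have xp : 0 < x q by rewrite lt_neqAle eq_sym n0 x0.
  rewrite divff// mulr1 lef_pV2 ?posrE//; first by rewrite lerDr ltW.
  by rewrite addr_gt0.
have cvf q : f ^~ q @ \oo --> (x q)^-1.
  rewrite /f; have [->|n0] := eqVneq (x q) 0.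
    by under eq_fun do rewrite mul0r mulr0; rewrite invr0; exact: cvg_cst.
  under eq_fun do rewrite divff// mulr1.
  apply: cvgV => //; rewrite -[X in _ --> X]add0r; apply: cvgD; last exact: cvg_cst.
  exact: cvg_harmonic.
have [|||||if_ _ cv] := @dominated_convergence _ _ R mu T mT
   (fun n q => (f n q)%:E) (fun q => (x q)^-1%:E) (fun q => (x q)^-1%:E).
- by move=> n; exact/measurable_EFinP.
- by apply/measurable_EFinP; exact: measurable_funV.
- by apply: aeW => q _; apply: cvg_EFin; [exact: nearW|exact: cvf].
- exact: Ix.
- by apply: aeW => q n _; rewrite lee_fin ger0_norm.
have fin : (\int[mu]_(q in T) ((x q)^-1)%:E \is a fin_num)%E.
  exact: integrable_fin_num.
rewrite -(fineK fin) in cv; have /fine_cvgP[_] := cv.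
rewrite -/(Rintegral _ _ _) (_ : Rintegral _ _ _ = critical ga); last first.
  rewrite /critical mulrC -RintegralZl//; last exact: integrable_inv_dispersion.
  by apply: eq_Rintegral => q _; rewrite /x invfM.
move=> /cvgr_dist_le/(_ _ eta0) H1.
have H2 : \forall n \near \oo, `|0 - de n| < d by apply: cvgr_dist_lt => //; exact: cvg_harmonic.
near \oo => n.
have h1 : `|critical ga - (fine \o (fun n => \int[mu]_(q in T) (f n q)%:E)%E) n| <= eta.
  by near: n; exact: H1.
have h2 : `|0 - de n| < d by near: n; exact: H2.
exists (de n); split => //; first by rewrite sub0r normrN gtr0_norm in h2.
apply: (@le_trans _ _ (\int[mu]_(q in T) f n q)).
  move: h1; rewrite /= -/(Rintegral _ _ _) ler_norml => /andP[_]; lra.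
have bnd q : `|(de n + x q)^-1| <= (de n)^-1.
  rewrite ger0_norm ?invr_ge0 ?addr_ge0 ?(ltW (de0 n))//.
  by rewrite lef_pV2 ?posrE ?lerDl ?ltr_pwDl.
apply: le_Rintegral => //.
- apply: (@integrable_torus _ _ (de n)^-1) => // q _.
  by apply: le_trans (bnd q); rewrite !ger0_norm ?invr_ge0 ?addr_ge0// ltW.
- exact: (integrable_torus (mde n) (fun q _ => bnd q)).
Unshelve. all: end_near. Qed.

(** The symbol above its minimum, after translation of the minimiser to the
    origin. *)
Definition band_profile (k q : R3 R) : R := amplitude ga k.1.1 * (1 - cos q.1.1) +
  amplitude ga k.1.2 * (1 - cos q.1.2) + amplitude ga k.2 * (1 - cos q.2).

Lemma band_profile_ge0 k q : 0 <= band_profile k q.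
Proof. by rewrite !addr_ge0// mulr_ge0 ?sqrtr_ge0// subr_ge0 cos_le1. Qed.

Lemma measurable_band_profile k : measurable_fun setT (band_profile k : R3 MR -> R).
Proof.
have cc (a : R) : continuous (fun t : R => a * (1 - cos t)).
  move=> t; apply: cvgM; first exact: cvg_cst.
  by apply: cvgB; [exact: cvg_cst|exact: continuous_cos].
exact: (measurable_sum3 (cc _) (cc _) (cc _)).
Qed.

(** In this form the resolvent integral depends on k only through the cosines of
    its coordinates. *)
Lemma inv_symbol_integral_profile k l : l < band_bottom ga k ->
  inv_symbol_integral (calE k ga) l =
  \int[mu]_(q in T) (band_bottom ga k - l + band_profile k q)^-1.
Proof.
move=> lm; have [phi Tphi Ephi] := calE_shift ga k.
pose H (q : R3 R) := (band_bottom ga k - l + band_profile k q)^-1.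
have mH : measurable_fun setT (H : R3 MR -> R).
  apply: measurable_funV; apply: measurable_funD; first exact: measurable_cst.
  exact: measurable_band_profile.
have nk (t : R) : t \in `]- pi, pi] -> `|t| <= pi.
  by rewrite in_itv/= ler_norml => /andP[? ->]; rewrite andbT ltW.
have [[p1 p2] p3] := Tphi.
have [eH _] : \int[mu]_(q in T) H (q - phi) = \int[mu]_(q in T) H q /\
  (mu.-integrable T (EFin \o H) -> mu.-integrable T (EFin \o (fun q => H (q - phi)))).
  apply: torus_Rshift; rewrite ?nk//.
  - by move=> q; rewrite invr_ge0 addr_ge0 ?band_profile_ge0// subr_ge0 ltW.
  - by move=> x y z; rewrite /H /band_profile /= cosD2pi1.
  - by move=> x y z; rewrite /H /band_profile /= cosD2pi1.
  - by move=> x y z; rewrite /H /band_profile /= cosD2pi1.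
rewrite -eH; apply: eq_Rintegral => q _; rewrite Ephi /H /band_profile.
by congr (_^-1); rewrite /=; ring.
Qed.

(** The profile is at most (1 + ga) * dispersion, which is the profile at k = 0,
    so by [watson_reg_lim] the integral is almost critical when l is close to
    m.  On the corner box the two profiles differ by at least m, because
    m is the sum of the 1 + ga - a_i; the resulting gain does not depend on how
    close l is to m and exceeds the loss. *)
Lemma inv_symbol_integral_gt (k : R3 R) : torus k -> k != 0 -> exists l,
  [/\ 0 < l, l < band_bottom ga k & critical ga < inv_symbol_integral (calE k ga) l].
Proof.
move=> Tk k0; have g0 : 0 < 1 + ga by rewrite addr_gt0.
have m0 := band_bottom_gt0 ga0 Tk k0; set m := band_bottom ga k in m0 *.
(* Both denominators are at most de + 6 (1 + ga) with de < 1. *)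
pose c := m / (1 + 6 * (1 + ga)) ^+ 2.
have s0 : 0 < 1 + 6 * (1 + ga) by rewrite addr_gt0// mulr_gt0.
have c0 : 0 < c by rewrite divr_gt0// exprn_gt0.
have b0 := corner_gt0 R.
have eta0 : 0 < c * fine (mu (@corner R)) / 2 by rewrite divr_gt0// mulr_gt0.
have d0 : 0 < Num.min m 1 by rewrite lt_min m0 ltr01.
have [de [de0 + Hde]] := watson_reg_lim eta0 d0; rewrite lt_min => /andP[dem de1].
exists (m - de); split; [by rewrite subr_gt0|by rewrite gtrBl|].
apply: (@lt_le_trans _ _ (\int[mu]_(q in T) (de + (1 + ga) * dispersion q)^-1
  + c * fine (mu (@corner R)))).
  by move: Hde eta0; clear; lra.
have dem' : m - de < m by rewrite gtrBl.
rewrite (inv_symbol_integral_profile dem') -/m opprB addrCA subrr addr0 /band_profile.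
set a1 := amplitude ga k.1.1; set a2 := amplitude ga k.1.2.
set a3 := amplitude ga k.2.
have a10 : 0 <= a1 := sqrtr_ge0 _.
have a20 : 0 <= a2 := sqrtr_ge0 _.
have a30 : 0 <= a3 := sqrtr_ge0 _.
have a1s : a1 <= 1 + ga := amplitude_le ga0 _.
have a2s : a2 <= 1 + ga := amplitude_le ga0 _.
have a3s : a3 <= 1 + ga := amplitude_le ga0 _.
pose S (q : R3 R) := a1 * (1 - cos q.1.1) + a2 * (1 - cos q.1.2) + a3 * (1 - cos q.2).
pose H (q : R3 R) := (de + S q)^-1; rewrite -[leRHS]/(\int[mu]_(q in T) H q).
have S0 q : 0 <= S q by rewrite !addr_ge0// mulr_ge0// subr_ge0 cos_le1.
have SD q : S q <= (1 + ga) * dispersion q.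
  have -> : (1 + ga) * dispersion q = (1 + ga) * (1 - cos q.1.1) +
    (1 + ga) * (1 - cos q.1.2) + (1 + ga) * (1 - cos q.2).
    by rewrite /dispersion; ring.
  by apply: lerD; [apply: lerD|]; apply: ler_wpM2r; rewrite ?subr_ge0 ?cos_le1.
have mH : measurable_fun setT (H : R3 MR -> R).
  apply: measurable_funV; apply: measurable_funD; first exact: measurable_cst.
  exact: (measurable_band_profile k).
have d6 (q : R3 R) : (1 + ga) * dispersion q <= 6 * (1 + ga).
  by rewrite mulrC ler_wpM2r ?dispersion_le6// ltW.
have d00 (q : R3 R) : 0 <= (1 + ga) * dispersion q.
  by rewrite mulr_ge0 ?dispersion_ge0// ltW.
have mD : measurable_fun T (fun q : R3 MR => (de + (1 + ga) * dispersion q)^-1).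
  apply: measurable_funTS; apply: measurable_funV.
  apply: measurable_funD; first exact: measurable_cst.
  by apply: measurable_funM; [exact: measurable_cst|exact: measurable_dispersion].
apply: (Rintegral_gain _ _ (@measurable_corner R) (@corner_torus R)).
- apply: (@integrable_torus _ _ de^-1) => // q _.
  have := d00 q => h; rewrite ger0_norm ?invr_ge0 ?addr_ge0 ?(ltW de0)//.
  by rewrite lef_pV2 ?posrE// ?lerDl// ltr_pwDl.
- apply: (@integrable_torus _ _ de^-1) => [|q _]; first exact: measurable_funTS.
  have h := S0 q; rewrite ger0_norm; last by rewrite invr_ge0 (addr_ge0 (ltW de0)).
  by rewrite lef_pV2 ?posrE ?lerDl ?ltr_pwDl.
- move=> q _; have h1 := S0 q; have h2 := SD q; rewrite -/(S q).
  by rewrite lef_pV2 ?posrE ?lerD2l// ltr_pwDl// (le_trans h1 h2).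
- move=> q /corner_cos[h1 h2 h3].
  have num : m <= (1 + ga) * dispersion q - S q.
    rewrite /m /band_bottom -/a1 -/a2 -/a3 /dispersion /S.
    by move: a1s a2s a3s h1 h2 h3; clear; nra.
  have Sq := S0 q; have Dq := d00 q; have D6 := d6 q; have SDq := SD q.
  rewrite /H; move: (S q) ((1 + ga) * dispersion q) num Sq Dq D6 SDq => s u num s1 u0 u6 su.
  have p0 : 0 < de + s by rewrite ltr_pwDl.
  have p1' : 0 < de + u by rewrite ltr_pwDl.
  rewrite -lerBrDl.
  have -> : (de + s)^-1 - (de + u)^-1 = (u - s) / ((de + s) * (de + u)).
    by field; rewrite !gt_eqF.
  rewrite /c ler_pM ?(ltW m0) ?invr_ge0 ?exprn_ge0 ?(ltW s0)//.
  rewrite lef_pV2 ?posrE ?mulr_gt0 ?exprn_gt0// expr2.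
  by rewrite ler_pM ?(ltW p0) ?(ltW p1')//; lra.
Qed.

End BandEdge.

(** * Rank-one perturbations acting on real functions *)

Section RealPerturbation.
Variable R : realType.
Local Notation mu := (leb3 R).
Local Notation MR := (measurableTypeR R).
Local Notation T := (@torus R : set (R3 MR)).
Local Notation vol := ((2 * pi) ^+ 3 : R).
Implicit Types (u w : R3 MR -> R).

Definition sqr_integrable u : Prop :=
  measurable_fun T u /\ mu.-integrable T (EFin \o (fun q => u q ^+ 2)).

Lemma sqr_integrable_dom u w (a b : R) : sqr_integrable w -> measurable_fun T u ->
  (forall q, torus q -> u q ^+ 2 <= a * w q ^+ 2 + b) -> sqr_integrable u.
Proof.
move=> [mw iw] mu_ h; split => //; have mT := @measurable_torus R.
have Ib : mu.-integrable T (EFin \o (fun=> b)).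
  by apply: (@integrable_torus _ _ `|b|) => // q _; exact: lexx.
apply: (le_integrable mT _ _ (integrableD mT (integrableZl mT a iw) Ib)).
  by apply/measurable_EFinP; exact: measurable_funX.
move=> q Tq; rewrite /= lee_fin ger0_norm ?sqr_ge0//.
by apply: le_trans (h q Tq) _; rewrite ler_norm.
Qed.

Lemma sqr_integrable_bounded u C : measurable_fun T u ->
  (forall q, torus q -> `|u q| <= C) -> sqr_integrable u.
Proof.
move=> mu_ uC; split => //; apply: (@integrable_torus _ _ (C ^+ 2)).
  exact: measurable_funX.
move=> q Tq; rewrite normrX lerXn2r ?nnegrE ?uC//.
exact: le_trans (uC q Tq).
Qed.

Lemma sqr_integrableD u w : sqr_integrable u -> sqr_integrable w ->
  sqr_integrable (fun q => u q + w q).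
Proof.
move=> [mu_ iu] [mw iw]; split; first exact: measurable_funD.
have mT := @measurable_torus R.
apply: (le_integrable mT _ _ (integrableD mT (integrableZl mT 2 iu) (integrableZl mT 2 iw))).
  by apply/measurable_EFinP; apply: measurable_funX; exact: measurable_funD.
move=> q Tq; rewrite /= lee_fin ger0_norm ?sqr_ge0//.
apply: le_trans (ler_norm _); have := sqr_ge0 (u q - w q); nra.
Qed.

Lemma sqr_integrableM u w C : measurable_fun T u ->
  (forall q, torus q -> `|u q| <= C) -> sqr_integrable w ->
  sqr_integrable (fun q => u q * w q).
Proof.
move=> mu_ uC hw; have [mw _] := hw.
apply: (@sqr_integrable_dom _ w (C ^+ 2) 0) => //; first exact: measurable_funM.
move=> q Tq; rewrite addr0 exprMn ler_wpM2r ?sqr_ge0//.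
rewrite -[leLHS]real_normK ?num_real// lerXn2r ?nnegrE ?uC//.
exact: le_trans (uC q Tq).
Qed.

Lemma sqr_integrable_cst c : sqr_integrable (fun=> c).
Proof. by apply: (@sqr_integrable_bounded _ `|c|) => // q _; exact: lexx. Qed.

Lemma integrable_of_sqr u : sqr_integrable u -> mu.-integrable T (EFin \o u).
Proof.
move=> [mu_ iu]; have mT := @measurable_torus R.
have I1 : mu.-integrable T (EFin \o (fun=> 1 : R)).
  by apply: (@integrable_torus _ _ 1) => // q _; rewrite normr1.
apply: (le_integrable mT _ _ (integrableD mT I1 iu)); first exact/measurable_EFinP.
move=> q Tq; rewrite /= lee_fin; apply: le_trans (ler_norm _).
have := sqr_ge0 (`|u q| - 1); have := real_normK (num_real (u q)).
have := normr_ge0 (u q); nra.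
Qed.

Lemma Rintegral_torus_cst (c : R) : \int[mu]_(q in T) c = c * vol.
Proof. by rewrite Rintegral_cst ?fine_torus//; exact: measurable_torus. Qed.

Lemma integral_sqr_ge0 u : 0 <= \int[mu]_(q in T) (u q ^+ 2).
Proof. by apply: Rintegral_ge0 => q _; exact: sqr_ge0. Qed.

(** The Cauchy-Schwarz inequality against constants, as nonnegativity of the
    variance. *)
Lemma sqr_integral_le u : sqr_integrable u ->
  (\int[mu]_(q in T) u q) ^+ 2 <= vol * \int[mu]_(q in T) (u q ^+ 2).
Proof.
move=> hu; have [mu_ iu] := hu; have I := integrable_of_sqr hu.
have mT := @measurable_torus R; have v0 := vol_gt0 R.
set J := \int[mu]_(q in T) u q; set N := \int[mu]_(q in T) (u q ^+ 2).
pose a := J / vol.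
have : 0 <= \int[mu]_(q in T) (u q ^+ 2 + (- (2 * a)) * u q + a ^+ 2).
  apply: Rintegral_ge0 => q _; have := sqr_ge0 (u q - a); rewrite sqrrB; nra.
rewrite RintegralD//; last 2 first.
- exact: (integrableD mT iu (integrableZl mT (- (2 * a)) I)).
- by apply: (@integrable_torus _ _ `|a ^+ 2|) => // q _; exact: lexx.
rewrite RintegralD//; last exact: (integrableZl mT (- (2 * a)) I).
rewrite RintegralZl// Rintegral_torus_cst -/J -/N.
have -> : J = a * vol by rewrite /a divfK// gt_eqF.
by move=> h; rewrite expr2; clear -h v0; nra.
Qed.

Variables (E : R3 R -> R) (lo hi ka : R).
Hypotheses (mE : measurable_fun setT (E : R3 MR -> R)).
Hypotheses (loE : forall q, lo <= E q) (Ehi : forall q, E q <= hi).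
Hypothesis ka0 : 0 < ka.
Local Notation F := (inv_symbol_integral E).

(** The operator with symbol E minus a rank-one term, shifted by l.  All its
    coefficients are real, so it acts separately on the real and imaginary parts
    of a complex function. *)
Definition real_op (l : R) (u : R3 R -> R) (q : R3 R) : R :=
  (E q - l) * u q - ka^-1 * \int[mu]_(q in T) u q.

Lemma symbol_bounded l q : `|E q - l| <= `|lo| + `|hi| + `|l|.
Proof.
have h1 := loE q; have h2 := Ehi q.
have := ler_norm lo; have := ler_norm hi; have := ler_norm l.
have := ler_norm (- lo); have := ler_norm (- hi); have := ler_norm (- l).
rewrite !normrN ler_norml => *; apply/andP; split; lra.
Qed.

Lemma sqr_integrable_real_op l u : sqr_integrable u -> sqr_integrable (real_op l u).
Proof.
move=> hu; apply: (@sqr_integrableD (fun q => (E q - l) * u q)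
  (fun=> - (ka^-1 * \int[mu]_(q in T) u q))); last exact: sqr_integrable_cst.
apply: (@sqr_integrableM _ _ (`|lo| + `|hi| + `|l|)) => //.
  by apply: measurable_funTS; apply: measurable_funB => //; exact: measurable_cst.
by move=> q _; exact: symbol_bounded.
Qed.

Section Resolvent.
Variable l : R.
Hypotheses (llo : l < lo) (Fl : F l != ka).
Let r (q : R3 R) := (E q - l)^-1.

Let r_bnd q : torus q -> `|r q| <= (lo - l)^-1.
Proof.
by move=> _; have /andP[h1 h2] := inv_symbol_bounds loE q llo; rewrite gtr0_norm.
Qed.

Let mr : measurable_fun T (r : R3 MR -> R) := measurable_inv_symbol mE l.

Let rE q : r q * (E q - l) = 1.
Proof. by rewrite mulVf// gt_eqF// subr_gt0 (lt_le_trans llo). Qed.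

Lemma sqr_integrable_resolvent u : sqr_integrable u ->
  sqr_integrable (fun q => r q * u q).
Proof. exact: sqr_integrableM mr r_bnd. Qed.

(** Dividing the operator by E - l and integrating turns it into a scalar
    equation for the integral of u, solvable when F l differs from [ka]. *)
Lemma real_op_integral u : sqr_integrable u ->
  (ka - F l) * (ka^-1 * \int[mu]_(q in T) u q) =
  \int[mu]_(q in T) (r q * real_op l u q).
Proof.
move=> hu; have mT := @measurable_torus R.
set c := ka^-1 * _.
have Iw := integrable_of_sqr (sqr_integrable_resolvent (sqr_integrable_real_op l hu)).
have Ir := integrable_inv_symbol mE loE llo.
have : \int[mu]_(q in T) u q = \int[mu]_(q in T) (r q * real_op l u q + c * r q).
  apply: eq_Rintegral => q _; rewrite /real_op -/c mulrBr mulrA rE.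
  by ring.
rewrite RintegralD//; last exact: (integrableZl mT c Ir).
rewrite RintegralZl// -/(F l) => e.
have e2 : \int[mu]_(q in T) u q = ka * c.
  by rewrite /c mulrA divff ?mul1r// gt_eqF.
by rewrite mulrBl -e2 e; ring.
Qed.

(** With w the image of u and c the rank-one term, u = (w + c) / (E - l), and c is
    controlled by w through [real_op_integral] and Cauchy-Schwarz. *)
Lemma real_op_bounded_below : exists K, forall u, sqr_integrable u ->
  \int[mu]_(q in T) (u q ^+ 2) <= K * \int[mu]_(q in T) (real_op l u q ^+ 2).
Proof.
pose d := lo - l; have d0 : 0 < d by rewrite subr_gt0.
have v0 := vol_gt0 R.
pose D := (ka - F l) ^+ 2.
have D0 : 0 < D by rewrite exprn_even_gt0//= subr_eq0 eq_sym.
pose K1 := vol * d^-1 ^+ 2 / D.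
exists (2 * d^-1 ^+ 2 * (1 + vol * K1)) => u hu.
have mT := @measurable_torus R.
set c := ka^-1 * \int[mu]_(q in T) u q.
have hw := sqr_integrable_real_op l hu; have [_ iw] := hw.
set w := real_op l u in hw iw *; set N := \int[mu]_(q in T) (w q ^+ 2).
have r2 q (x : R) : torus q -> (r q * x) ^+ 2 <= d^-1 ^+ 2 * x ^+ 2.
  move=> Tq; rewrite exprMn ler_wpM2r ?sqr_ge0// -[leLHS]real_normK ?num_real//.
  by rewrite lerXn2r ?nnegrE ?invr_ge0 ?(ltW d0)//; exact: r_bnd.
have cN : c ^+ 2 <= K1 * N.
  have hrw := sqr_integrable_resolvent hw.
  have := sqr_integral_le hrw; rewrite -(real_op_integral hu) -/c exprMn -/D.
  have : \int[mu]_(q in T) ((r q * w q) ^+ 2) <= d^-1 ^+ 2 * N.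
    rewrite -RintegralZl//; apply: le_Rintegral => //.
    - by have [] := hrw.
    - exact: (integrableZl mT _ iw).
    - by move=> q Tq; exact: r2.
  move=> h1 h2; rewrite /K1 mulrAC ler_pdivlMr// -[vol * _ * N]mulrA [c ^+ 2 * D]mulrC.
  by apply: le_trans h2 _; rewrite ler_pM2l.
have Ic : mu.-integrable T (EFin \o (fun=> 2 * d^-1 ^+ 2 * c ^+ 2)).
  by apply: (@integrable_torus _ _ `|2 * d^-1 ^+ 2 * c ^+ 2|) => // q _; exact: lexx.
apply: (@le_trans _ _ (\int[mu]_(q in T) (2 * d^-1 ^+ 2 * (w q ^+ 2) + 2 * d^-1 ^+ 2 * c ^+ 2))).
  have [_ iu] := hu; apply: le_Rintegral => //.
    exact: (integrableD mT (integrableZl mT (2 * d^-1 ^+ 2) iw) Ic).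
  move=> q Tq; have -> : u q = r q * (w q + c).
    by rewrite /w /real_op -/c subrK mulrA rE mul1r.
  apply: le_trans (r2 q _ Tq) _.
  have := sqr_ge0 (w q - c); have : 0 <= d^-1 ^+ 2 by rewrite sqr_ge0.
  move: (d^-1 ^+ 2) (w q) => y x; nra.
rewrite RintegralD//; last exact: (integrableZl mT (2 * d^-1 ^+ 2) iw).
rewrite RintegralZl// Rintegral_torus_cst -/N.
rewrite (_ : _ + _ = 2 * d^-1 ^+ 2 * (N + vol * c ^+ 2)); last by ring.
have dd : 0 <= 2 * d^-1 ^+ 2 by apply: mulr_ge0 => //; exact: sqr_ge0.
rewrite -[leRHS]mulrA (ler_wpM2l dd)//.
rewrite [leRHS]mulrDl mul1r -[vol * K1 * N]mulrA lerD2l.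
by rewrite ler_wpM2l ?(ltW v0).
Qed.

Lemma real_op_surjective g : sqr_integrable g ->
  exists2 u, sqr_integrable u & forall q, real_op l u q = g q.
Proof.
move=> hg; have mT := @measurable_torus R.
have Ig := integrable_of_sqr (sqr_integrable_resolvent hg).
have Ir := integrable_inv_symbol mE loE llo.
pose c := (\int[mu]_(q in T) (r q * g q)) / (ka - F l).
have kF : ka - F l != 0 by rewrite subr_eq0 eq_sym.
exists (fun q => r q * (g q + c)).
  apply: sqr_integrable_resolvent; apply: sqr_integrableD => //.
  exact: sqr_integrable_cst.
have e : \int[mu]_(q in T) (r q * (g q + c)) = ka * c.
  under eq_Rintegral => q _ do rewrite mulrDr [r q * c]mulrC.
  rewrite RintegralD//; last exact: (integrableZl mT c Ir).
  rewrite RintegralZl// -/(F l).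
  have -> : \int[mu]_(q in T) (r q * g q) = c * (ka - F l) by rewrite divfK.
  by ring.
move=> q; rewrite /real_op e mulrA [(E q - l) * _]mulrC rE mul1r mulrA mulVf ?gt_eqF//.
by rewrite mul1r addrK.
Qed.

End Resolvent.

End RealPerturbation.

(** * The spectrum below the band *)

Section ComplexL2.
Variable R : realType.
Local Notation mu := (leb3 R).
Local Notation MR := (measurableTypeR R).
Local Notation T := (@torus R : set (R3 MR)).
Local Notation vol := ((2 * pi) ^+ 3 : R).
Local Notation Re := complex.Re.
Local Notation Im := complex.Im.
Local Notation normc := ComplexField.Normc.normc.
Implicit Types (f g : R3 R -> R[i]).

Lemma normc_sqr (z : R[i]) : normc z ^+ 2 = Re z ^+ 2 + Im z ^+ 2.
Proof. by case: z => a b; rewrite /= sqr_sqrtr// addr_ge0 ?sqr_ge0. Qed.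

Lemma complex_ext (z w : R[i]) : Re z = Re w -> Im z = Im w -> z = w.
Proof. by case: z w => [a b] [c d] /= -> ->. Qed.

Lemma ReB (z w : R[i]) : Re (z - w) = Re z - Re w.
Proof. by case: z w => [a b] [c d]. Qed.
Lemma ImB (z w : R[i]) : Im (z - w) = Im z - Im w.
Proof. by case: z w => [a b] [c d]. Qed.
Lemma ReMr (x : R) (z : R[i]) : Re (x%:C * z) = x * Re z.
Proof. by case: z => a b /=; rewrite mul0r subr0. Qed.
Lemma ImMr (x : R) (z : R[i]) : Im (x%:C * z) = x * Im z.
Proof. by case: z => a b /=; rewrite mul0r addr0. Qed.

Lemma L2P f : L2 f <-> sqr_integrable (fun q => Re (f q)) /\
  sqr_integrable (fun q => Im (f q)).
Proof.
have mT := @measurable_torus R.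
have sqrE u : measurable_fun T u ->
   measurable_fun T (fun q => ((u q : R) ^+ 2)%:E).
  by move=> mu_; apply/measurable_EFinP; exact: measurable_funX.
split.
  move=> [mr mi h].
  have mN : measurable_fun T (fun q => (normc (f q) ^+ 2)%:E).
    apply/measurable_EFinP; under eq_fun do rewrite normc_sqr.
    by apply: measurable_funD; exact: measurable_funX.
  have iN : mu.-integrable T (EFin \o (fun q => normc (f q) ^+ 2)).
    apply/integrableP; split => //.
    by under eq_integral => q _ do rewrite /= ger0_norm ?sqr_ge0//.
  split; split => //; apply: (le_integrable mT _ _ iN); try exact: sqrE.
  - move=> q _; rewrite /= lee_fin ger0_norm ?sqr_ge0// ger0_norm ?sqr_ge0//.
    by rewrite normc_sqr lerDl sqr_ge0.
  - move=> q _; rewrite /= lee_fin ger0_norm ?sqr_ge0// ger0_norm ?sqr_ge0//.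
    by rewrite normc_sqr lerDr sqr_ge0.
move=> [[mr ir] [mi ii]]; split => //.
have /integrableP[_] := integrableD mT ir ii.
congr (_ < _)%E; apply: eq_integral => q _.
by rewrite /= normc_sqr ger0_norm// addr_ge0 ?sqr_ge0.
Qed.

Lemma L2normE f : L2 f -> L2norm f =
  Num.sqrt (\int[mu]_(q in T) (Re (f q) ^+ 2) + \int[mu]_(q in T) (Im (f q) ^+ 2)).
Proof.
move=> /L2P[[_ ir] [_ ii]]; congr Num.sqrt; have mT := @measurable_torus R.
rewrite -RintegralD//; apply: eq_Rintegral => q _; exact: normc_sqr.
Qed.

Lemma L2_real (u : R3 R -> R) : sqr_integrable u -> L2 (fun q => (u q)%:C).
Proof. by move=> hu; apply/L2P; split => //; exact: sqr_integrable_cst. Qed.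

Lemma L2norm_real (u : R3 R -> R) : sqr_integrable u ->
  L2norm (fun q => (u q)%:C) = Num.sqrt (\int[mu]_(q in T) (u q ^+ 2)).
Proof.
move=> hu; rewrite L2normE; last exact: L2_real.
by congr Num.sqrt; rewrite /= expr0n Rintegral_torus_cst mul0r addr0.
Qed.

Lemma sqr_integral0 (u : R3 MR -> R) : sqr_integrable u ->
  \int[mu]_(q in T) (u q ^+ 2) <= 0 -> ae_eq mu T u (cst 0).
Proof.
move=> [mu_ iu] u0; have mT := @measurable_torus R.
have e0 : \int[mu]_(q in T) (u q ^+ 2) = 0.
  by apply/eqP; rewrite eq_le u0 integral_sqr_ge0.
have eE : (\int[mu]_(q in T) `|(u q ^+ 2)%:E| = 0)%E.
  under eq_integral => q _ do rewrite /= ger0_norm ?sqr_ge0//.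
  by rewrite -[LHS]fineK; [congr EFin; exact: e0|exact: integrable_fin_num].
have [h _] := ae_eq_integral_abs mu mT (measurable_int _ iu).
have := h eE; apply: filterS => q + Tq => /(_ Tq) [] /eqP.
by rewrite sqrf_eq0 => /eqP.
Qed.

Lemma sqr_integral_ae0 (u : R3 MR -> R) : measurable_fun T u ->
  ae_eq mu T u (cst 0) -> \int[mu]_(q in T) (u q ^+ 2) = 0.
Proof.
move=> mu_ u0; have mT := @measurable_torus R.
rewrite /Rintegral (_ : integral _ _ _ = 0%E)//.
rewrite -[RHS](integral0 mu T); apply: ae_eq_integral => //.
  by apply/measurable_EFinP; exact: measurable_funX.
by move: u0; apply: filterS => q /= + Tq => /(_ Tq) ->; rewrite expr0n.
Qed.

Lemma eq_aeP f g : eq_ae f g <->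
  ae_eq mu T (fun q => Re (f q)) (fun q => Re (g q)) /\
  ae_eq mu T (fun q => Im (f q)) (fun q => Im (g q)).
Proof.
split=> [h|[]].
  by split; move: h; apply: filterS => q /= + Tq => /(_ Tq) ->.
by apply: filterS2 => q /= h1 h2 Tq; apply: complex_ext; [exact: h1|exact: h2].
Qed.

End ComplexL2.

Section BelowBand.
Variables (R : realType) (ga : R).
Hypothesis ga0 : 0 < ga.
Variable k : R3 R.
Local Notation mu := (leb3 R).
Local Notation MR := (measurableTypeR R).
Local Notation T := (@torus R : set (R3 MR)).
Local Notation vol := ((2 * pi) ^+ 3 : R).
Local Notation Re := complex.Re.
Local Notation Im := complex.Im.
Local Notation E := (calE k ga).
Local Notation F := (inv_symbol_integral E).
Local Notation A := (hop ga k).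
Local Notation m := (band_bottom ga k).
Local Notation kap := (critical ga).

Lemma coupling_vop f q : (coupling ga)%:C * vop f q =
  (kap^-1)%:C * cintegral f :> R[i].
Proof.
rewrite /vop mulrA -rmorphM; congr (_%:C * _).
rewrite (coupling_critical ga0) mulrAC divff ?mul1r//.
by rewrite gt_eqF ?vol_gt0.
Qed.

Lemma Re_op_shift l f q :
  Re (op_shift A l f q) = real_op E kap l (fun q => Re (f q)) q.
Proof.
rewrite /op_shift /hop /h0 coupling_vop !ReB !ReMr /real_op /=; ring.
Qed.

Lemma Im_op_shift l f q :
  Im (op_shift A l f q) = real_op E kap l (fun q => Im (f q)) q.
Proof.
rewrite /op_shift /hop /h0 coupling_vop !ImB !ImMr /real_op /=; ring.
Qed.

Let mE := measurable_calE k ga.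
Let loE := calE_ge ga k.
Let Ehi := calE_le ga0 k.
Let kap0 := critical_gt0 ga0.

Lemma L2_op_shift l f : L2 f -> L2 (op_shift A l f).
Proof.
move=> /L2P[hr hi]; apply/L2P; split.
- under eq_fun do rewrite Re_op_shift; exact: (sqr_integrable_real_op _ mE loE Ehi).
- under eq_fun do rewrite Im_op_shift; exact: (sqr_integrable_real_op _ mE loE Ehi).
Qed.

Lemma resolvent_below l : l < m -> F l != kap -> resolvent_set A l.
Proof.
move=> lm Fl; split.
  have [K HK] := real_op_bounded_below mE loE Ehi kap0 lm Fl.
  exists (Num.sqrt `|K|) => f Lf; have Lg := L2_op_shift l Lf.
  rewrite !L2normE// -sqrtrM//; apply: ler_wsqrtr.
  move: Lf => /L2P[hr hi].
  have er : \int[mu]_(q in T) (Re (op_shift A l f q) ^+ 2) =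
      \int[mu]_(q in T) (real_op E kap l (fun q => Re (f q)) q ^+ 2).
    by apply: eq_Rintegral => q _; rewrite Re_op_shift.
  have ei : \int[mu]_(q in T) (Im (op_shift A l f q) ^+ 2) =
      \int[mu]_(q in T) (real_op E kap l (fun q => Im (f q)) q ^+ 2).
    by apply: eq_Rintegral => q _; rewrite Im_op_shift.
  rewrite er ei.
  rewrite mulrDr; apply: lerD.
    by apply: le_trans (HK _ hr) _; rewrite ler_wpM2r ?integral_sqr_ge0 ?ler_norm.
  by apply: le_trans (HK _ hi) _; rewrite ler_wpM2r ?integral_sqr_ge0 ?ler_norm.
move=> g /L2P[hr hi].
have [u hu eu] := real_op_surjective mE loE kap0 lm Fl hr.
have [w hw ew] := real_op_surjective mE loE kap0 lm Fl hi.
exists (fun q => (u q +i* w q)%C); first by apply/L2P.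
apply/eq_aeP; split; apply: aeW => q _.
- by rewrite Re_op_shift; exact: eu.
- by rewrite Im_op_shift; exact: ew.
Qed.

Lemma eigen_op_shift l f : eq_ae (A f) (fun q => l%:C * f q) ->
  ae_eq mu T (real_op E kap l (fun q => Re (f q))) (cst 0) /\
  ae_eq mu T (real_op E kap l (fun q => Im (f q))) (cst 0).
Proof.
move=> h; split; move: h; apply: filterS => q /= + Tq => /(_ Tq) h.
- by rewrite -Re_op_shift /op_shift h subrr.
- by rewrite -Im_op_shift /op_shift h subrr.
Qed.

(** If F l is not critical, the lower bound on [real_op] forces an eigenfunction to
    vanish. *)
Lemma eigenvalue_critical l : l < m -> is_eigenvalue A l -> F l = kap.
Proof.
move=> lm [f [Lf f0 /eigen_op_shift[hr hi]]].
apply: contra_notP f0 => /eqP Fl.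
have [K HK] := real_op_bounded_below mE loE Ehi kap0 lm Fl.
have z (u : R3 MR -> R) : sqr_integrable u -> ae_eq mu T (real_op E kap l u) (cst 0) ->
    ae_eq mu T u (cst 0).
  move=> hu u0; apply: sqr_integral0 => //; apply: le_trans (HK _ hu) _.
  have [mw _] := sqr_integrable_real_op kap mE loE Ehi l hu.
  by rewrite sqr_integral_ae0// mulr0.
have /L2P[ur ui] := Lf.
by apply/eq_aeP; split; apply: z.
Qed.

(** The eigenvalue equation reads (E - l) f = c with c a constant. *)
Lemma eigenfunction_form l f : l < m -> eigenfunction A l f ->
  exists c : R[i], eq_ae f (fun q => c * ((E q - l)^-1)%:C).
Proof.
move=> lm [Lf f0 /eigen_op_shift[hr hi]].
pose cr := kap^-1 * \int[mu]_(q in T) Re (f q).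
pose ci := kap^-1 * \int[mu]_(q in T) Im (f q).
have El q : E q - l != 0 by rewrite gt_eqF// subr_gt0 (lt_le_trans lm).
exists (cr +i* ci)%C; apply/eq_aeP; split.
- move: hr; apply: filterS => q + Tq => /(_ Tq) /=.
  rewrite /real_op -/cr => /subr0_eq h; rewrite mulr0 subr0.
  by rewrite -h mulrAC divff// mul1r.
- move: hi; apply: filterS => q + Tq => /(_ Tq) /=.
  rewrite /real_op -/ci => /subr0_eq h; rewrite mulr0 add0r.
  by rewrite -h mulrAC divff// mul1r.
Qed.

Lemma sqr_integrable_inv l : l < m -> sqr_integrable (fun q : R3 MR => (E q - l)^-1).
Proof.
move=> lm; apply: (@sqr_integrable_bounded _ _ (m - l)^-1).
  exact: measurable_inv_symbol.
by move=> q _; have /andP[h1 h2] := inv_symbol_bounds loE q lm; rewrite gtr0_norm.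
Qed.

Lemma eigenfunction_inv l : l < m -> F l = kap ->
  eigenfunction A l (fun q => ((E q - l)^-1)%:C).
Proof.
move=> lm Fl; have hs := sqr_integrable_inv lm.
have El q : E q - l != 0 by rewrite gt_eqF// subr_gt0 (lt_le_trans lm).
split; first exact: L2_real.
- move=> /eq_aeP[/= h _].
  have [mu_ _] := hs.
  have := integral_sqr_ge0 (fun q : R3 MR => (E q - l)^-1).
  have h0 := sqr_integral_ae0 mu_ h.
  have := sqr_integral_le hs; rewrite h0 mulr0 -/(F l) Fl => h1.
  by have := exprn_gt0 2 kap0; rewrite ltNge h1.
- apply: aeW => q _; apply/eqP; rewrite -subr_eq0 -/(op_shift A l _ q); apply/eqP.
  apply: complex_ext; rewrite ?Re_op_shift ?Im_op_shift /real_op /=.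
    by rewrite divff// -/(F l) Fl mulVf ?gt_eqF// subrr.
  by rewrite mulr0 Rintegral_torus_cst !(mul0r, mulr0) subrr.
Qed.

(** Isolation holds because F is injective below m: no other point there is in
    the spectrum. *)
Lemma discrete_below l : l < m -> spectrum A l -> discrete_spectrum A l.
Proof.
move=> lm sl.
have Fl : F l = kap.
  by apply/eqP; apply: contra_notT sl => /(resolvent_below lm).
have ef := eigenfunction_inv lm Fl.
split.
- split; first by rewrite inE.
  exists [set x | x < m]; first by apply: open_nbhs_nbhs; split => //; exact: lt_open.
  apply/seteqP; split => [x [/= xm sx]|x ->]; last by split.
  apply: (inv_symbol_integral_inj mE loE Ehi xm lm); rewrite Fl.
  by apply/eqP; apply: contra_notT sx => /(resolvent_below xm).
- by exists (fun q => ((E q - l)^-1)%:C).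
- exists 1%N, (fun _ q => ((E q - l)^-1)%:C); split.
    by move=> _; have [] := ef.
  move=> f hf; have [c hc] := eigenfunction_form lm hf.
  by exists (fun=> c); move: hc; apply: filterS => q + Tq => /(_ Tq) ->;
    rewrite big_ord1.
Qed.

End BelowBand.

(** * The bottom of the essential spectrum *)

Section Dipoles.
Variable R : realType.
Local Notation mu := (leb3 R).
Local Notation MR := (measurableTypeR R).
Local Notation T := (@torus R : set (R3 MR)).
Implicit Types (B : set (R3 MR)).

Lemma ae_witness B (P : R3 MR -> Prop) : measurable B -> B `<=` T ->
  0 < fine (mu B) -> {ae mu, forall q, torus q -> P q} -> exists2 q, B q & P q.
Proof.
move=> mB BT B0 [N [mN N0 hN]]; apply: contrapT => H.
have BN : B `<=` N.
  move=> q Bq; apply: hN => /= hq; apply: H; exists q => //.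
  by apply: hq; exact: BT.
have : (mu B <= mu N)%E by apply: le_measure; rewrite ?inE.
rewrite N0 => h; suff : mu B = 0%E by move=> e; rewrite e ltxx in B0.
by apply/eqP; rewrite eq_le h measure_ge0.
Qed.

Lemma integrable_indic_torus B : measurable B ->
  mu.-integrable T (EFin \o (\1_B : R3 MR -> R)).
Proof.
move=> mB; apply: (@integrable_torus _ _ 1); first exact: measurable_indic.
by move=> q _; rewrite indicE; case: (q \in B); rewrite ?normr1 ?normr0.
Qed.

Lemma Rintegral_indic_torus B : measurable B -> B `<=` T ->
  \int[mu]_(q in T) (\1_B q : R) = fine (mu B).
Proof.
move=> mB BT; rewrite /Rintegral integral_indic//; last exact: measurable_torus.
by rewrite setIidl.
Qed.

Lemma measurable_box (a a' b b' c c' : R) :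
  measurable (`]a, a'] `*` `]b, b'] `*` `]c, c'] : set (R3 MR)).
Proof. by apply: measurableX => //; exact: measurableX. Qed.

(** Functions of mean zero for two disjoint sets of equal measure: they are
    annihilated by the rank-one part of the operator, which thus acts on them as
    multiplication by the symbol. *)
Definition dipole B1 B2 (q : R3 R) : R := \1_B1 q - \1_B2 q.

Variables (B1 B2 : set (R3 MR)) (v : R).
Hypotheses (mB1 : measurable B1) (mB2 : measurable B2).
Hypotheses (B1T : B1 `<=` T) (B2T : B2 `<=` T).
Hypothesis B12 : forall q, B1 q -> B2 q -> False.
Hypotheses (vB1 : fine (mu B1) = v) (vB2 : fine (mu B2) = v).

Lemma measurable_dipole : measurable_fun T (dipole B1 B2 : R3 MR -> R).
Proof. by apply: measurable_funB; exact: measurable_indic. Qed.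

Lemma dipole_sqr q : dipole B1 B2 q ^+ 2 = \1_B1 q + \1_B2 q.
Proof.
rewrite /dipole !indicE; case: (boolP (q \in B1)) => h1; case: (boolP (q \in B2)) => h2.
- by exfalso; apply: (@B12 q); rewrite -inE.
- by rewrite subr0 addr0 expr1n.
- by rewrite sub0r add0r sqrrN expr1n.
- by rewrite subr0 addr0 expr0n.
Qed.

Lemma sqr_integrable_dipole : sqr_integrable (dipole B1 B2 : R3 MR -> R).
Proof.
apply: (@sqr_integrable_bounded _ _ 1); first exact: measurable_dipole.
move=> q _; rewrite -(@expr_le1 _ 2)// real_normK ?num_real// dipole_sqr !indicE.
case: (boolP (q \in B1)) => h1; case: (boolP (q \in B2)) => h2; rewrite ?addr0 ?add0r//.
by exfalso; apply: (@B12 q); rewrite -inE.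
Qed.

Lemma dipole_integral : \int[mu]_(q in T) dipole B1 B2 q = 0.
Proof.
rewrite RintegralB; [|exact: measurable_torus|exact: integrable_indic_torus..].
by rewrite !Rintegral_indic_torus// vB1 vB2 subrr.
Qed.

Lemma dipole_sqr_integral : \int[mu]_(q in T) (dipole B1 B2 q ^+ 2) = v + v.
Proof.
under eq_Rintegral => q _ do rewrite dipole_sqr.
rewrite RintegralD; [|exact: measurable_torus|exact: integrable_indic_torus..].
by rewrite !Rintegral_indic_torus// vB1 vB2.
Qed.

End Dipoles.

Section EssentialSpectrum.
Variables (R : realType) (ga : R).
Hypothesis ga0 : 0 < ga.
Variable k : R3 R.
Local Notation mu := (leb3 R).
Local Notation MR := (measurableTypeR R).
Local Notation T := (@torus R : set (R3 MR)).
Local Notation Re := complex.Re.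
Local Notation Im := complex.Im.
Local Notation E := (calE k ga).
Local Notation A := (hop ga k).
Local Notation m := (band_bottom ga k).
Local Notation kap := (critical ga).

Lemma calE_lip (p q : R3 R) (h : R) : `|p.1.1 - q.1.1| <= h ->
  `|p.1.2 - q.1.2| <= h -> `|p.2 - q.2| <= h ->
  `|E p - E q| <= 3 * (1 + ga) * h.
Proof.
move=> h1 h2 h3; have e1 := dispersion_lip h1 h2 h3.
have e2 : `|dispersion (k - p) - dispersion (k - q)| <= 3 * h.
  have e (t x y : R) : t - x - (t - y) = y - x by ring.
  by apply: dispersion_lip => /=; rewrite e distrC.
have g0 := ga0; rewrite /calE.
move: (dispersion p) (dispersion q) (dispersion (k - p)) (dispersion (k - q)) e1 e2.
move=> a b c d; clear -g0; rewrite !ler_norml => /andP[? ?] /andP[? ?].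
by apply/andP; split; nra.
Qed.

Lemma op_shift_dipole l (u : R3 R -> R) : \int[mu]_(q in T) u q = 0 ->
  forall q, op_shift A l (fun q => (u q)%:C) q = ((E q - l) * u q)%:C.
Proof.
move=> u0 q; apply: complex_ext.
- by rewrite (Re_op_shift ga0) /real_op /= u0 mulr0 subr0.
- by rewrite (Im_op_shift ga0) /real_op /= Rintegral_torus_cst mul0r !mulr0 subrr.
Qed.

(** Weyl's argument: on a dipole supported in a small cube at q0 the shifted
    operator is small, so no lower bound can hold at E q0.  The cube has q0 as
    its upper corner, which keeps it inside the half-open torus. *)
Lemma spectrum_calE (q0 : R3 R) : torus q0 -> spectrum A (E q0).
Proof.
move=> [[q1 q2] q3] [[C HC] _].
pose C' := `|C| + 1; have C0 : 0 < C' by rewrite ltr_pwDr.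
have g0 : 0 < 1 + ga by rewrite addr_gt0.
have gap (t : R) : t \in `]- pi, pi] -> 0 < t + pi by rewrite in_itv/=; lra.
(* The symbol is 3 (1 + ga)-Lipschitz, so on a cube of side at most h1 it varies
   by at most 1 / (2 C'), which contradicts the lower bound with constant C'. *)
pose h1 := (6 * (1 + ga) * C')^-1.
have h10 : 0 < h1 by rewrite invr_gt0 !mulr_gt0.
pose h := Num.min h1 (Num.min ((q0.1.1 + pi) / 2) (Num.min ((q0.1.2 + pi) / 2) ((q0.2 + pi) / 2))).
have h0 : 0 < h by rewrite !lt_min h10 !divr_gt0 ?gap.
have [hh1 ha hb hc] : [/\ h <= h1, h <= (q0.1.1 + pi) / 2,
   h <= (q0.1.2 + pi) / 2 & h <= (q0.2 + pi) / 2].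
  by rewrite /h !ge_min !lexx ?orbT; split.
pose J2 := `]q0.1.2 - h, q0.1.2]%classic; pose J3 := `]q0.2 - h, q0.2]%classic.
pose B1 : set (R3 MR) := `]q0.1.1 - h, q0.1.1 - h / 2] `*` J2 `*` J3.
pose B2 : set (R3 MR) := `]q0.1.1 - h / 2, q0.1.1] `*` J2 `*` J3.
have mB1 : measurable B1 by exact: measurable_box.
have mB2 : measurable B2 by exact: measurable_box.
have I1 (t s : R) : t \in `]- pi, pi] -> h <= (t + pi) / 2 -> s \in `]t - h, t] ->
    (s \in `]- pi, pi]) && (`|s - t| <= h).
  by rewrite !in_itv/= ler_norml; clear -h0; lra.
have in1 (s : R) : s \in `]q0.1.1 - h, q0.1.1 - h / 2] -> s \in `]q0.1.1 - h, q0.1.1].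
  by rewrite !in_itv/=; clear -h0; lra.
have in2 (s : R) : s \in `]q0.1.1 - h / 2, q0.1.1] -> s \in `]q0.1.1 - h, q0.1.1].
  by rewrite !in_itv/=; clear -h0; lra.
have B1h q : B1 q -> torus q /\ `|E q - E q0| <= 3 * (1 + ga) * h.
  move=> [[/in1/(I1 _ _ q1 ha)/andP[? ?] /(I1 _ _ q2 hb)/andP[? ?]]].
  by move=> /(I1 _ _ q3 hc)/andP[? ?]; split; [do !split|exact: calE_lip].
have B2h q : B2 q -> torus q /\ `|E q - E q0| <= 3 * (1 + ga) * h.
  move=> [[/in2/(I1 _ _ q1 ha)/andP[? ?] /(I1 _ _ q2 hb)/andP[? ?]]].
  by move=> /(I1 _ _ q3 hc)/andP[? ?]; split; [do !split|exact: calE_lip].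
have B1T : B1 `<=` T by move=> q /B1h[].
have B2T : B2 `<=` T by move=> q /B2h[].
have B12 q : B1 q -> B2 q -> False.
  by move=> [[+ _] _] [[+ _] _]; rewrite /= !in_itv/=; clear; lra.
pose v := h / 2 * h * h; have v0 : 0 < v by rewrite !mulr_gt0.
have vB1 : fine (mu B1) = v.
  by rewrite leb3_box /=; [rewrite /v; field|clear -h0; lra..].
have vB2 : fine (mu B2) = v.
  by rewrite leb3_box /=; [rewrite /v; field|clear -h0; lra..].
pose u := dipole B1 B2.
have hu : sqr_integrable (u : R3 MR -> R) := sqr_integrable_dipole mB1 mB2 B12.
have u0 : \int[mu]_(q in T) u q = 0 := dipole_integral mB1 mB2 B1T B2T vB1 vB2.
have := HC _ (L2_real hu).
rewrite (_ : op_shift _ _ _ = fun q => ((E q - E q0) * u q)%:C); last first.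
  by apply/funext => q; exact: op_shift_dipole.
set ep := 3 * (1 + ga) * h in B1h B2h.
have ep0 : 0 < ep by rewrite !mulr_gt0.
have hw : sqr_integrable (fun q : R3 MR => (E q - E q0) * u q).
  apply: (@sqr_integrableM _ _ _ (`|m| + `|6 * (1 + ga)| + `|E q0|)) => //.
    apply: measurable_funTS; apply: measurable_funB; first exact: measurable_calE.
    exact: measurable_cst.
  by move=> q _; apply: symbol_bounded; [exact: calE_ge|exact: calE_le].
rewrite !L2norm_real// (dipole_sqr_integral mB1 mB2 B1T B2T B12 vB1 vB2).
have wle : \int[mu]_(q in T) (((E q - E q0) * u q) ^+ 2) <= ep ^+ 2 * (v + v).
  rewrite -(dipole_sqr_integral mB1 mB2 B1T B2T B12 vB1 vB2).
  have [_ iu] := hu; have [_ iw] := hw; have mT := @measurable_torus R.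
  rewrite -RintegralZl//; apply: le_Rintegral => //.
    exact: (integrableZl mT (ep ^+ 2) iu).
  move=> q Tq; rewrite exprMn -/u.
  have [uq|uq] := eqVneq (u q) 0; first by rewrite uq expr0n /= !mulr0.
  have hq : `|E q - E q0| <= ep.
    move: uq; rewrite /u /dipole !indicE.
    case: (boolP (q \in B1)) => [/set_mem/B1h[]//|_].
    case: (boolP (q \in B2)) => [/set_mem/B2h[]//|_].
    by rewrite subrr eqxx.
  rewrite ler_wpM2r ?sqr_ge0// -[leLHS]real_normK ?num_real//.
  by rewrite lerXn2r ?nnegrE ?(ltW ep0).
have : Num.sqrt (\int[mu]_(q in T) (((E q - E q0) * u q) ^+ 2)) <= ep * Num.sqrt (v + v).
  apply: le_trans (ler_wsqrtr wle) _.
  by rewrite sqrtrM ?sqr_ge0// sqrtr_sqr gtr0_norm.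
have sv : 0 < Num.sqrt (v + v) by rewrite sqrtr_gt0 addr_gt0.
have eC : ep * C' <= 2^-1.
  apply: (@le_trans _ _ (3 * (1 + ga) * h1 * C')).
    by rewrite /ep ler_pM2r// ler_pM2l// !mulr_gt0.
  rewrite /h1 le_eqVlt; apply/orP; left; apply/eqP; field.
  by rewrite !gt_eqF.
have CC : C <= C' by apply: le_trans (ler_norm C) _; rewrite lerDl.
have w0 := sqrtr_ge0 (\int[mu]_(q in T) (((E q - E q0) * u q) ^+ 2)).
move: (Num.sqrt (v + v)) (Num.sqrt (\int[mu]_(q in T) _)) sv w0 => s w sv w0 wep sC.
have h2 : C * w <= C' * (ep * s).
  apply: (@le_trans _ _ (C' * w)); first by rewrite ler_wpM2r.
  by rewrite ler_pM2l.
have : C' * (ep * s) <= 2^-1 * s by rewrite mulrA ler_pM2r// mulrC.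
by move: sC h2 sv; clear; lra.
Qed.

Lemma calE_segment (q0 q1 : R3 R) (y : R) : torus q0 -> torus q1 ->
  E q0 <= y <= E q1 -> exists2 q, torus q & E q = y.
Proof.
move=> [[a1 a2] a3] [[b1 b2] b3] /andP[y0 y1].
pose p (t : R) : R3 R := (q0.1.1 + t * (q1.1.1 - q0.1.1),
  q0.1.2 + t * (q1.1.2 - q0.1.2), q0.2 + t * (q1.2 - q0.2)).
have ca (a b : R) : continuous (fun t : R => a + t * (b - a)).
  move=> t; apply: cvgD; first exact: cvg_cst.
  by apply: cvgM; [exact: cvg_id|exact: cvg_cst].
have cE : continuous (fun t => E (p t)).
  rewrite (_ : (fun _ => _) = fun t =>
    dispersion1 ga k.1.1 (q0.1.1 + t * (q1.1.1 - q0.1.1)) +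
    dispersion1 ga k.1.2 (q0.1.2 + t * (q1.1.2 - q0.1.2)) +
    dispersion1 ga k.2 (q0.2 + t * (q1.2 - q0.2))); last first.
    by apply/funext => t; rewrite calE_sum.
  have cd ka a b : continuous (fun t : R => dispersion1 ga ka (a + t * (b - a))).
    move=> t; have := @continuous_comp _ _ _ _ _ t (ca a b t)
      (@continuous_dispersion1 _ ga ka (a + t * (b - a))).
    by [].
  by move=> t; apply: cvgD; [apply: cvgD|]; exact: cd.
have p0 : p 0 = q0 by rewrite /p !mul0r !addr0; case: (q0) => [[]].
have p1 : p 1 = q1 by rewrite /p !mul1r !subrKC; case: (q1) => [[]].
have [|t + Et] := @IVT R (fun t => E (p t)) 0 1 y ler01 (continuous_subspaceT cE).
  by rewrite p0 p1 ge_min y0/= le_max y1 orbT.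
rewrite in_itv/= => /andP[t0 t1]; exists (p t) => //.
have cv (a b : R) : a \in `]- pi, pi] -> b \in `]- pi, pi] ->
    a + t * (b - a) \in `]- pi, pi].
  rewrite !in_itv/= => /andP[ha1 ha2] /andP[hb1 hb2].
  have t1' : 0 <= 1 - t by rewrite subr_ge0.
  have hb2' : 0 <= pi - b by rewrite subr_ge0.
  have ha2' : 0 <= pi - a by rewrite subr_ge0.
  have u1 := mulr_ge0 t0 hb2'; have u2 := mulr_ge0 t1' ha2'.
  have [->|tn] := eqVneq t 0; first by rewrite mul0r addr0 ha1.
  have tp : 0 < t by rewrite lt_neqAle eq_sym tn.
  have hb1' : 0 < b + pi by lra.
  have ha1' : 0 <= a + pi by lra.
  have u3 := mulr_gt0 tp hb1'; have u4 := mulr_ge0 t1' ha1'.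
  by clear -u1 u2 u3 u4; apply/andP; split; nra.
by split; [split|]; exact: cv.
Qed.

(** By connectedness the symbol takes all values between m and E q1, so m is not
    isolated in the spectrum. *)
Lemma not_discrete_nonconstant (q1 : R3 R) : torus q1 -> E q1 != m ->
  ~ discrete_spectrum A m.
Proof.
move=> T1 E1 [[_ [V + VA]] _ _].
have [q0 T0 E0] := calE_attained ga k.
have E1m : m < E q1 by rewrite lt_neqAle eq_sym E1 calE_ge.
move=> /nbhs_ballP[e /= e0 eV].
pose y := Num.min (m + e / 2) (E q1).
have my : m < y by rewrite lt_min E1m ltrDl divr_gt0.
have ye : y <= m + e / 2 by rewrite ge_min lexx.
have [q Tq Eq] : exists2 q, torus q & E q = y.
  by apply: (calE_segment T0 T1); rewrite E0 (ltW my) ge_min lexx orbT.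
have : (V `&` spectrum A) y.
  split; last by rewrite -Eq; exact: spectrum_calE.
  apply: eV; rewrite /ball /= ltr_norml.
  by move: my ye e0; clear; lra.
by rewrite VA => /= ey; rewrite ey ltxx in my.
Qed.

(** A constant symbol does occur, at k = (pi, pi, pi) for ga = 1.  Then every
    function of mean zero is an eigenfunction; n + 1 dipoles with disjoint
    supports are linearly independent, which excludes multiplicity n. *)
Lemma not_discrete_constant : (forall q, torus q -> E q = m) ->
  ~ discrete_spectrum A m.
Proof.
move=> Em [_ _ [n [e [Le He]]]]; have p0 := pi_gt0 R.
(* The interval ]0, pi] of the first coordinate is cut into n + 1 pairs of slabs
   of width s. *)
pose s : R := pi / (2 * n.+1%:R).
have s0 : 0 < s by rewrite divr_gt0// mulr_gt0.
pose Ipi := `]- pi, (pi : R)]%classic.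
pose a (j : 'I_n.+1) : R := 2 * (j : nat)%:R * s.
pose B1 j : set (R3 MR) := `]a j, a j + s] `*` Ipi `*` Ipi.
pose B2 j : set (R3 MR) := `]a j + s, a j + 2 * s] `*` Ipi `*` Ipi.
have mB1 j : measurable (B1 j) by exact: measurable_box.
have mB2 j : measurable (B2 j) by exact: measurable_box.
have a0 j : 0 <= a j by rewrite !mulr_ge0// ltW.
have apos j : a j + 2 * s <= pi.
  have -> : a j + 2 * s = 2 * s * (j.+1)%:R by rewrite /a -natr1; ring.
  have -> : pi = 2 * s * n.+1%:R.
    have : n.+1%:R != 0 :> R by rewrite pnatr_eq0.
    by rewrite /s; move: (n.+1%:R) => N N0; field.
  by rewrite ler_pM2l ?mulr_gt0// ler_nat.
have inI (x j : R) : 0 <= j -> j + 2 * s <= pi -> j < x <= j + 2 * s -> - pi < x <= pi.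
  by clear -p0; lra.
have B1T j : B1 j `<=` T.
  move=> q [[/= + h2] h3]; rewrite in_itv/= => h1; split; [split|] => //=.
  by rewrite in_itv/=; apply: (inI _ _ (a0 j) (apos j)); move: h1 s0; clear; lra.
have B2T j : B2 j `<=` T.
  move=> q [[/= + h2] h3]; rewrite in_itv/= => h1; split; [split|] => //=.
  by rewrite in_itv/=; apply: (inI _ _ (a0 j) (apos j)); move: h1 s0; clear; lra.
have B12 j q : B1 j q -> B2 j q -> False.
  by move=> [[+ _] _] [[+ _] _]; rewrite /= !in_itv/=; clear; lra.
pose v := s * (2 * pi) * (2 * pi); have v0 : 0 < v by rewrite !mulr_gt0.
have vB1 j : fine (mu (B1 j)) = v.
  by rewrite leb3_box /=; [rewrite /v; ring|clear -s0 p0; lra..].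
have vB2 j : fine (mu (B2 j)) = v.
  by rewrite leb3_box /=; [rewrite /v; ring|clear -s0 p0; lra..].
have vp j : 0 < fine (mu (B1 j)) by rewrite vB1.
pose u j := dipole (B1 j) (B2 j).
have hu j : sqr_integrable (u j : R3 MR -> R) :=
  sqr_integrable_dipole (mB1 j) (mB2 j) (@B12 j).
have u0 j : \int[mu]_(q in T) u j q = 0 :=
  dipole_integral (mB1 j) (mB2 j) (@B1T j) (@B2T j) (vB1 j) (vB2 j).
have u1 j q : B1 j q -> u j q = 1.
  move=> b1; rewrite /u /dipole !indicE mem_set// memNset ?subr0//.
  exact: B12.
have sep i j q : B1 i q -> i != j -> u j q = 0.
  move=> [[+ _] _] ij; rewrite /= in_itv/= => hq.
  have ji : (i < j)%N || (j < i)%N by rewrite -neq_ltn.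
  have hji : (a i + 2 * s <= a j) \/ (a j + 2 * s <= a i).
    have st (x y : nat) : (x < y)%N -> 2 * x%:R * s + 2 * s <= 2 * y%:R * s.
      move=> xy; rewrite (_ : _ + _ = 2 * x.+1%:R * s); last by rewrite -natr1; ring.
      by rewrite ler_pM2r// ler_pM2l// ler_nat.
    by case/orP: ji => /st h; [left|right].
  rewrite /u /dipole !indicE !memNset ?subr0//.
  - move=> [[+ _] _]; rewrite /= in_itv/= => hq'.
    by case: hji; move: hq hq' s0; clear; lra.
  - move=> [[+ _] _]; rewrite /= in_itv/= => hq'.
    by case: hji; move: hq hq' s0; clear; lra.
have ef j : eigenfunction A m (fun q => (u j q)%:C).
  split; first exact: L2_real.
  - move=> h; have [q b1] := ae_witness (mB1 j) (@B1T j) (vp j) h.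
    by rewrite /= u1// => -[] /eqP; rewrite oner_eq0.
  - apply: aeW => q Tq; apply/eqP; rewrite -subr_eq0 -/(op_shift A m _ q).
    by rewrite op_shift_dipole// Em// subrr mul0r.
have /choice[c Hc] : forall j, exists c : 'I_n -> R[i],
    eq_ae (fun q => (u j q)%:C) (fun q => \sum_(i < n) c i * e i q).
  by move=> j; exact: He.
pose M : 'M[R[i]]_(n.+1, n) := \matrix_(j, i) c j i.
(* n + 1 vectors in dimension n satisfy a nontrivial linear relation x, which
   the corresponding dipoles then satisfy almost everywhere. *)
have : kermx M != 0.
  rewrite kermx_eq0 /row_free neq_ltn; apply/orP; left.
  by rewrite ltnS rank_leq_col.
rewrite -nz_row_eq0; set x := nz_row _ => xn0.
have xM : x *m M = 0 by apply/sub_kermxP; exact: nz_row_sub.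
have [j0 xj0] : exists j0, x 0 j0 != 0 by apply/rV0Pn.
have ae0 : {ae mu, forall q, torus q -> \sum_j x 0 j * (u j q)%:C = 0}.
  have : {ae mu, forall q, forall j, torus q ->
      (u j q)%:C = \sum_(i < n) c j i * e i q}.
    by apply: filter_forall => j; exact: Hc.
  apply: (@filterS _ _ (ae_filter_ringOfSetsType mu)) => q h Tq.
  rewrite (eq_bigr (fun j => \sum_(i < n) x 0 j * (c j i * e i q))); last first.
    by move=> j _; rewrite -mulr_sumr; congr (_ * _); exact: h.
  rewrite exchange_big /= big1// => i _.
  have /matrixP/(_ 0 i) := xM; rewrite !mxE => xMi.
  rewrite (eq_bigr (fun j => x 0 j * M j i * e i q)); last first.
    by move=> j _; rewrite mxE mulrA.
  by rewrite -mulr_suml xMi mul0r.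
have [q b1] := ae_witness (mB1 j0) (@B1T j0) (vp j0) ae0.
rewrite (bigD1 j0)//= u1// big1 ?addr0 => [|j jj0].
  by rewrite mulr1 => /eqP; rewrite (negbTE xj0).
by rewrite (sep j0)// 1?eq_sym// mulr0.
Qed.

Lemma ess_bottomE : ess_bottom A = m.
Proof.
have [q0 T0 E0] := calE_attained ga k.
have mess : essential_spectrum A m.
  split; first by rewrite -E0; exact: spectrum_calE.
  have [[q1 [T1 E1]]|H] := pselect (exists q1, torus q1 /\ E q1 != m).
    exact: not_discrete_nonconstant E1.
  apply: not_discrete_constant => q Tq.
  by apply/eqP; apply: contra_notT H => h; exists q.
have lb : lbound (essential_spectrum A) m.
  move=> l [sl nd]; rewrite leNgt; apply/negP => lm; apply: nd.
  exact: discrete_below.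
apply/eqP; rewrite eq_le; apply/andP; split.
  by apply: ge_inf => //; exists m.
by apply: lb_le_inf => //; exists m.
Qed.

End EssentialSpectrum.

(** * The zero-energy resonance *)

Section Resonance.
Variables (R : realType) (ga : R).
Hypothesis ga0 : 0 < ga.
Local Notation mu := (leb3 R).
Local Notation MR := (measurableTypeR R).
Local Notation T := (@torus R : set (R3 MR)).
Local Notation vol := ((2 * pi) ^+ 3 : R).
Local Notation Re := complex.Re.
Local Notation Im := complex.Im.

Lemma calE0k (q : R3 R) : calE 0 ga q = (1 + ga) * dispersion q.
Proof. by rewrite /calE sub0r dispersionN; ring. Qed.

(** The coupling constant is defined by this normalisation: [Gop] is exactly the
    projection onto the constants. *)
Lemma Gop_vop (f : R3 R -> R[i]) p : Gop ga f p = vop f p.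
Proof.
have mT := @measurable_torus R; have g0 : 1 + ga != 0 by rewrite gt_eqF// addr_gt0.
rewrite /Gop (coupling_vop ga0); set s := vop f p.
have -> : cintegral (h0inv ga (vop f)) = (critical ga)%:C * s.
  have h (x : R) : \int[mu]_(q in T) ((calE 0 ga q)^-1 * x) = critical ga * x.
    have e q : (calE 0 ga q)^-1 * x = (x / (1 + ga)) * (dispersion q)^-1.
      by rewrite calE0k invfM; ring.
    under eq_Rintegral => q _ do rewrite e.
    rewrite RintegralZl//; last exact: integrable_inv_dispersion.
    by rewrite /critical; ring.
  apply: complex_ext; rewrite ?ReMr ?ImMr.
  - by rewrite -h; apply: eq_Rintegral => q _; rewrite /h0inv /vop !ReMr.
  - by rewrite -h; apply: eq_Rintegral => q _; rewrite /h0inv /vop !ImMr.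
rewrite mulrA -rmorphM mulVf ?mul1r//.
by rewrite gt_eqF// critical_gt0.
Qed.

Lemma cintegral1 : cintegral (fun=> 1 : R[i]) = vol%:C.
Proof.
by apply: complex_ext; rewrite /= Rintegral_torus_cst ?mul1r ?mul0r.
Qed.

Lemma resonance : zero_energy_resonance ga.
Proof.
have v0 : vol != 0 by rewrite gt_eqF ?vol_gt0.
split.
  exists (fun=> 1); split.
  - have -> : (fun=> 1 : R[i]) = (fun _ : R3 R => (1 : R)%:C) by [].
    exact/L2_real/sqr_integrable_cst.
  - move=> h; have := @corner_gt0 R => c0.
    have [q _] := ae_witness (@measurable_corner R) (@corner_torus R) c0 h.
    by move/eqP; rewrite oner_eq0.
  - apply: aeW => q _; rewrite Gop_vop /vop cintegral1 -rmorphM mulVf//.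
    by rewrite rmorph1 mulr1.
move=> psi [_ psi0 h]; apply/eqP => vp; apply: psi0.
move: h; apply: filterS => q /= + Tq => /(_ Tq).
rewrite Gop_vop; have -> : vop psi q = vop psi 0 by [].
by rewrite vp rmorph1 mul1r => <-.
Qed.

End Resonance.

(** * An implicit function theorem for families of power series *)

Section ImplicitLevel.
Variables (R : realType) (dQ : measure_display) (Q : measurableType dQ).
Variables (D : set Q) (mu : {measure set Q -> \bar R}).
Hypotheses (mD : measurable D) (Doo : (mu D < +oo)%E).
Variables (a : Q -> R) (d : R).
Hypotheses (ma : measurable_fun D a) (d0 : 0 < d) (da : forall q, D q -> d <= a q).

Let a0 q : D q -> 0 < a q.
Proof. by move=> Dq; exact: lt_le_trans d0 (da Dq). Qed.

Lemma inv_le_inv q : D q -> 0 < (a q)^-1 <= d^-1.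
Proof. by move=> Dq; rewrite invr_gt0 a0//= lef_pV2 ?posrE ?a0//; exact: da. Qed.

Section Radius.
Variable r : R.
Hypothesis r0 : 0 < r.
Local Notation family := (analytic_family D r).

Lemma family_integrable M f h : family (fun=> M) f -> cube r h ->
  mu.-integrable D (EFin \o (fun q => f q h)).
Proof.
move=> hf rh; apply: (integrable_of_bounded mD Doo (C := M)).
  exact: (family_measurable hf rh).
by move=> q Dq; exact: (family_bound hf).
Qed.

(** The factor 2 bounds 1 / (1 - t) for t <= 1/2. *)
Lemma family_inv_diff t f : 0 <= t -> t <= 2^-1 -> family (fun=> t * d) f ->
  family (fun=> 2 * t / d) (fun q h => (a q - f q h)^-1 - (a q)^-1).
Proof.
move=> t0 t2 hf; have t1 : t < 1 by lra.
have hM q : D q -> 0 <= t * d <= t * a q.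
  by move=> Dq; rewrite mulr_ge0 ?(ltW d0)// ler_wpM2l// da.
have h1 := family_inv r0 ma a0 t1 hM hf.
have h2 : forall q, D q -> 0 <= (a q * (1 - t))^-1.
  by move=> q Dq; rewrite invr_ge0 mulr_ge0 ?(ltW (a0 Dq))// subr_ge0 ltW.
have h3 := @family_scale _ _ _ _ _ r0 (fun q => (a q)^-1) _ _
  (measurable_funV ma) (family_mul r0 hf h1 h2).
apply: (family_ext _ _ h3) => [q Dq|q h Dq rh].
  have := a0 Dq; have := da Dq; move: (a q) => x dx x0.
  rewrite ger0_norm ?invr_ge0 ?(ltW x0)//.
  have -> : x^-1 * (t * d * (x * (1 - t))^-1) = t * d / (x ^+ 2 * (1 - t)).
    by rewrite expr2 !invfM; ring.
  rewrite ler_pdivrMr ?mulr_gt0 ?exprn_gt0 ?subr_gt0//.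
  rewrite mulrAC ler_pdivlMr//.
  have dd : d ^+ 2 <= x ^+ 2 by rewrite lerXn2r ?nnegrE ?(ltW d0) ?(ltW x0).
  have : d ^+ 2 <= x ^+ 2 * (2 * (1 - t)).
    by apply: le_trans dd _; rewrite ler_peMr ?sqr_ge0//; lra.
  by move=> /(ler_wpM2l t0); rewrite expr2; lra.
have := family_bound hf Dq rh; have := da Dq.
move: (a q) (f q h) (a0 Dq) => x y x0 dx; rewrite ler_norml => /andP[_ hy].
have td : t * d <= 2^-1 * d by rewrite ler_pM2r.
have xy : 0 < x - y by have := d0; lra.
by field; rewrite !gt_eqF.
Qed.

End Radius.

Let G := \int[mu]_(q in D) ((a q)^-1 ^+ 2).
Hypothesis G0 : 0 < G.

(** The three scales of the iteration: perturbations w of norm at most th0 * d and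
   corrections Y of norm at most th * d / 2 keep w + Y at most th * d, where th
   makes the Newton map a contraction of ratio 1/2, and th0 makes its first
   step at most half of the radius for Y. *)
Let c := fine (mu D) / (G * d ^+ 2).
Let th := (12 * c + 2)^-1.
Let th0 := th / (8 * c + 2).

Let c0 : 0 <= c.
Proof. by rewrite divr_ge0 ?fine_ge0 ?measure_ge0// mulr_ge0 ?(ltW G0)// sqr_ge0. Qed.

Let thP : [/\ 0 < th, th <= 2^-1 & 12 * c * th <= 1].
Proof.
have h : 0 < 12 * c + 2 by have := c0; lra.
split; first by rewrite invr_gt0.
  by rewrite lef_pV2 ?posrE//; have := c0; lra.
by rewrite ler_pdivrMr//; lra.
Qed.

Let th0P : [/\ 0 < th0, th0 <= th / 2 & 8 * c * th0 <= th].
Proof.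
have h : 0 < 8 * c + 2 by have := c0; lra.
have [h1 _ _] := thP; split; first by rewrite divr_gt0.
  by rewrite ler_pM2l// lef_pV2 ?posrE//; have := c0; lra.
by rewrite mulrA ler_pdivrMr// mulrC ler_pM2l//; lra.
Qed.

Section Step.
Variables (r : R) (w : Q -> R3 R -> R).
Hypotheses (r0 : 0 < r) (hw : analytic_family D r (fun=> th0 * d) w).
Local Notation family := (analytic_family D r).
Let dt := th * d / 2.

Let dt0 : 0 < dt.
Proof. by have [h _ _] := thP; rewrite divr_gt0// mulr_gt0. Qed.

(** One step of the simplified Newton method for the equation
    \int 1 / (a - w - Y) = \int 1 / a in the unknown Y, with the derivative G of
    the left side taken at w = 0 and Y = 0 throughout. *)
Definition newton_step (Y : R3 R -> R) (h : R3 R) : R :=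
  Y h - G^-1 * (\int[mu]_(q in D) (a q - (w q h + Y h))^-1 -
                \int[mu]_(q in D) (a q)^-1).

Let e (Y : R3 R -> R) q h := (a q - (w q h + Y h))^-1 - (a q)^-1.

(** 1 / (a - w - Y) times the same with Y' is 1 / a^2 plus kappa, and the term
   1 / a^2 cancels against the derivative G at 0; what remains is [ratio]. *)
Let kappa (Y Y' : R3 R -> R) q h :=
  (a q)^-1 * e Y q h + (a q)^-1 * e Y' q h + e Y q h * e Y' q h.

Let ratio (Y Y' : R3 R -> R) h := - G^-1 * \int[mu]_(q in D) kappa Y Y' q h.

Let small (Y : R3 R -> R) := family (fun=> dt) (fun _ h => Y h).

Lemma small_sum Y : small Y -> family (fun=> th * d) (fun q h => w q h + Y h).
Proof.
have [h1 h2 h3] := th0P; have [t0 _ _] := thP; move=> hY.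
apply: (family_ext _ _ (family_add r0 hw hY _ _)) => // q Dq; last first.
- exact: ltW dt0.
- by rewrite mulr_ge0// ltW.
- have : th0 * d <= th / 2 * d by rewrite ler_pM2r.
  by rewrite /dt; lra.
Qed.

Lemma family_resolvent_diff Y : small Y -> family (fun=> 2 * th / d) (e Y).
Proof. by have [h1 h2 h3] := thP; move=> /small_sum; apply: family_inv_diff => //; exact: ltW. Qed.

Lemma family_kappa Y Y' : small Y -> small Y' ->
  family (fun=> 6 * th / d ^+ 2) (kappa Y Y').
Proof.
move=> /family_resolvent_diff hY /family_resolvent_diff hY'; have [h1 h2 h3] := thP.
have p0 : 0 <= 2 * th / d by rewrite divr_ge0 ?(ltW d0)// mulr_ge0 ?(ltW h1).
have ha Z M : 0 <= M -> family (fun=> M) Z ->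
    family (fun=> d^-1 * M) (fun q h => (a q)^-1 * Z q h).
  move=> M0 hZ; apply: (family_ext _ _ (@family_scale _ _ _ _ _ r0
    (fun q => (a q)^-1) _ _ (measurable_funV ma) hZ)) => // q Dq.
  by have /andP[i1 i2] := inv_le_inv Dq; rewrite gtr0_norm// ler_wpM2r.
have p1 : 0 <= d^-1 * (2 * th / d) by rewrite mulr_ge0// invr_ge0 ltW.
have p2 : 0 <= 2 * th / d * (2 * th / d) by rewrite mulr_ge0.
apply: (family_ext _ _ (family_add r0 (family_add r0 (ha _ _ p0 hY) (ha _ _ p0 hY') _ _)
  (family_mul r0 hY hY' _) _ _)) => // q Dq; last by rewrite addr_ge0.
have -> : d^-1 * (2 * th / d) + d^-1 * (2 * th / d) + 2 * th / d * (2 * th / d) =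
  (4 * th + 4 * th ^+ 2) / d ^+ 2 by field; rewrite gt_eqF.
rewrite ler_pM2r ?invr_gt0 ?exprn_gt0//.
have : th * th <= th * 2^-1 by rewrite ler_pM2l.
by rewrite -expr2; lra.
Qed.

Lemma family_ratio Y Y' : small Y -> small Y' ->
  family (fun=> 2^-1) (fun _ h => ratio Y Y' h).
Proof.
move=> hY hY'; have [h1 h2 h3] := thP.
have hI := family_integral r0 mD Doo (family_kappa hY hY') (fun q _ => lexx _).
have mc : measurable_fun D (fun=> - G^-1 : R) by exact: measurable_cst.
apply: (family_ext _ _ (@family_scale _ _ _ _ _ r0 (fun=> - G^-1) _ _ mc hI)) => // q _.
rewrite normrN ger0_norm ?invr_ge0 ?(ltW G0)//.
have -> : G^-1 * (6 * th / d ^+ 2 * fine (mu D)) = 6 * c * th.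
  by rewrite /c; field; rewrite !gt_eqF.
lra.
Qed.

Lemma denominator_gt0 Y q h : small Y -> D q -> cube r h -> 0 < a q - (w q h + Y h).
Proof.
move=> /small_sum hY Dq rh; have [h1 h2 h3] := thP.
have := family_bound hY Dq rh; have := da Dq; rewrite ler_norml => h4 /andP[_ h5].
have td : th * d <= 2^-1 * d by rewrite ler_pM2r.
by have := d0; lra.
Qed.

(** The difference quotient of the Newton map is exactly [ratio], itself a power
    series of norm at most 1/2; so the contraction takes place in the majorant
    norm, and not only pointwise. *)
Lemma newton_step_diff Y Y' h : small Y -> small Y' -> cube r h ->
  newton_step Y h - newton_step Y' h = (Y h - Y' h) * ratio Y Y' h.
Proof.
move=> hY hY' rh.
have Iinv Z : small Z -> mu.-integrable D (EFin \o (fun q => (a q - (w q h + Z h))^-1)).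
  move=> hZ; have I1 := family_integrable (family_resolvent_diff hZ) rh.
  have I2 : mu.-integrable D (EFin \o (fun q => (a q)^-1)).
    apply: (integrable_of_bounded mD Doo (C := d^-1)); first exact: measurable_funV.
    by move=> q Dq; have /andP[i1 i2] := inv_le_inv Dq; rewrite gtr0_norm.
  apply: eq_integrable (integrableD mD I1 I2) => // q _ /=.
  by rewrite -EFinD /e subrK.
have I2 : mu.-integrable D (EFin \o (fun q => (a q)^-1 ^+ 2)).
  apply: (integrable_of_bounded mD Doo (C := d^-1 ^+ 2)).
    by apply: measurable_funX; exact: measurable_funV.
  move=> q Dq; have /andP[i1 i2] := inv_le_inv Dq.
  by rewrite normrX gtr0_norm// lerXn2r ?nnegrE ?(ltW i1)// invr_ge0 ltW.
have Ik := family_integrable (family_kappa hY hY') rh.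
have D1 : \int[mu]_(q in D) (a q - (w q h + Y h))^-1 -
    \int[mu]_(q in D) (a q - (w q h + Y' h))^-1 =
    (Y h - Y' h) * (G + \int[mu]_(q in D) kappa Y Y' q h).
  rewrite -RintegralB//; [|exact: Iinv|exact: Iinv].
  rewrite -RintegralD// -RintegralZl//; last first.
    exact: (integrableD mD I2 Ik).
  apply: eq_Rintegral => q; rewrite inE => Dq.
  have := denominator_gt0 hY Dq rh; have := denominator_gt0 hY' Dq rh; have := a0 Dq.
  rewrite /kappa /e; move: (a q) (w q h) (Y h) (Y' h) => x s y y' x0 h1 h2.
  by field; rewrite !gt_eqF.
rewrite /newton_step /ratio.
have -> : forall y y' I I' J : R, y - G^-1 * (I - J) - (y' - G^-1 * (I' - J)) =
  y - y' - G^-1 * (I - I') by move=> *; ring.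
rewrite D1; field; by rewrite gt_eqF.
Qed.

Let Y_ n : R3 R -> R := iter n newton_step (fun=> 0).

(** The increments are products of the previous increment with [ratio], hence
    halve in norm at each step. *)
Lemma family_iterates n :
  family (fun=> dt * (2^-1 ^+ n.+1)) (fun _ h => Y_ n.+1 h - Y_ n h) /\
  family (fun=> dt * (1 - 2^-1 ^+ n)) (fun _ h => Y_ n h).
Proof.
have le_small M Z : M <= dt -> family (fun=> M) (fun _ h => Z h) -> small Z.
  by move=> Mdt; apply: family_ext.
have half m : 0 <= (2^-1 : R) ^+ m <= 1.
  by rewrite exprn_ge0 ?invr_ge0//= exprn_ile1 ?invr_ge0// invf_le1// ler1n.
have [t0 t2 t3] := thP; have [h1 h2 h3] := th0P.
elim: n => [|n [IH1 IH2]].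
  split.
    have hz : family (fun=> 2 * th0 / d) (fun q h => (a q - w q h)^-1 - (a q)^-1).
      by apply: family_inv_diff => //; [exact: ltW|lra].
    have hI := family_integral r0 mD Doo hz (fun q _ => lexx _).
    have mc : measurable_fun D (fun=> - G^-1 : R) by exact: measurable_cst.
    apply: (family_ext _ _ (@family_scale _ _ _ _ _ r0 (fun=> - G^-1) _ _ mc hI)).
      move=> q _; rewrite normrN ger0_norm ?invr_ge0 ?(ltW G0)//.
      have -> : G^-1 * (2 * th0 / d * fine (mu D)) = 2 * c * th0 * d.
        by rewrite /c; field; rewrite !gt_eqF.
      have : 8 * c * th0 * d <= th * d by rewrite ler_pM2r.
      by rewrite expr1 /dt; lra.
    move=> q h Dq rh; rewrite /Y_ /= /newton_step subr0 sub0r mulNr.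
    congr (- (_ * _)); rewrite -RintegralB//.
    - by apply: eq_Rintegral => x _; rewrite addr0.
    - have I1 := family_integrable hz rh.
      have I2 : mu.-integrable D (EFin \o (fun q => (a q)^-1)).
        apply: (integrable_of_bounded mD Doo (C := d^-1)); first exact: measurable_funV.
        by move=> x Dx; have /andP[i1 i2] := inv_le_inv Dx; rewrite gtr0_norm.
      apply: eq_integrable (integrableD mD I1 I2) => // x _ /=.
      by rewrite -EFinD subrK addr0.
    - apply: (integrable_of_bounded mD Doo (C := d^-1)); first exact: measurable_funV.
      by move=> x Dx; have /andP[i1 i2] := inv_le_inv Dx; rewrite gtr0_norm.
  have := family_cst r (@measurable_cst _ _ Q R D 0).
  by apply: family_ext => // q _; rewrite normr0 expr0 subrr mulr0.
have IH2' : family (fun=> dt * (1 - 2^-1 ^+ n.+1)) (fun _ h => Y_ n.+1 h).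
  apply: (family_ext _ _ (family_add r0 IH2 IH1 _ _)).
  - by move=> q _; rewrite exprS; lra.
  - by move=> q h _ _; rewrite addrC subrK.
  - by move=> q _; rewrite mulr_ge0 ?(ltW dt0)// subr_ge0; have /andP[] := half n.
  - by move=> q _; rewrite mulr_ge0 ?(ltW dt0)//; have /andP[] := half n.+1.
split => //.
have sm m Z : family (fun=> dt * (1 - 2^-1 ^+ m)) (fun _ h => Z h) -> small Z.
  apply: le_small; rewrite ler_piMr ?(ltW dt0)//; have /andP[hm _] := half m; lra.
have s1 := sm _ _ IH2'; have s0 := sm _ _ IH2.
have hr := family_ratio s1 s0.
apply: (family_ext _ _ (family_mul r0 IH1 hr _)) => // [q _|q h Dq rh].
  by rewrite [in leRHS]exprSr mulrA.
by rewrite -newton_step_diff.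
Qed.

(** The limit is the sum of the increments, a power series by completeness, and a
    fixed point of the Newton map because the map is a contraction
    pointwise. *)
Lemma newton_limit : D !=set0 -> exists Y : R3 R -> R,
  family (fun=> dt) (fun _ h => Y h) /\ forall h, cube r h ->
    (forall q, D q -> 0 < a q - (w q h + Y h)) /\
    \int[mu]_(q in D) (a q - (w q h + Y h))^-1 = \int[mu]_(q in D) (a q)^-1.
Proof.
move=> [q0 Dq0].
have geo N : \sum_(0 <= n < N) dt * 2^-1 ^+ n.+1 <= dt.
  have -> : \sum_(0 <= n < N) dt * 2^-1 ^+ n.+1 = dt * (1 - 2^-1 ^+ N).
    elim: N => [|N IH]; first by rewrite big_geq// expr0 subrr mulr0.
    by rewrite big_nat_recr//= IH !exprS; field.
  by rewrite ler_piMr ?(ltW dt0)// lerBlDr lerDl exprn_ge0// invr_ge0.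
pose g n h := Y_ n.+1 h - Y_ n h.
have gB n h : cube r h -> `|g n h| <= dt * 2^-1 ^+ n.+1.
  by move=> rh; have [hg _] := family_iterates n; exact: (family_bound hg Dq0 rh).
have cvgY h : cube r h -> cvgn (series (fun n => g n h)).
  move=> rh; apply: (@abs_series_cvg R _ dt) => N.
  by apply: le_trans (geo N); apply: ler_sum => n _; exact: gB.
pose Y h := limn (series (fun n => g n h)).
have serY h n : series (fun n => g n h) n = Y_ n h.
  elim: n => [|n IH]; first by rewrite /series /= big_geq.
  by rewrite seriesSr IH /g addrC subrK.
have YY h : cube r h -> Y_ ^~ h @ \oo --> Y h.
  move=> rh; have : series (fun n => g n h) @ \oo --> Y h := cvgY h rh.
  by rewrite (_ : series _ = Y_ ^~ h)//; apply/funext => n; exact: serY.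
have sY : small Y.
  apply: (@family_series _ _ _ _ _ r0 (fun n _ => dt * 2^-1 ^+ n.+1) _
    (fun n _ h => g n h)).
  - by move=> n; have [] := family_iterates n.
  - by move=> q _ N; exact: geo.
  - by move=> q h _ rh; exact: cvgY.
exists Y; split => // h rh; split; first by move=> q Dq; exact: denominator_gt0.
have fixY : newton_step Y h = Y h.
  have lim2 : (fun n => Y_ n.+1 h) @ \oo --> newton_step Y h.
    apply/cvgrPdist_le => eps eps0.
    have /cvgrPdist_le/(_ _ eps0) H := YY h rh; near=> n.
    have sn : small (Y_ n).
      have [_] := family_iterates n; apply: family_ext => // q _.
      by rewrite ler_piMr ?(ltW dt0)// lerBlDr lerDl exprn_ge0// invr_ge0.
    rewrite [Y_ n.+1 h]/(newton_step (Y_ n) h) newton_step_diff// normrM.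
    have := family_bound (family_ratio sY sn) Dq0 rh.
    have : `|Y h - Y_ n h| <= eps by near: n.
    have := normr_ge0 (Y h - Y_ n h); have := normr_ge0 (ratio Y (Y_ n) h); nra.
  have lim1 : (fun n => Y_ n.+1 h) @ \oo --> Y h.
    by have := YY h rh; rewrite -(cvg_shiftS (Y_ ^~ h)).
  exact: (cvg_unique _ lim2 lim1).
move: fixY; rewrite /newton_step => /eqP; rewrite subr_eq addrC -subr_eq subrr eq_sym.
by rewrite mulf_eq0 invr_eq0 gt_eqF//= subr_eq0 => /eqP.
Unshelve. all: end_near. Qed.

End Step.

(** The admissible size of the perturbation does not depend on the radius [r] of
    the cube, so that it can be reached afterwards by shrinking [r]. *)
Lemma implicit_level : D !=set0 -> exists2 rho, 0 < rho &
  forall (r : R) (w : Q -> R3 R -> R), 0 < r ->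
  analytic_family D r (fun=> rho) w ->
  exists (M : R) (Y : R3 R -> R),
    analytic_family D r (fun=> M) (fun _ h => Y h) /\ forall h, cube r h ->
    (forall q, D q -> 0 < a q - (w q h + Y h)) /\
    \int[mu]_(q in D) (a q - (w q h + Y h))^-1 = \int[mu]_(q in D) (a q)^-1.
Proof.
move=> D0; have [h _ _] := th0P; exists (th0 * d); first by rewrite mulr_gt0.
move=> r w r0 hw; exists (th * d / 2); exact: newton_limit.
Qed.

End ImplicitLevel.

(** * The eigenvalue as a function of the quasi-momentum *)

Section Level.
Variables (R : realType) (ga : R).
Hypothesis ga0 : 0 < ga.
Local Notation mu := (leb3 R).
Local Notation MR := (measurableTypeR R).
Local Notation T := (@torus R : set (R3 MR)).
Local Notation vol := ((2 * pi) ^+ 3 : R).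
Local Notation F k := (inv_symbol_integral (calE k ga)).

Lemma cosD2pi_int (x : R) (n : int) : cos (x + n%:~R * (2 * pi)) = cos x.
Proof.
have h (m : nat) y : cos (y + m%:R * (2 * pi)) = cos y :> R.
  elim: m => [|m IH]; first by rewrite mul0r addr0.
  by rewrite -natr1 mulrDl mul1r addrA cosD2pi1.
case: n => m; first exact: h.
by rewrite NegzE rmorphN mulNr -[in LHS](h m.+1) subrK.
Qed.

Lemma cos_mod2pi1 (t s : R) : cos (mod2pi1 t + s) = cos (t + s).
Proof. by rewrite /mod2pi1 -mulNr -rmorphN addrAC cosD2pi_int. Qed.

(** The candidate eigenvalue.  It is defined for every k in R^3, not only on the
    torus, which makes its periodicity a statement about the function itself. *)
Definition level (k : R3 R) : R :=
  xget 0 [set l | l < band_bottom ga k /\ F k l = critical ga].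

Lemma levelE k l : l < band_bottom ga k -> F k l = critical ga -> level k = l.
Proof.
move=> lm Fl; apply: xget_unique => // l' [lm' Fl'].
apply: (inv_symbol_integral_inj (measurable_calE k ga) (calE_ge ga k)
  (calE_le ga0 k)) => //.
by rewrite Fl'.
Qed.

Lemma levelP k : torus k -> k != 0 ->
  [/\ 0 < level k, level k < band_bottom ga k & F k (level k) = critical ga].
Proof.
move=> Tk k0; have [l1 [l0 l1m Fl1]] := inv_symbol_integral_gt ga0 Tk k0.
have [l [h1 h2 h3]] := inv_symbol_integral_ivt (measurable_calE k ga)
  (calE_ge ga k) l0 l1m (inv_symbol_integral0_lt ga0 Tk k0) Fl1.
by rewrite (levelE h2 h3).
Qed.

Lemma band_bottom_ext k k' : cos k.1.1 = cos k'.1.1 -> cos k.1.2 = cos k'.1.2 ->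
  cos k.2 = cos k'.2 -> band_bottom ga k = band_bottom ga k'.
Proof. by move=> h1 h2 h3; rewrite /band_bottom /amplitude h1 h2 h3. Qed.

Lemma level_ext k k' : cos k.1.1 = cos k'.1.1 -> cos k.1.2 = cos k'.1.2 ->
  cos k.2 = cos k'.2 -> level k = level k'.
Proof.
move=> h1 h2 h3; have bb := band_bottom_ext h1 h2 h3.
rewrite /level; congr xget; apply/seteqP.
have e l : l < band_bottom ga k -> F k l = F k' l.
  move=> lm; rewrite !inv_symbol_integral_profile -?bb//.
  by apply: eq_Rintegral => q _; rewrite /band_profile /amplitude h1 h2 h3.
split => l /= [lm Fl]; first by rewrite -bb -e.
by rewrite bb e ?bb.
Qed.

Lemma level_mod2pi k : level (mod2pi k) = level k.
Proof.
by apply: level_ext; rewrite /mod2pi /=;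
  rewrite -[mod2pi1 _]addr0 cos_mod2pi1 addr0.
Qed.

Lemma levelN k : level (- k) = level k.
Proof. by apply: level_ext; rewrite /= cosN. Qed.

Section Perturbation.
Variable r : R.
Hypotheses (r0 : 0 < r) (r2 : r <= 2^-1).
Local Notation family := (analytic_family T r).

(** The addition formula separates the parameter u from the increment h; each of
    the two products has norm at most 2 r. *)
Lemma family_cos_shift (be : nat * nat * nat) (u : R3 MR -> R) :
  weight r be = r -> measurable_fun setT u ->
  family (fun=> 4 * r) (fun q h => cos (u q + monomial be h) - cos (u q)).
Proof.
move=> wr mu_.
have mc : measurable_fun T (fun q => cos (u q)).
  apply: measurable_funTS; apply: measurableT_comp mu_.
  exact: (continuous_measurable_fun (@continuous_cos R)).
have ms : measurable_fun T (fun q => - sin (u q)).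
  apply: measurable_funTS; apply: measurable_funN.
  apply: measurableT_comp mu_; exact: (continuous_measurable_fun (@continuous_sin R)).
have h1 := @family_scale _ _ _ _ _ r0 (fun q => cos (u q)) _ _ mc
  (family_cosm1 _ r0 wr r2).
have h2 := @family_scale _ _ _ _ _ r0 (fun q => - sin (u q)) _ _ ms
  (family_sin _ r0 wr r2).
have r20 : 0 <= 2 * r by rewrite mulr_ge0// ltW.
apply: (family_ext _ _ (family_add r0 h1 h2 _ _)).
- move=> q _; rewrite normrN -mulrDl (_ : 4 * r = 2 * (2 * r)); last by ring.
  rewrite ler_wpM2r//; apply: (@le_trans _ _ (1 + 1)); last by lra.
  by apply: lerD; [exact: cos_max|exact: sin_max].
- by move=> q h _ _; rewrite cosD; ring.
- by move=> q _; rewrite mulr_ge0.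
- by move=> q _; rewrite mulr_ge0.
Qed.

Lemma family_calE_shift k :
  family (fun=> 12 * ga * r) (fun q h => calE k ga q - calE (k + h) ga q).
Proof.
have cs (c : R) : continuous (fun t : R => c - t).
  by move=> t; apply: cvgB; [exact: cvg_cst|exact: cvg_id].
have mcs c := continuous_measurable_fun (cs c).
have w1 : weight r (1, 0, 0)%N = r by rewrite /weight /monomial /= expr1 !expr0 !mulr1.
have w2 : weight r (0, 1, 0)%N = r.
  by rewrite /weight /monomial /= expr1 !expr0 mulr1 mul1r.
have w3 : weight r (0, 0, 1)%N = r.
  by rewrite /weight /monomial /= expr1 !expr0 !mul1r.
have h1 := family_cos_shift w1 (measurable_coord1 (mcs k.1.1)).
have h2 := family_cos_shift w2 (measurable_coord2 (mcs k.1.2)).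
have h3 := family_cos_shift w3 (measurable_coord3 (mcs k.2)).
have r40 : 0 <= 4 * r by rewrite mulr_ge0// ltW.
have hs := family_add r0 (family_add r0 h1 h2 (fun _ _ => r40) (fun _ _ => r40)) h3
  (fun _ _ => addr_ge0 r40 r40) (fun _ _ => r40).
have mg : measurable_fun T (fun=> ga) by exact: measurable_cst.
apply: (family_ext _ _ (@family_scale _ _ _ _ _ r0 (fun=> ga) _ _ mg hs)).
- by move=> q _; rewrite (gtr0_norm ga0); lra.
- move=> q h _ _; rewrite /monomial /= !expr0 !expr1 !mul1r !mulr1.
  rewrite /calE /dispersion /=.
  rewrite (addrAC k.1.1 h.1.1) (addrAC k.1.2 h.1.2) (addrAC k.2 h.2); ring.
Qed.

End Perturbation.

(** Near k the symbol is calE k minus a family of size proportional to the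
    radius, so [implicit_level] yields a power series Y with
    F (k + h) (level k + Y h) critical.  The denominators stay positive, so
    level k + Y h lies below the band at k + h, and by uniqueness it is
    level (k + h). *)
Lemma level_analytic k : torus k -> k != 0 -> real_analytic_at level k.
Proof.
move=> Tk k0; have [l0 lm Fl] := levelP Tk k0; set l := level k in l0 lm Fl.
have g0 : 0 < 1 + ga by rewrite addr_gt0.
pose a (q : R3 MR) := calE k ga q - l.
have d0 : 0 < band_bottom ga k - l by rewrite subr_gt0.
have da q : T q -> band_bottom ga k - l <= a q by move=> _; rewrite lerD2r calE_ge.
have ma : measurable_fun T a.
  apply: measurable_funTS; apply: measurable_funB; first exact: measurable_calE.
  exact: measurable_cst.
have hi0 : 0 < 6 * (1 + ga) - l.
  by rewrite subr_gt0 (lt_le_trans lm)// (le_trans (calE_ge ga k 0))// calE_le.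
have G0 : 0 < \int[mu]_(q in T) ((a q)^-1 ^+ 2).
  apply: (@lt_le_trans _ _ ((6 * (1 + ga) - l)^-1 ^+ 2 * vol)).
    by rewrite mulr_gt0 ?vol_gt0// exprn_gt0// invr_gt0.
  have mT := @measurable_torus R.
  rewrite -Rintegral_torus_cst; apply: le_Rintegral => //.
  - by apply: (@integrable_torus _ _ `|(6 * (1 + ga) - l)^-1 ^+ 2|) => // q _; exact: lexx.
  - apply: (@integrable_torus _ _ ((band_bottom ga k - l)^-1 ^+ 2)).
      by apply: measurable_funX; exact: measurable_funV.
    move=> q Tq; have /andP[i1 i2] := inv_le_inv d0 da Tq.
    by rewrite normrX gtr0_norm// lerXn2r ?nnegrE ?(ltW i1)// invr_ge0 ltW.
  - move=> q Tq; have aq := lt_le_trans d0 (da q Tq).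
    rewrite lerXn2r ?nnegrE ?invr_ge0 ?(ltW aq) ?(ltW hi0)//.
    by rewrite lef_pV2 ?posrE// lerD2r calE_le.
have T0 : T 0.
  have := pi_gt0 R => p0.
  by split; [split|]; rewrite /= in_itv/= oppr_lt0 p0 ltW.
have [rho rho0 H] := implicit_level (@measurable_torus R) (leb3_torus_fin R)
  ma d0 da G0 (ex_intro _ _ T0).
pose r := Num.min 2^-1 (rho / (12 * ga)).
have r0 : 0 < r by rewrite lt_min invr_gt0 ltr0n/= divr_gt0// mulr_gt0.
have r2 : r <= 2^-1 by rewrite ge_min lexx.
have rr : 12 * ga * r <= rho.
  by rewrite -ler_pdivlMl ?mulr_gt0// mulrC ge_min lexx orbT.
have hw := family_ext (fun q _ => rr) (fun q h _ _ => erefl) (family_calE_shift r0 r2 k).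
have [M [Y [hY HY]]] := H r _ r0 hw.
have c0 : cube r (0 : R3 R) by split; rewrite /= normr0 ltW.
have M0 : 0 <= M := le_trans (normr_ge0 _) (family_bound hY T0 c0).
have ml : measurable_fun T (fun=> l) by exact: measurable_cst.
have hlY := family_add r0 (family_cst r ml) hY (fun q _ => normr_ge0 _) (fun _ _ => M0).
apply: (family_real_analytic r0 hlY T0) => x rx.
have [pos eqI] := HY _ rx.
have e q : a q - (calE k ga q - calE (k + (x - k)) ga q + Y (x - k)) =
   calE x ga q - (l + Y (x - k)) by rewrite (addrC k) subrK /a; ring.
apply: levelE.
- have [q Tq <-] := calE_attained ga x; rewrite -subr_gt0 -e; exact: pos.
- rewrite -Fl -[RHS]eqI; apply: eq_Rintegral => q _; by rewrite -e.
Qed.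

End Level.

Theorem theorem4p3 (R : realType) (gamma : R) (hgamma : 0 < gamma) :
  zero_energy_resonance gamma /\
  exists z : R3 R -> R,
    (forall k : R3 R, torus k -> k != 0 ->
       [/\ 0 < z k, z k < ess_bottom (hop gamma k),
           is_eigenvalue (hop gamma k) (z k) &
           forall lambda : R, is_eigenvalue (hop gamma k) lambda ->
             lambda < ess_bottom (hop gamma k) -> lambda = z k]) /\
    (forall k : R3 R, torus k -> k != 0 -> z (mod2pi (- k)) = z k) /\
    (forall k : R3 R, torus k -> k != 0 -> torus_real_analytic_at z k).
Proof.
split; first exact: resonance.
exists (level gamma); split; last split.
- move=> k Tk k0; have [l0 lm Fl] := levelP hgamma Tk k0; rewrite ess_bottomE//.
  split => //.
    exists (fun q => ((calE k gamma q - level gamma k)^-1)%:C).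
    exact: eigenfunction_inv.
  move=> l ev llm; apply/esym; apply: (levelE hgamma llm).
  exact: eigenvalue_critical.
- by move=> k _ _; rewrite level_mod2pi levelN.
- move=> k Tk k0; rewrite /torus_real_analytic_at.
  rewrite (_ : (fun x => _) = level gamma); first exact: level_analytic.
  by apply/funext => x; exact: level_mod2pi.
Qed.
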